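(* In the setting of the context (genuinely nonlinear $k$-th field, $\det A_{11}\neq 0$), there is a constant $C_2>0$, depending only on the functions $A,E,B,G$ and on $u^\ast$, such that the following holds. Let $u^+,\bar u,u_b\in\mathbb R^N$ be close to $u^\ast$ and let $s_k$, $(\xi_{\ell+1},\dots,\xi_k)$, $(\xi'_{\ell+1},\dots,\xi'_{k-1},s'_k,s'_{k+1},\dots,s'_N)$ be small reals such that $$\bar u=t_k(u^+,s_k)\quad\text{with}\quad\varsigma_k(u^+,s_k)<0,$$ $$\beta\big(\phi(\bar u,\xi_{\ell+1},\dots,\xi_{k-1},\xi_k),u_b\big)=0,$$ $$\beta\big(\phi(\cdot,\xi'_{\ell+1},\dots,\xi'_{k-1},s'_k)\circ t_{k+1}(\cdot,s'_{k+1})\circ\dots\circ t_N(u^+,s'_N),u_b\big)=0,$$ and $$\xi_k\le\underline s(t_k(u^+,s_k))\ \text{ if }\lambda_k(t_k(u^+,s_k))\le0,\qquad \xi_k=0\ \text{ if }\lambda_k(t_k(u^+,s_k))>0 .$$ Then $$\sum_{i=\ell+1}^{k-1}|\xi_i-\xi'_i|+|s'_k-(\xi_k+s_k)|+\sum_{i=k+1}^N|s'_i|\le C_2\,|s_k|\Big([\varsigma_k(u^+,s_k)]^-+|\xi_k|\Big),$$ where $[\cdot]^-$ denotes the negative part.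
   Context: System. $g(v)_t+f(v)_x=0$ is considered together with its viscous approximation, which in variables $u$ (smooth change of variables $v=v(u)$) reads $E(u)u_t+A(u)u_x=B(u)u_{xx}+G(u,u_x)u_x$ with smooth coefficients. Write $u=(u_1,u_2)\in\mathbb R^h\times\mathbb R^{N-h}$, $h=\dim\ker B$, and use the corresponding blocks. For every $u$: $B=\mathrm{diag}(0_{h\times h},B_{22})$ with $B_{22}$ symmetric positive definite; $A=\begin{pmatrix}A_{11}&A_{21}^t\\ A_{21}&A_{22}\end{pmatrix}$ is symmetric; $E=\mathrm{diag}(E_{11},E_{22})$ is symmetric positive definite; $G=\begin{pmatrix}0&0\\ G_1&G_2\end{pmatrix}$, $G_1$ depending on $u$ and the last $N-h$ components of $u_x$ and vanishing when these vanish, $G_2$ depending on $u,u_x$ and vanishing when $u_x=0$. No eigenvector of $E^{-1}A(u)$ lies in $\ker B(u)$. $E^{-1}A(u)$ has $N$ distinct real eigenvalues with $\lambda_1<\dots<\lambda_{k-1}\le-c<0<c\le\lambda_{k+1}<\dots<\lambda_N$ and eigenvectors $r_1,\dots,r_N$; $\lambda_k(u^\ast)=0$. Each field is genuinely nonlinear or linearly degenerate, and the $k$-th is genuinely nonlinear: $\nabla\lambda_k\cdot r_k\ge d>0$. Finally $\det A_{11}(u)\ne0$ for every $u$, and $\ell$ is the number of negative eigenvalues of $A_{11}$. All states are in a sufficiently small neighborhood of $u^\ast$ and all parameters are sufficiently small. Boundary function. $\beta(u,u_b)=(\pi_{11}(u_1-u_{1b}),u_2-u_{2b})$, where $\pi_{11}$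 is the projection of $\mathbb R^h$ onto the span of the eigenvectors of $A_{11}$ (at $u_b$) with positive eigenvalues. Boundary layers. The equation $A(u)u'=B(u)u''+G(u,u')u'$ is equivalent to the first order system $\omega'=a(\omega)$, $\omega=(u_1,u_2,z_2)\in\mathbb R^{2N-h}$: $$u_1'=-A_{11}^{-1}A_{21}^tz_2,\quad u_2'=z_2,\quad z_2'=B_{22}^{-1}\big[(G_1-A_{21})A_{11}^{-1}A_{21}^t+A_{22}-G_2\big]z_2 .$$ Let $\pi_u(u,z_2)=u$. Fix a center manifold $\mathcal M^c$ at $\omega^\ast=(u^\ast,0)$; near $\omega^\ast$ it is $\{(u,z_cp_c(u,z_c)):z_c\in\mathbb R\}$, with $p_c$ a regular $\mathbb R^{N-h}$-valued function with $p_c^tB_{22}p_c\equiv1$ and $p_c(u^\ast,0)\in\ker(-A_{21}A_{11}^{-1}A_{21}^t+A_{22})(u^\ast)$. On $\mathcal M^c$ the system becomes $u'=z_c\,r_c(u,z_c)$, $z_c'=z_c\,\theta_c(u,z_c)$, where $r_c=(-A_{11}^{-1}A_{21}^tp_c,\,p_c)$, $\theta_c$ is real valued and $\theta_c(u^\ast,0)=0$. The eigenvector $r_k$ is normalized so that $r_k(u)=r_c(u,0)$ whenever $\lambda_k(u)=0$. Set $b_k(\widetilde u,s)=(u,z_cp_c(u,z_c))|_{\tau=s}$, where $(u,z_c)$ solves $\frac{du}{d\tau}=r_c(u,z_c)$, $\frac{dz_c}{d\tau}=\theta_c(u,z_c)$, $u(0)=\widetilde u$, $z_c(0)=0$. Wave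 curves (of left states). $i_i(\widetilde u,\cdot)$ is the integral curve of $r_i$ with $i_i(\widetilde u,0)=\widetilde u$; $h_i(\widetilde u,\cdot)$ is the Hugoniot curve, $f\circ v(h_i(\widetilde u,s))-f\circ v(\widetilde u)=\sigma_i(\widetilde u,s)[g\circ v(h_i(\widetilde u,s))-g\circ v(\widetilde u)]$ with $\sigma_i(\widetilde u,s)$ close to $\lambda_i(\widetilde u)$. If the $i$-th field is genuinely nonlinear, $t_i(\widetilde u,s)=i_i(\widetilde u,s)$ for $s<0$ (rarefactions) and $=h_i(\widetilde u,s)$ for $s\ge0$ (Lax shocks); if it is linearly degenerate $t_i=i_i$. Here $\widetilde u$ is the right state and $t_i(\widetilde u,s)$ the left state. $\underline s(\widetilde u)$ and $\bar s(\widetilde u)$ are the unique values with $\sigma_k(\widetilde u,\underline s(\widetilde u))=0$ and $\lambda_k(i_k(\widetilde u,\bar s(\widetilde u)))=0$. The curve $t_k$ is parametrized so that $(t_k(\widetilde u,\underline s(\widetilde u)),0)=b_k(\widetilde u,\underline s(\widetilde u))$ if $\lambda_k(\widetilde u)\le0$. Set $\varsigma_k(\widetilde u,s)=\sigma_k(\widetilde u,s)$ if $s\ge0$ and $\varsigma_k(\widetilde u,s)=\lambda_k(t_k(\widetilde u,s))$ if $s<0$. Characteristic curves. If $\lambda_k(\widetilde u)<0$: $\gamma_k(\widetilde u,s)=b_k(\widetilde u,s)$ for $s<\underline s(\widetilde u)$ and $(t_k(\widetilde u,s),0)$ for $s\ge\underline s(\widetilde u)$. If $\lambda_k(\widetilde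 u)\ge0$: $\gamma_k(\widetilde u,s)=b_k(t_k(\widetilde u,\bar s(\widetilde u)),s-\bar s(\widetilde u))$ for $s<\bar s(\widetilde u)$ and $(t_k(\widetilde u,s),0)$ for $s\ge\bar s(\widetilde u)$. Set $\zeta_k=\pi_u\circ\gamma_k$. The map $\phi$. With $\xi=(\xi_{\ell+1},\dots,\xi_{k-1})$, $\check\omega=(\zeta_k(\widetilde u,s_k),0)$ and $\omega_0(0)=\gamma_k(\widetilde u,s_k)$, $$\phi(\widetilde u,\xi,s_k)=\pi_u\big(m_-(\check\omega,\xi)-\check\omega+m_p(\check\omega,\omega_0(0),\xi)+\omega_0(0)\big)=\psi_s(\zeta_k(\widetilde u,s_k),\xi)+\psi_p(\widetilde u,\xi,s_k),$$ with $\psi_s=\pi_u m_-$, $\psi_p=\pi_u m_p$. Here $m_-(\check\omega,\cdot)$ is the Lipschitz parametrization of the $(k-1-\ell)$-dimensional uniformly stable manifold ($m_-(\check\omega,0)=\check\omega$; orbits of $\omega'=a(\omega)$ starting on it converge exponentially to $\check\omega$), and $m_p$ is the Lipschitz map given by the Slaving Manifold Theorem: the orbit $\omega$ starting at $m_-(\check\omega,\xi)-\check\omega+m_p+\omega_0(0)$ satisfies $\lim_{y\to+\infty}|\omega(y)-\omega_0(y)|=0$, $\omega_0$ being the orbit starting at $\omega_0(0)$, and $|m_p(\check\omega,\omega_0(0),\xi)|\le C|\omega_0(0)-\check\omega||\xi|$. It is part of the known theory (Bianchini--Spinolo, via Clarke's theorem) that, writing $P(u)=(\pi_{11}u_1,u_2)$,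 the map $(\xi',s'_k,\dots,s'_N)\mapsto P\big(\phi(\cdot,\xi',s'_k)\circ t_{k+1}(\cdot,s'_{k+1})\circ\dots\circ t_N(u^+,s'_N)\big)$ is locally invertible onto the $(N-\ell)$-dimensional range of $P$, with Lipschitz inverse, uniformly for $u^+$ near $u^\ast$. *)

(* Defs.v *)
From mathcomp Require Import all_boot all_order all_algebra.
From mathcomp Require Import all_classical all_reals all_analysis.

Set Implicit Arguments.
Unset Strict Implicit.
Unset Printing Implicit Defensive.

Import Order.TTheory GRing.Theory Num.Theory.
Import numFieldNormedType.Exports.

Local Open Scope classical_set_scope.
Local Open Scope ring_scope.

Section Regularity.
Context {R : realType} {V W : normedModType R}.

(* For finite-dimensional V (the only use below) this is the usual class C^n:
   all iterated directional derivatives up to order n exist and are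
   continuous on U. *)
Fixpoint classC (n : nat) (U : set V) (f : V -> W) : Prop :=
  (forall x, U x -> {for x, continuous f}) /\
  if n is n'.+1 then
    forall w : V, (forall x, U x -> derivable f x w) /\ classC n' U ('D_w f)
  else True.

Definition classC_near (n : nat) (x : V) (f : V -> W) : Prop :=
  exists2 U : set V, open_nbhs x U & classC n U f.

Definition smooth_near (x : V) (f : V -> W) : Prop :=
  exists2 U : set V, open_nbhs x U & forall n, classC n U f.

Definition lipschitz_near (x : V) (f : V -> W) : Prop :=
  exists L : R, \forall p \near (x, x), `|f p.1 - f p.2| <= L * `|p.1 - p.2|.

End Regularity.

Section LinearAlgebra.
Context {R : realType}.

Definition posdef (n : nat) (M : 'M[R]_n) : Prop :=
  M^T = M /\ forall x : 'cV[R]_n, x != 0 -> 0 < (x^T *m M *m x) 0 0.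

(* Eigenvalues are counted with multiplicity. *)
Definition nb_neg_eigenvalues (n : nat) (M : 'M[R]_n) (l : nat) : Prop :=
  exists2 s : seq R, char_poly M = \prod_(a <- s) ('X - a%:P)
    & count (fun a => a < 0) s = l.

Definition pos_eigenspan (n : nat) (M : 'M[R]_n) : set 'cV[R]_n :=
  [set x | exists (p : nat) (w : 'I_p -> 'cV[R]_n),
     (forall i, exists2 a : R, 0 < a & M *m w i = a *: w i) /\
     x = \sum_(i < p) w i].

(* The projections are orthogonal; for symmetric M, the kernel of
   [pos_proj M] is the span of the eigenvectors with eigenvalue <= 0. *)
Definition orthogonal_projection (n : nat) (X : set 'cV[R]_n)
    (Pi : 'M[R]_n) : Prop :=
  [/\ Pi^T = Pi, Pi *m Pi = Pi & range (fun x : 'cV[R]_n => Pi *m x) = X].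

Definition pos_proj (n : nat) (M : 'M[R]_n) : 'M[R]_n :=
  get [set Pi | orthogonal_projection (pos_eigenspan M) Pi].

End LinearAlgebra.

Section Setting.
Context {R : realType} {h m : nat}.

(* N = h + m, and u = col_mx u1 u2. *)
Notation state := 'cV[R]_(h + m).

(* omega = (u, z2); pi_u is the first projection. *)
Notation phase := ('cV[R]_(h + m) * 'cV[R]_m)%type.

Record system := System {
  f_ : state -> state;
  g_ : state -> state;
  v_ : state -> state;
  E11 : state -> 'M[R]_h;
  E22 : state -> 'M[R]_m;
  A11 : state -> 'M[R]_h;
  A21 : state -> 'M[R]_(m, h);
  A22 : state -> 'M[R]_m;
  B22 : state -> 'M[R]_m;
  G1 : state * 'cV[R]_m -> 'M[R]_(m, h);
  G2 : state * state -> 'M[R]_m;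
  ustar : state }.

Section System.
Variable S : system.

Definition Emx (u : state) : 'M[R]_(h + m) := block_mx (E11 S u) 0 0 (E22 S u).
Definition Amx (u : state) : 'M[R]_(h + m) :=
  block_mx (A11 S u) (A21 S u)^T (A21 S u) (A22 S u).
Definition Bmx (u : state) : 'M[R]_(h + m) := block_mx 0 0 0 (B22 S u).

Definition EA (u : state) : 'M[R]_(h + m) := invmx (Emx u) *m Amx u.

Definition smooth_coefficients : Prop :=
  [/\ smooth_near (ustar S) (E11 S) /\ smooth_near (ustar S) (E22 S),
      [/\ smooth_near (ustar S) (A11 S), smooth_near (ustar S) (A21 S)
        & smooth_near (ustar S) (A22 S)],
      smooth_near (ustar S) (B22 S),
      smooth_near (ustar S, 0) (G1 S) & smooth_near (ustar S, 0) (G2 S)].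

(* In the variable u, the left-hand side of g(v)_t + f(v)_x = 0 is
   Mc(u) (E(u) u_t + A(u) u_x) for some invertible Mc(u). *)
Definition conservative_form : Prop :=
  [/\ smooth_near (v_ S (ustar S)) (f_ S), smooth_near (v_ S (ustar S)) (g_ S),
      smooth_near (ustar S) (v_ S),
      (\forall u \near ustar S, forall w, 'D_w (v_ S) u = 0 -> w = 0)
    & exists Mc : state -> 'M[R]_(h + m), \forall u \near ustar S,
        Mc u \in unitmx /\
        forall w : state,
          'D_w (g_ S \o v_ S) u = Mc u *m Emx u *m w /\
          'D_w (f_ S \o v_ S) u = Mc u *m Amx u *m w].

Definition structure_conditions : Prop :=
  [/\ (\forall u \near ustar S, posdef (B22 S u)),
      (\forall u \near ustar S, (Amx u)^T = Amx u),
      (\forall u \near ustar S, posdef (Emx u)),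
      (\forall u \near ustar S, G1 S (u, 0) = 0 /\ G2 S (u, 0) = 0)
    & (\forall u \near ustar S, forall (a : R) (x : state),
         x != 0 -> EA u *m x = a *: x -> Bmx u *m x != 0)].

Definition noncharacteristic_block (l : nat) : Prop :=
  \forall u \near ustar S, \det (A11 S u) != 0 /\ nb_neg_eigenvalues (A11 S u) l.

Definition parabolic_reduction (ub u : state) : state :=
  col_mx (pos_proj (A11 S ub) *m usubmx u) (dsubmx u).

Definition beta (u ub : state) : state :=
  col_mx (pos_proj (A11 S ub) *m (usubmx u - usubmx ub)) (dsubmx u - dsubmx ub).

(* u' as a function of (u, p) in the layer system, where p = u_2'. *)
Definition layer_slope (u : state) (p : 'cV[R]_m) : state :=
  col_mx (- (invmx (A11 S u) *m (A21 S u)^T *m p)) p.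

Definition avf (om : phase) : phase :=
  let: (u, z2) := om in
  (layer_slope u z2,
   invmx (B22 S u) *m
     ((G1 S (u, z2) - A21 S u) *m invmx (A11 S u) *m (A21 S u)^T
      + A22 S u - G2 S (u, layer_slope u z2)) *m z2).

Definition orbit_from (x : phase) (om : R -> phase) : Prop :=
  [/\ om 0 = x, {within `[0, +oo[, continuous om}
    & forall y : R, 0 < y -> is_derive y (1 : R) om (avf (om y))].

Definition stable_set (c eps : R) (om0 : phase) : set phase :=
  [set x | exists2 om : R -> phase, orbit_from x om
     & forall y : R, 0 <= y -> `|om y - om0| <= eps * expR (- (c * y))].

End System.

Record fields := Fields {
  lam : 'I_(h + m) -> state -> R;
  rv : 'I_(h + m) -> state -> state }.

Section Fields.
Variables (S : system) (F : fields).

Definition genuinely_nonlinear (i : 'I_(h + m)) : Prop :=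
  \forall u \near ustar S, 0 < 'D_(rv F i u) (lam F i) u.

Definition linearly_degenerate (i : 'I_(h + m)) : Prop :=
  \forall u \near ustar S, 'D_(rv F i u) (lam F i) u = 0.

(* Indices are 0-based: i : 'I_(h + m) stands for the field usually numbered
   i + 1. *)
Definition characteristic_fields (k : 'I_(h + m)) : Prop :=
  [/\ (forall i, classC_near 2 (ustar S) (lam F i) /\
                 classC_near 2 (ustar S) (rv F i)),
      (\forall u \near ustar S, forall i,
         rv F i u != 0 /\ EA S u *m rv F i u = lam F i u *: rv F i u),
      (\forall u \near ustar S, forall i j : 'I_(h + m),
         (i < j)%N -> lam F i u < lam F j u),
      (exists2 c : R, 0 < c & \forall u \near ustar S, forall i : 'I_(h + m),
         ((i < k)%N -> lam F i u <= - c) /\ ((k < i)%N -> c <= lam F i u))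
        /\ lam F k (ustar S) = 0
    & (forall i, genuinely_nonlinear i \/ linearly_degenerate i) /\
      (exists2 d : R, 0 < d &
         \forall u \near ustar S, d <= 'D_(rv F k u) (lam F k) u)].

End Fields.

(* [pc] and [thc] are functions of (u, z_c); [bu u] and [bz u] are the two
   components of the solution issuing from (u, 0). *)
Record layers := Layers {
  pc : state * R -> 'cV[R]_m;
  thc : state * R -> R;
  bu : state -> R -> state;
  bz : state -> R -> R }.

Section Layers.
Variables (S : system) (F : fields) (L : layers).

Definition rc (q : state * R) : state := layer_slope S q.1 (pc L q).

Definition center_chart (q : state * R) : phase := (q.1, q.2 *: pc L q).

(* The graph of [center_chart] is a center manifold at (ustar, 0): it is
   invariant, the vector field on it being the image of
   (z_c r_c, z_c theta_c), and it is tangent to the center space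
   {(w, p) | p in ker (A22 - A21 A11^-1 A21^t)(ustar)}. *)
Definition center_manifold : Prop :=
  [/\ classC_near 2 (ustar S, 0) (pc L) /\ classC_near 2 (ustar S, 0) (thc L),
      (\forall q \near (ustar S, 0 : R),
         (pc L q)^T *m B22 S q.1 *m pc L q = 1%:M),
      (- (A21 S (ustar S) *m invmx (A11 S (ustar S)) *m (A21 S (ustar S))^T)
       + A22 S (ustar S)) *m pc L (ustar S, 0) = 0,
      (\forall q \near (ustar S, 0 : R),
         avf S (center_chart q) =
         'D_(q.2 *: rc q, q.2 * thc L q) center_chart q)
    & thc L (ustar S, 0) = 0].

Definition rk_normalized (k : 'I_(h + m)) : Prop :=
  \forall u \near ustar S, lam F k u = 0 -> rv F k u = rc (u, 0).

Definition layer_curves : Prop :=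
  (\forall u \near ustar S, bu L u 0 = u /\ bz L u 0 = 0) /\
  (\forall q \near (ustar S, 0 : R),
     is_derive q.2 (1 : R) (bu L q.1) (rc (bu L q.1 q.2, bz L q.1 q.2)) /\
     is_derive q.2 (1 : R) (bz L q.1) (thc L (bu L q.1 q.2, bz L q.1 q.2))).

Definition b_ (u : state) (s : R) : phase := center_chart (bu L u s, bz L u s).

End Layers.

Record waves := Waves {
  icurve : 'I_(h + m) -> state -> R -> state;
  hcurve : 'I_(h + m) -> state -> R -> state;
  sigma : 'I_(h + m) -> state -> R -> R;
  sunder : state -> R;
  sbar : state -> R }.

Section Waves.
Variables (S : system) (F : fields) (L : layers) (W : waves).

Definition integral_curves : Prop :=
  forall i,
    (\forall u \near ustar S, icurve W i u 0 = u) /\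
    (\forall q \near (ustar S, 0 : R),
       is_derive q.2 (1 : R) (icurve W i q.1) (rv F i (icurve W i q.1 q.2))).

(* The parametrization of the Hugoniot curves is free, except that it is
   nondegenerate and oriented by r_i. *)
Definition hugoniot_curves : Prop :=
  forall i,
    [/\ classC_near 2 (ustar S, 0) (fun q : state * R => hcurve W i q.1 q.2),
        classC_near 2 (ustar S, 0) (fun q : state * R => sigma W i q.1 q.2),
        (\forall u \near ustar S,
           [/\ hcurve W i u 0 = u, sigma W i u 0 = lam F i u
             & exists2 c : R, 0 < c &
                 is_derive (0 : R) (1 : R) (hcurve W i u) (c *: rv F i u)])
      & (\forall q \near (ustar S, 0 : R),
           f_ S (v_ S (hcurve W i q.1 q.2)) - f_ S (v_ S q.1) =
           sigma W i q.1 q.2 *: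
             (g_ S (v_ S (hcurve W i q.1 q.2)) - g_ S (v_ S q.1)))].

Definition tcurve (i : 'I_(h + m)) (u : state) (s : R) : state :=
  if `[< genuinely_nonlinear S F i >] && (0 <= s) then hcurve W i u s
  else icurve W i u s.

(* [z u] is the unique zero of [e u] near 0. *)
Definition unique_small_zero (e : state -> R -> R) (z : state -> R) : Prop :=
  exists2 r : R, 0 < r & \forall u \near ustar S,
    [/\ `|z u| < r, e u (z u) = 0
      & forall s : R, `|s| < r -> e u s = 0 -> s = z u].

Definition critical_parameters (k : 'I_(h + m)) : Prop :=
  unique_small_zero (sigma W k) (sunder W) /\
  unique_small_zero (fun u s => lam F k (icurve W k u s)) (sbar W).

Definition tk_parametrized (k : 'I_(h + m)) : Prop :=
  \forall u \near ustar S, lam F k u <= 0 ->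
    (tcurve k u (sunder W u), 0) = b_ L u (sunder W u).

Definition varsigma (k : 'I_(h + m)) (u : state) (s : R) : R :=
  if 0 <= s then sigma W k u s else lam F k (tcurve k u s).

Definition gamma (k : 'I_(h + m)) (u : state) (s : R) : phase :=
  if lam F k u < 0 then
    if s < sunder W u then b_ L u s else (tcurve k u s, 0)
  else
    if s < sbar W u then b_ L (tcurve k u (sbar W u)) (s - sbar W u)
    else (tcurve k u s, 0).

Definition zeta (k : 'I_(h + m)) (u : state) (s : R) : state := (gamma k u s).1.

Definition omega_check (k : 'I_(h + m)) (u : state) (s : R) : phase :=
  (zeta k u s, 0).

(* t_{k+1}(., s_{k+1}) o ... o t_N(u, s_N): t_N is applied first. *)
Definition fast_waves (k : 'I_(h + m)) (s : 'I_(h + m) -> R) (u : state) :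
    state :=
  foldr (fun (i : 'I_(h + m)) w => tcurve i w (s i)) u
    [seq i : 'I_(h + m) <- enum 'I_(h + m) | (k < i)%N].

End Waves.

(* n is k - 1 - l for the usual numbering of the fields, i.e. (k - l)%N for the
   0-based k; component j of 'rV_n is xi_(l+1+j). *)
Record slaving (n : nat) := Slaving {
  m_minus : phase -> 'rV[R]_n -> phase;
  m_p : phase -> phase -> 'rV[R]_n -> phase }.

Section Slaving.
Variables (S : system) (F : fields) (L : layers) (W : waves).
Variables (k : 'I_(h + m)) (n : nat) (M : slaving n).

Definition stable_parametrization : Prop :=
  [/\ lipschitz_near (ustar S, 0)
        (fun q : state * 'rV[R]_n => m_minus M (q.1, 0) q.2),
      (\forall u \near ustar S, m_minus M (u, 0) 0 = (u, 0)),
      (exists2 delta : R, 0 < delta & forall (u : state) (x y : 'rV[R]_n),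
         `|u - ustar S| < delta -> `|x| < delta -> `|y| < delta ->
         m_minus M (u, 0) x = m_minus M (u, 0) y -> x = y)
    & exists2 c : R, 0 < c &
        (forall eps : R, 0 < eps -> \forall q \near (ustar S, 0 : 'rV[R]_n),
           stable_set S c eps (q.1, 0) (m_minus M (q.1, 0) q.2)) /\
        (forall rho : R, 0 < rho -> exists2 eps : R, 0 < eps &
           \forall u \near ustar S, forall x, stable_set S c eps (u, 0) x ->
             exists2 xi : 'rV[R]_n, `|xi| < rho & x = m_minus M (u, 0) xi)].

(* q = (u, s) ranges over the pairs for which m_p is evaluated at
   omega_check = (zeta_k(u, s), 0) and omega_0(0) = gamma_k(u, s). *)
Definition slaving_map : Prop :=
  let oc (q : state * R) := omega_check S F L W k q.1 q.2 in
  let o0 (q : state * R) := gamma S F L W k q.1 q.2 in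
  [/\ (exists C : R, \forall p \near
         ((ustar S, 0 : R, 0 : 'rV[R]_n), (ustar S, 0 : R, 0 : 'rV[R]_n)),
         `|m_p M (oc p.1.1) (o0 p.1.1) p.1.2 -
           m_p M (oc p.2.1) (o0 p.2.1) p.2.2| <=
         C * (`|oc p.1.1 - oc p.2.1| + `|o0 p.1.1 - o0 p.2.1|
              + `|p.1.2 - p.2.2|)),
      (exists C : R, \forall p \near (ustar S, 0 : R, 0 : 'rV[R]_n),
         `|m_p M (oc p.1) (o0 p.1) p.2| <= C * `|o0 p.1 - oc p.1| * `|p.2|)
    & (\forall p \near (ustar S, 0 : R, 0 : 'rV[R]_n),
         exists om om0 : R -> phase,
           [/\ orbit_from S (m_minus M (oc p.1) p.2 - oc p.1
                 + m_p M (oc p.1) (o0 p.1) p.2 + o0 p.1) om,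
               orbit_from S (o0 p.1) om0
             & `|om y - om0 y| @[y --> +oo] --> (0 : R)])].

Definition phi (u : state) (xi : 'rV[R]_n) (s : R) : state :=
  let oc := omega_check S F L W k u s in
  let o0 := gamma S F L W k u s in
  (m_minus M oc xi - oc + m_p M oc o0 xi + o0).1.

(* The strengths s_k, ..., s_N are the values s i, k <= i; the values s i,
   i < k, are not used. *)
Definition boundary_solver (u : state) (xi : 'rV[R]_n)
    (s : 'I_(h + m) -> R) : state :=
  phi (fast_waves S F W k s u) xi (s k).

Definition small_params (delta : R) (xi : 'rV[R]_n) (s : 'I_(h + m) -> R) :
    Prop :=
  `|xi| < delta /\ forall i : 'I_(h + m), (k <= i)%N -> `|s i| < delta.

Definition boundary_solver_invertible : Prop :=
  exists delta K rho : R, [/\ 0 < delta, 0 < K, 0 < rho &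
    forall up ub : state,
      `|up - ustar S| < delta -> `|ub - ustar S| < delta ->
      (forall xi xi' s s', small_params delta xi s -> small_params delta xi' s' ->
         \sum_j `|xi 0 j - xi' 0 j|
           + \sum_(i < h + m | (k <= i)%N) `|s i - s' i|
         <= K * `|parabolic_reduction S ub (boundary_solver up xi s) -
                  parabolic_reduction S ub (boundary_solver up xi' s')|) /\
      (forall w : state,
         `|parabolic_reduction S ub w -
           parabolic_reduction S ub (boundary_solver up 0 (fun=> 0))| < rho ->
         exists xi s, small_params delta xi s /\
           parabolic_reduction S ub (boundary_solver up xi s) =
           parabolic_reduction S ub w)].

End Slaving.

End Setting.

Arguments system : clear implicits.
Arguments fields : clear implicits.
Arguments layers : clear implicits.
Arguments waves : clear implicits.
Arguments slaving : clear implicits.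

Definition negative_part {R : realType} (x : R) : R := Num.max (- x) 0.

(* Main.v *)
(* By the bi-Lipschitz property of the boundary solver, compare the solution
   (xi', s'_k, ..., s'_N) with the approximate one (xi, s_k + xi_k, 0, ..., 0):
   the left-hand side is at most a constant times
   phi(u^+, xi, s_k + xi_k) - phi(ubar, xi, xi_k), and phi is Lipschitz in the
   point gamma_k.  Everything reduces to
     |gamma_k(u^+, s_k + xi_k) - gamma_k(t_k(u^+, s_k), xi_k)|
       <= C |s_k| ([varsigma_k]^- + |xi_k|).
   Up to the contact point, gamma_k is the flow b_k of the reduced layer system,
   which is a semigroup in (u, z_c); by Gronwall the left-hand side is
   controlled by t_k(u^+, s_k) - b_k(u^+, s_k).  If s_k >= 0 this difference
   vanishes at 0 and at the contact parameter, where sigma_k = 0, so it is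
   O(|s_k| |sigma_k|).  If s_k < 0 the two curves are tangent up to
   O(|lambda_k|), so it is O(|s_k| |lambda_k(ubar)|).  Past the contact point
   the overshoot is bounded both by |s_k| and by |xi_k|.  That sigma_k is
   strictly increasing in s comes from differentiating the Rankine-Hugoniot
   relation at u_star. *)
Require Import Defs.
From HB Require Import structures.
From mathcomp Require Import all_boot all_order all_algebra.
From mathcomp Require Import all_classical all_reals all_analysis.
From mathcomp Require Import ring lra.

Set Implicit Arguments.
Unset Strict Implicit.
Unset Printing Implicit Defensive.

Import Order.TTheory GRing.Theory Num.Theory.
Import numFieldNormedType.Exports.

Local Open Scope classical_set_scope.
Local Open Scope ring_scope.

(** * Neighbourhoods as balls, and the mean value inequality *)

Section NearRadius.
Context {R : realType}.

(** Layer orbits leave the set z_c = 0, so [b_] is a flow only in the coordinates (u, z_c). The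
    comparison of characteristic curves is made there, for abstract data on a normed space
    satisfying uniform bounds with one radius [rho], one constant [K] and one slope [c]; the
    Lipschitz map [center_chart] transports it to the phase space. The delicate point is the contact
    of h_k with b_k. The normalization of h_k gives it only where lambda_k <= 0, but a rarefaction
    may start at a state with lambda_k > 0, and the comparison must then cover the shock branch too.
    The contact of the initial velocities is therefore extended to all nearby states, at the price
    of an error O(|lambda_k|). The same inequality bounds theta_c(u, 0) by |lambda_k(u)|, and this
    makes rarefactions comparable with b_k. A rarefaction crossing lambda_k = 0 is cut at the
    crossing state, where both critical parameters vanish. *)

Lemma nearW_radius (V : normedModType R) (x : V) (P : V -> Prop) :
  (\forall y \near x, P y) <-> exists2 r : R, 0 < r & forall y, `|y - x| < r -> P y.
Proof.
rewrite nbhs_normP; split.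
  move=> [r r0 Hr]; exists r => // y yx; apply: Hr; rewrite /= /ball_ /= distrC //.
move=> [r r0 Hr]; exists r => // y; rewrite /= /ball_ /= distrC; exact: Hr.
Qed.

Lemma near_pair_radius (V W : normedModType R) (x : V) (z : W) (P : V * W -> Prop) :
  (\forall q \near (x, z), P q) <->
  exists2 r : R, 0 < r & forall y w, `|y - x| < r -> `|w - z| < r -> P (y, w).
Proof.
rewrite nearW_radius; split=> -[r r0 Hr]; exists r => //.
  by move=> y w yx wz; apply: Hr; rewrite prod_normE /= gt_max yx wz.
by move=> -[y w]; rewrite prod_normE /= gt_max => /andP[]; exact: Hr.
Qed.

(** The infimum of the set of failures satisfies [P] by the first hypothesis, and the second one
    then keeps failures away from it. *)
Lemma real_induction (a b : R) (P : R -> Prop) :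
  (forall t, a <= t <= b -> (forall s, a <= s < t -> P s) -> P t) ->
  (forall t, a <= t < b -> P t ->
     exists2 e : R, 0 < e & forall s, t < s < t + e -> s <= b -> P s) ->
  forall t, a <= t <= b -> P t.
Proof.
move=> Pcl Pop t /andP[at_ tb]; apply: contrapT => nPt.
pose E := [set s | a <= s <= b /\ ~ P s].
have E0 : E !=set0 by exists t; split => //; rewrite at_ tb.
have Elb : has_lbound E by exists a => s [/andP[]].
have Einf : has_inf E by [].
pose c := inf E.
have ac : a <= c by apply: lb_le_inf => // s [/andP[]].
have cb : c <= b by apply: (le_trans _ tb); apply: ge_inf => //; split => //; rewrite at_ tb.
have Pc : P c.
  apply: Pcl => [|s /andP[as_ sc]]; first by rewrite ac cb.
  apply: contrapT => nPs; have := sc; rewrite ltNge ge_inf //.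
  by split => //; rewrite as_ (le_trans (ltW sc)).
have cltb : c < b.
  rewrite lt_neqAle cb andbT; apply/eqP => cb'; apply: (nPt).
  suff -> : t = c by [].
  apply/eqP; rewrite eq_le {1}cb' tb /=; apply: ge_inf => //.
  by split => //; rewrite at_ tb.
have [e e0 He] : exists2 e : R, 0 < e & forall s, c < s < c + e -> s <= b -> P s.
  by apply: Pop => //; rewrite ac cltb.
have [s [/andP[as_ sb] nPs] sce] := inf_adherent e0 Einf.
apply: (nPs); have cs : c <= s by apply: ge_inf => //; split => //; rewrite as_ sb.
move: cs; rewrite le_eqVlt => /orP[/eqP<-//|cs]; apply: He => //.
by rewrite cs.
Qed.

(** Multiplying the difference quotient by [t] removes the punctured neighbourhood, as nothing is
    claimed at [t = 0]. Derivatives of shifted, paired or projected curves then reduce to rewriting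
    the increment. *)
Lemma is_deriveP_eps (V W : normedModType R) (f : V -> W) (x v : V) (d : W) :
  is_derive x v f d <->
  forall e : R, 0 < e -> exists2 r : R, 0 < r &
    forall t : R, `|t| < r -> `|f (t *: v + x) - f x - t *: d| <= e * `|t|.
Proof.
have key t (t0 : t != 0) : d - t^-1 *: (f (t *: v + x) - f x) =
    - (t^-1 *: (f (t *: v + x) - f x - t *: d)).
  by rewrite [in RHS]scalerBr scalerA mulVf // scale1r opprB.
split=> [[fd dE] e e0|H].
  have : (fun h => h^-1 *: ((f \o shift x) (h *: v) - f x)) @ 0^' --> d.
    by rewrite -dE; exact: fd.
  move=> /cvgrPdist_le /(_ e e0); rewrite near_withinE => /nearW_radius[r r0 Hr].
  exists r => // t tr.
  have [->|t0] := eqVneq t 0.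
    by rewrite !scale0r add0r subrr subr0 !normr0 mulr0.
  have := Hr t; rewrite subr0 => /(_ tr t0) /=.
  by rewrite key // normrN normrZ normfV ler_pdivrMl ?normr_gt0 // mulrC.
have : (fun h => h^-1 *: ((f \o shift x) (h *: v) - f x)) @ 0^' --> d.
  apply/cvgrPdist_le => e e0; rewrite near_withinE.
  have [r r0 Hr] := H _ e0; apply/(@nearW_radius R^o); exists r => // t tr t0 /=.
  rewrite key // normrN normrZ normfV ler_pdivrMl ?normr_gt0 // mulrC.
  by apply: Hr; rewrite subr0 in tr.
move=> cv; split; first by apply/cvg_ex; exists d.
exact: cvg_lim cv.
Qed.

Lemma is_derive1_continuous (W : normedModType R) (g : R -> W) (t : R) (d : W) :
  is_derive t (1 : R) g d -> {for t, continuous g}.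
Proof. by case=> gt _; apply/differentiable_continuous/derivable1_diffP. Qed.

(** With values in a normed space there is no intermediate point. The bound with slope [K + e'] is
    propagated by [real_induction]: [e'] absorbs the error of the first order expansion when
    stepping forward, and continuity passes to limits. *)
Lemma mean_value_ineq_le (W : normedModType R) (g g' : R -> W) (a b K : R) :
  a <= b -> (forall t, a <= t <= b -> is_derive t (1 : R) g (g' t)) ->
  (forall t, a <= t <= b -> `|g' t| <= K) -> `|g b - g a| <= K * (b - a).
Proof.
move=> ab dg gK; apply/ler_addgt0Pr => e e0.
have [->|ba] := eqVneq b a; first by rewrite !subrr normr0 mulr0 add0r ltW.
have ba0 : 0 < b - a by rewrite subr_gt0 lt_neqAle eq_sym ba.
pose e' := e / (b - a); have e'0 : 0 < e' by rewrite divr_gt0.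
suff : `|g b - g a| <= (K + e') * (b - a) by rewrite mulrDl divfK ?gt_eqF.
apply: (@real_induction a b (fun t => `|g t - g a| <= (K + e') * (t - a))); last first.
- by rewrite ab lexx.
- move=> t /andP[at_ tb] Pt.
  have tab : a <= t <= b by rewrite at_ ltW.
  have [r r0 Hr] := (is_deriveP_eps _ _ _ _).1 (dg t tab) _ e'0.
  exists r => // s /andP[ts st] sb.
  have st0 : 0 < s - t by lra.
  have := Hr (s - t); rewrite gtr0_norm // => /(_ ltac:(lra)).
  rewrite scaler1 subrK => H.
  have -> : g s - g a = (g s - g t - (s - t) *: g' t) + (s - t) *: g' t + (g t - g a).
    by rewrite subrK addrA subrK.
  apply: (le_trans (ler_normD _ _)).
  have := ler_normD (g s - g t - (s - t) *: g' t) ((s - t) *: g' t).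
  have : `|(s - t) *: g' t| <= K * (s - t).
    by rewrite normrZ gtr0_norm // mulrC ler_wpM2r ?gK // ltW.
  by nra.
- move=> t /andP[at_ tb] Hs.
  have [<-|ta] := eqVneq a t; first by rewrite !subrr normr0 mulr0.
  have ta0 : a < t by rewrite lt_neqAle ta.
  rewrite leNgt; apply/negP => lt.
  pose F s := `|g s - g a| - (K + e') * (s - a).
  have Fc : {for t, continuous F}.
    apply: cvgB; last first.
      apply: cvgM; first exact: cvg_cst.
      by apply: cvgB; [exact: cvg_id|exact: cvg_cst].
    apply: cvg_norm; apply: cvgB; last exact: cvg_cst.
    by apply: is_derive1_continuous; apply: dg; rewrite at_ tb.
  have Ft : 0 < F t by rewrite subr_gt0.
  have /nearW_radius[r r0 Hr] : \forall s \near t, 0 < F s.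
    exact: (cvgr_gt (F t) Fc).
  pose s := Num.max a (t - r / 2).
  have sa : a <= s by rewrite le_max lexx.
  have sr : t - r / 2 <= s by rewrite le_max lexx orbT.
  have st : s < t by rewrite gt_max ta0 /=; lra.
  have := Hs s; rewrite sa st => /(_ isT).
  have := Hr s; rewrite ler0_norm; last by lra.
  move=> /(_ ltac:(lra)); rewrite /F subr_gt0; lra.
Qed.

(** The segment is unordered because wave parameters take both signs. *)
Definition between (a b t : R) := Num.min a b <= t <= Num.max a b.

Lemma mean_value_ineq (W : normedModType R) (g g' : R -> W) (a b K : R) :
  (forall t, between a b t -> is_derive t (1 : R) g (g' t)) ->
  (forall t, between a b t -> `|g' t| <= K) -> `|g b - g a| <= K * `|b - a|.
Proof.
rewrite /between; case: (leP a b) => [ab|/ltW ba] dg gK.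
  by rewrite (ger0_norm (x := b - a)) ?subr_ge0 //; exact: mean_value_ineq_le dg gK.
by rewrite distrC (distrC b) (ger0_norm (x := a - b)) ?subr_ge0 //; exact: mean_value_ineq_le dg gK.
Qed.

End NearRadius.

(** * Taylor bounds for curves with Lipschitz derivative *)

Section CurveEstimates.
Context {R : realType}.

Lemma betweenP (a b t : R) : between a b t <-> a <= t <= b \/ b <= t <= a.
Proof.
rewrite /between; case: (leP a b) => h; split=> [|[]//]; try by [left|right].
- by move=> /andP[bt ta]; rewrite (le_trans h bt) (le_trans ta h).
- by move=> /andP[bt ta]; rewrite (le_trans (ltW h) bt) (le_trans ta (ltW h)).
Qed.

Lemma between0_norm (t s : R) : between 0 t s -> `|s| <= `|t|.
Proof. by rewrite betweenP => -[] /andP[]; case: (ler0P s); case: (ler0P t); lra. Qed.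

Lemma between_norm (a b s : R) : between a b s -> `|s| <= Num.max `|a| `|b|.
Proof.
rewrite betweenP le_max => -[] /andP[].
  by case: (ler0P s); case: (ler0P a); case: (ler0P b) => *; apply/orP; lra.
by case: (ler0P s); case: (ler0P a); case: (ler0P b) => *; apply/orP; lra.
Qed.

Lemma is_derive_scalel (W : normedModType R) (w : W) (t : R) :
  is_derive t (1 : R) (fun s => s *: w) w.
Proof.
apply/is_deriveP_eps => e e0; exists 1 => // u _.
by rewrite scaler1 scalerDl addrK subrr normr0 mulr_ge0 // ltW.
Qed.

Lemma taylor1_bound (W : normedModType R) (g g' : R -> W) (t K : R) :
  (forall s, between 0 t s -> is_derive s (1 : R) g (g' s)) ->
  (forall s, between 0 t s -> `|g' s - g' 0| <= K * `|s|) -> 0 <= K ->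
  `|g t - g 0 - t *: g' 0| <= K * `|t| ^+ 2.
Proof.
move=> dg g'K K0.
pose G s := g s - s *: g' 0; pose G' s := g' s - g' 0.
have dG s : between 0 t s -> is_derive s (1 : R) G (G' s).
  by move=> /dg ?; apply: is_deriveB; exact: is_derive_scalel.
have := mean_value_ineq (K := K * `|t|) dG; rewrite subr0.
have -> : G t - G 0 = g t - g 0 - t *: g' 0 by rewrite /G scale0r subr0 addrAC.
rewrite expr2 mulrA; apply => s bs; apply: (le_trans (g'K s bs)).
by rewrite ler_wpM2l // between0_norm.
Qed.

(* The mean slope between the two zeros vanishes, so [g'] is O(|a| + |t|);
   integrating it from the zero nearest to [s] gives the estimate. *)
Lemma two_zeros_bound (W : normedModType R) (g g' : R -> W) (r a s K : R) :
  (forall t, `|t| < r -> is_derive t (1 : R) g (g' t)) ->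
  (forall t u, `|t| < r -> `|u| < r -> `|g' t - g' u| <= K * `|t - u|) ->
  0 <= K -> `|a| < r -> `|s| < r -> a != 0 -> g 0 = 0 -> g a = 0 ->
  `|g' 0| <= K * `|a| /\ `|g s| <= 4 * K * `|s| * `|s - a|.
Proof.
move=> dg g'K K0 ar sr a0 g0 ga.
have r0 : `|0 : R| < r by rewrite normr0 (le_lt_trans _ ar).
have sub0 u t : `|u| < r -> between 0 u t -> `|t| < r.
  by move=> ur /between0_norm /le_lt_trans; apply.
have g'0 : `|g' 0| <= K * `|a|.
  have := @taylor1_bound W g g' a K; rewrite ga g0 subrr sub0r normrN normrZ.
  rewrite expr2 mulrA => H.
  rewrite -(ler_pM2r (x := `|a|)) ?normr_gt0 // mulrC; apply: H => // t /(sub0 _ _ ar) tr.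
    exact: dg.
  by have := g'K t 0 tr r0; rewrite subr0.
split=> //.
have g't t : `|t| < r -> `|g' t| <= K * (`|a| + `|t|).
  move=> tr; have := g'K t 0 tr r0; rewrite subr0.
  have := ler_normD (g' t - g' 0) (g' 0); rewrite subrK; lra.
have tri : `|a| <= `|s| + `|s - a| :> R by rewrite (distrC s) -{1}(subrK s a) addrC ler_normD.
have [sa|sa] := leP `|s| `|s - a|.
  have := @mean_value_ineq R W g g' 0 s (K * (3 * `|s - a|)).
  rewrite g0 !subr0 => H; apply: (le_trans (H _ _)).
  - by move=> t /(sub0 _ _ sr); exact: dg.
  - move=> t bt; apply: (le_trans (g't _ (sub0 _ _ sr bt))).
    have := between0_norm bt => ts; rewrite ler_wpM2l //; lra.
  - have := mulr_ge0 (mulr_ge0 K0 (normr_ge0 s)) (normr_ge0 (s - a)); nra.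
have := @mean_value_ineq R W g g' a s (K * (4 * `|s|)).
have sub t : between a s t -> `|t| < r /\ `|a| + `|t| <= 4 * `|s| :> R.
  move=> /between_norm; rewrite le_max => /orP[] h; split.
  - exact: le_lt_trans ar.
  - lra.
  - exact: le_lt_trans sr.
  - by have := normr_ge0 s; lra.
rewrite ga subr0 => H; apply: (le_trans (H _ _)).
- by move=> t /sub[? _]; exact: dg.
- move=> t /sub[tr ht]; apply: (le_trans (g't _ tr)).
  by rewrite ler_wpM2l.
- by rewrite [K * _]mulrCA -!mulrA.
Qed.

(** * A priori estimates for an autonomous differential equation *)

Section AutonomousODE.
Variables (X : normedModType R) (V : X -> X) (x0 : X) (rho L K : R).
Hypothesis V_lip : forall x y, `|x - x0| < rho -> `|y - x0| < rho ->
  `|V x - V y| <= L * `|x - y|.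
Hypothesis V_bound : forall x, `|x - x0| < rho -> `|V x| <= K.
Hypothesis L0 : 0 <= L.
Hypothesis K0 : 0 <= K.

(** The speed bound holds only inside the ball, so staying in the ball and the bound on the
    displacement are proved together by [real_induction]. *)
Lemma solution_trapped (x : R -> X) (r t : R) :
  (forall s, `|s| < r -> is_derive s (1 : R) x (V (x s))) ->
  `|x 0 - x0| + K * r < rho -> `|t| < r ->
  `|x t - x0| < rho /\ `|x t - x 0| <= K * `|t|.
Proof.
move=> dx x0r tr.
have r0 : 0 < r by apply: le_lt_trans tr.
have Kr0 : 0 <= K * r by rewrite mulr_ge0 // ltW.
(* Running along [t * s] with [s] in [0, 1] treats both signs of [t] at once. *)
have ts_r s : 0 <= s <= 1 -> `|t * s| < r.
  move=> /andP[s0 s1]; rewrite normrM (ger0_norm s0) (le_lt_trans _ tr) //.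
  by rewrite ler_piMr.
have mv s : 0 <= s <= 1 -> (forall u, 0 <= u <= s -> `|x (t * u) - x0| < rho) ->
    `|x (t * s) - x 0| <= K * `|t * s|.
  move=> s01 Hs; rewrite -{2}(subr0 (t * s)).
  have bt u : between 0 (t * s) u -> exists2 v, 0 <= v <= s & u = t * v.
    move/andP: s01 => [s0 s1] bu.
    have [t0|t0] := eqVneq t 0.
      exists 0; rewrite ?lexx //; move: bu; rewrite t0 !mul0r => /between0_norm.
      by rewrite normr0 normr_le0 => /eqP.
    exists (u / t); last by rewrite mulrC divfK.
    move: bu; rewrite betweenP; case: (ltgtP t 0) t0 => // [tn|tp] _.
      rewrite ler_ndivlMr // ler_ndivrMr // mul0r [s * t]mulrC.
      by move=> [] /andP[]; nra.
    rewrite ler_pdivlMr // ler_pdivrMr // mul0r [s * t]mulrC.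
    by move=> [] /andP[]; nra.
  apply: (@mean_value_ineq _ _ x (V \o x)) => u /bt[v /andP[v0 vs] ->].
    by apply: dx; apply: ts_r; rewrite v0 (le_trans vs) //; case/andP: s01.
  by apply/V_bound/Hs; rewrite v0.
have P : forall s, 0 <= s <= 1 -> `|x (t * s) - x0| < rho.
  apply: real_induction => [s s01 Hs|s /andP[s0 s1] Ps].
    have [s0|s0] := eqVneq s 0.
      by rewrite s0 mulr0; lra.
    have {}s0 : 0 < s by rewrite lt_neqAle eq_sym s0; case/andP: s01.
    (* [eta] is the room left by the initial state and the maximal displacement; at a time slightly
       before [s] the displacement is at most [K * r], and continuity costs less than [eta]. *)
    pose eta := rho - (`|x 0 - x0| + K * r).
    have eta0 : 0 < eta by rewrite subr_gt0.
    have /is_derive1_continuous xc := dx _ (ts_r _ s01).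
    have : {for s, continuous (fun u => x (t * u))}.
      apply: (@continuous_comp _ _ _ (fun u : R => t * u) x) => //.
      by apply: cvgM; [exact: cvg_cst|exact: cvg_id].
    move=> /cvgrPdist_lt/(_ _ eta0)/nearW_radius[d d0 Hd].
    pose u := Num.max 0 (s - d / 2).
    have us : u < s by rewrite gt_max s0 /=; lra.
    have u0 : 0 <= u by rewrite le_max lexx.
    have us' : s - d / 2 <= u by rewrite le_max lexx orbT.
    have := Hd u; rewrite distrC gtr0_norm; last by lra.
    move=> /(_ ltac:(lra)) H.
    have u01 : 0 <= u <= 1 by case/andP: s01 => ? ?; apply/andP; split; lra.
    have : `|x (t * u) - x 0| <= K * r.
      apply: (le_trans (mv u u01 _)).
        move=> w /andP[w0 wu]; apply: Hs; rewrite w0; lra.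
      by rewrite ler_wpM2l // ltW // ts_r.
    move=> H2.
    have -> : x (t * s) - x0 = (x (t * s) - x (t * u)) + (x (t * u) - x 0) + (x 0 - x0).
      by rewrite !addrA !subrK.
    have := ler_normD (x (t * s) - x (t * u) + (x (t * u) - x 0)) (x 0 - x0).
    have := ler_normD (x (t * s) - x (t * u)) (x (t * u) - x 0).
    rewrite /eta in H; lra.
  have s01 : 0 <= s <= 1 by rewrite s0 ltW.
  have /is_derive1_continuous xc := dx _ (ts_r _ s01).
  have : {for s, continuous (fun u => x (t * u))}.
    apply: (@continuous_comp _ _ _ (fun u : R => t * u) x) => //.
    by apply: cvgM; [exact: cvg_cst|exact: cvg_id].
  have e0 : 0 < rho - `|x (t * s) - x0| by rewrite subr_gt0.
  move=> /cvgrPdist_lt/(_ _ e0)/nearW_radius[d d0 Hd].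
  exists d => // u /andP[su ud] _; have := Hd u; rewrite gtr0_norm; last by lra.
  move=> /(_ ltac:(lra)) H.
  have := ler_normD (x (t * u) - x (t * s)) (x (t * s) - x0).
  by rewrite distrC in H; rewrite addrA subrK; lra.
split; first by have := P 1; rewrite mulr1; apply; rewrite ler01 lexx.
have := mv 1; rewrite mulr1; apply; first by rewrite ler01 lexx.
exact: P.
Qed.

(** Gronwall's inequality for short times, without exponential: at a point [c] where the distance is
    maximal, the mean value inequality bounds its growth by [L * |w c| * |t|], at most half of
    [|w c|]. Absorbing this half gives the factor 2. *)
Lemma solutions_close (x y : R -> X) (t : R) :
  (forall s, between 0 t s ->
     [/\ is_derive s (1 : R) x (V (x s)), is_derive s (1 : R) y (V (y s)),
         `|x s - x0| < rho & `|y s - x0| < rho]) ->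
  2 * L * `|t| <= 1 -> `|x t - y t| <= 2 * `|x 0 - y 0|.
Proof.
move=> H Lt.
pose w s := x s - y s.
have dw s : between 0 t s -> is_derive s (1 : R) w (V (x s) - V (y s)).
  by move=> /H[? ? _ _]; exact: is_deriveB.
have mM : Num.min 0 t <= Num.max 0 t by rewrite ge_min !le_max lexx.
have wc : {within `[Num.min 0 t, Num.max 0 t], continuous (fun s => `|w s|)}.
  apply: continuous_in_subspaceT => s; rewrite inE /= in_itv /= => sb.
  by apply: cvg_norm; apply: is_derive1_continuous (dw s sb).
have [c] := EVT_max mM wc; rewrite in_itv /= => cb cmax.
have bt0 : between 0 t t by rewrite /between ge_min le_max lexx !orbT.
have subc s : between 0 c s -> between 0 t s.
  move: cb; rewrite -/(between 0 t c) !betweenP => -[] /andP[? ?] [] /andP[? ?];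
  by [left; lra|right; lra|left; lra|right; lra].
have : `|w c - w 0| <= L * `|w c| * `|c - 0|.
  apply: (@mean_value_ineq _ _ w (fun s => V (x s) - V (y s))) => s /subc bs.
    exact: dw.
  have [_ _ xs ys] := H _ bs; apply: (le_trans (V_lip xs ys)).
  by rewrite ler_wpM2l //; apply: cmax; rewrite in_itv.
have := between0_norm cb; rewrite subr0 => ct.
have : L * `|w c| * `|c| <= L * `|w c| * `|t| by rewrite ler_wpM2l // mulr_ge0.
have : `|w t| <= `|w c| by apply: cmax; rewrite in_itv.
have := ler_normD (w c - w 0) (w 0); rewrite subrK -/(w 0) -/(w t).
have := normr_ge0 (w c).
nra.
Qed.

Lemma solution_taylor (x : R -> X) (t : R) :
  (forall s, between 0 t s ->
     [/\ is_derive s (1 : R) x (V (x s)), `|x s - x0| < rho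
       & `|x s - x 0| <= K * `|s|]) ->
  `|x t - x 0 - t *: V (x 0)| <= L * K * `|t| ^+ 2.
Proof.
move=> H; have b0 : between 0 t 0 by rewrite /between ge_min le_max lexx.
have [_ x00 _] := H _ b0.
apply: (@taylor1_bound _ x (V \o x)); last exact: mulr_ge0.
  by move=> s /H[].
move=> s /H[_ xs xK]; apply: (le_trans (V_lip xs x00)).
by rewrite -mulrA ler_wpM2l.
Qed.

End AutonomousODE.

End CurveEstimates.

(** * Finite coordinates and strict differentiability *)

(** A finite frame whose coordinates are bounded by the norm: one argument then serves both columns
    and pairs of a column and a real. *)
Record coordinates (R : realType) (V : normedModType R) := Coordinates {
  cindex : finType;
  cvec : cindex -> V;
  coord : cindex -> V -> R;
  coord_linear : forall i (a : R) (u v : V),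
    coord i (a *: u + v) = a * coord i u + coord i v;
  coord_sum : forall v, v = \sum_i coord i v *: cvec i;
  coord_le : forall i v, `|coord i v| <= `|v| }.

Arguments cvec {R V} c i.

Definition locally_lipschitz (R : realType) (V W : normedModType R) (f : V -> W) (x : V) :=
  exists2 K : R, 0 <= K & exists2 r : R, 0 < r &
    forall y z, `|y - x| < r -> `|z - x| < r -> `|f y - f z| <= K * `|y - z|.

Section StrictDifferentiability.
Context {R : realType} {V W : normedModType R}.

Lemma is_derive_line (f : V -> W) (y e : V) (t : R) (d : W) :
  is_derive (t *: e + y) e f d -> is_derive t (1 : R) (fun s => f (s *: e + y)) d.
Proof.
move=> /is_deriveP_eps H; apply/is_deriveP_eps => eps eps0.
have [r r0 Hr] := H _ eps0; exists r => // u /Hr.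
by rewrite scaler1 addrA scalerDl.
Qed.

(** The increment is split along a polygonal path with one edge per direction of the frame; the
    length condition keeps the path in the ball, and each edge is a one-dimensional mean value
    estimate. *)
Lemma increment_along_frame (I : Type) (e : I -> V) (a : I -> R) (D : I -> W)
    (f : V -> W) (x : V) (r eps : R) (s : seq I) (y : V) :
  (forall z, `|z - x| < r -> forall i, derivable f z (e i) /\ `|'D_(e i) f z - D i| <= eps) ->
  `|y - x| + \sum_(i <- s) `|a i| * `|e i| < r ->
  `|f (\sum_(i <- s) a i *: e i + y) - f y - \sum_(i <- s) a i *: D i|
    <= eps * \sum_(i <- s) `|a i|.
Proof.
move=> H; elim: s y => [|i s IHs] y yr.
  by rewrite !big_nil add0r subrr subr0 normr0 mulr0.
rewrite !big_cons in yr *.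
have s0 : 0 <= \sum_(i <- s) `|a i| * `|e i| by apply: sumr_ge0 => *; rewrite mulr_ge0.
have tr (t : R) : `|t| <= `|a i| -> `|t *: e i + y - x| <= `|y - x| + `|a i| * `|e i|.
  move=> ta; rewrite -addrA addrC; apply: (le_trans (ler_normD _ _)).
  by rewrite normrZ lerD2l ler_wpM2r.
have step : `|f (a i *: e i + y) - f y - a i *: D i| <= eps * `|a i|.
  pose g t := f (t *: e i + y) - t *: D i.
  have := @mean_value_ineq R W g (fun t => 'D_(e i) f (t *: e i + y) - D i) 0 (a i) eps.
  have -> : g (a i) - g 0 = f (a i *: e i + y) - f y - a i *: D i.
    by rewrite /g !scale0r add0r subr0 addrAC.
  rewrite subr0; apply => t /between0_norm ta.
    have [d _] := H (t *: e i + y) ltac:(by apply: (le_lt_trans (tr t ta)); lra) i.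
    by apply: is_deriveB; [apply/is_derive_line/derivableP|exact: is_derive_scalel].
  by have [] := H (t *: e i + y) ltac:(by apply: (le_lt_trans (tr t ta)); lra) i.
have := IHs (a i *: e i + y) ltac:(by apply: (le_lt_trans _ yr); rewrite addrA lerD2r tr).
rewrite mulrDr; set S := \sum_(j <- s) a j *: e j; set T := \sum_(j <- s) a j *: D j.
move=> IH.
have -> : f (a i *: e i + S + y) - f y - (a i *: D i + T) =
    (f (a i *: e i + y) - f y - a i *: D i) +
    (f (S + (a i *: e i + y)) - f (a i *: e i + y) - T).
  rewrite [a i *: e i + S]addrC -[S + _ + y]addrA.
  set p := f (S + _); set q := f (a i *: e i + y).
  rewrite [RHS]addrC !addrA [X in _ = X + _ + _]addrAC subrK opprD addrA.
  by rewrite addrAC [X in X - _ = _]addrAC.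
by apply: (le_trans (ler_normD _ _)); rewrite lerD.
Qed.

Variable cV : coordinates V.

(** [classC] speaks of directional derivatives only. Their continuity makes the linear approximation
    uniform in both endpoints, from which local Lipschitz continuity and differentiability both
    follow. *)
Lemma classC_near1_strict (f : V -> W) (x : V) (eps : R) :
  classC_near 1 x f -> 0 < eps ->
  exists2 r : R, 0 < r & forall y z, `|y - x| < r -> `|z - x| < r ->
    `|f z - f y - \sum_i coord i (z - y) *: 'D_(cvec cV i) f x| <= eps * `|z - y|.
Proof.
move=> [U [Uo Ux] [fc /= fC]] eps0.
pose p : R := #|cindex cV|%:R.
have p0 : 0 <= p by rewrite ler0n.
pose eps' := eps / (p + 1); have eps'0 : 0 < eps' by rewrite divr_gt0 // ltr_wpDl.
have : \forall z \near x, forall i, derivable f z (cvec cV i) /\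
    `|'D_(cvec cV i) f z - 'D_(cvec cV i) f x| <= eps'.
  apply: filter_forall => i; have [fd [fdc _]] := fC (cvec cV i).
  have : \forall z \near x, U z by exact: open_nbhs_nbhs.
  have /cvgrPdist_le/(_ _ eps'0) := fdc _ Ux.
  apply: filterS2 => z; rewrite distrC => ? Uz; split => //; exact: fd.
move=> /nearW_radius[r0 r00 Hr].
pose E := \sum_i `|cvec cV i|.
have E0 : 0 <= E by apply: sumr_ge0.
(* The polygonal path from [y] to [z] has length at most [|z - y| * E], and [|z - y|] is less than
   twice the radius, so the path stays in the ball of radius [r0]. *)
exists (r0 / (1 + 2 * (E + 1))) => [|y z yx zx].
  by rewrite divr_gt0 //; lra.
rewrite !ltr_pdivlMr in yx zx; try lra.
have zy : `|z - y| <= `|z - x| + `|y - x|.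
  by rewrite -[z - y](subrKA x) (distrC y) ler_normD.
have := @increment_along_frame _ (cvec cV) (fun i => coord i (z - y))
  (fun i => 'D_(cvec cV i) f x) f x r0 eps' (index_enum (cindex cV)) y Hr.
rewrite -coord_sum subrK => H.
apply: (le_trans (H _)).
  apply: (@le_lt_trans _ _ (`|y - x| + `|z - y| * E)); last first.
    have := normr_ge0 (z - x); have := normr_ge0 (y - x); nra.
  by rewrite lerD2l mulr_sumr ler_sum // => i _; rewrite ler_wpM2r // coord_le.
rewrite /eps' -mulrA ler_wpM2l ?(ltW eps0) // ler_pdivrMl; last by lra.
apply: (@le_trans _ _ (\sum_(i : cindex cV) `|z - y|)).
  by apply: ler_sum => i _; exact: coord_le.
by rewrite sumr_const -mulr_natl ler_wpM2r // lerDl.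
Qed.

Lemma classC_near1_locally_lipschitz (f : V -> W) (x : V) :
  classC_near 1 x f -> locally_lipschitz f x.
Proof.
move=> fC; have [r r0 Hr] := classC_near1_strict fC ltr01.
pose D := \sum_(i : cindex cV) `|'D_(cvec cV i) f x|.
exists (1 + D); first by rewrite addr_ge0 // sumr_ge0.
exists r => // y z yx zx; have := Hr z y zx yx.
set S := \sum_i _ => H; rewrite -[f y - f z](subrK S).
apply: (le_trans (ler_normD _ _)); rewrite mulrDl lerD //.
apply: (le_trans (ler_norm_sum _ _ _)); rewrite mulr_suml ler_sum // => i _.
by rewrite normrZ mulrC ler_wpM2l // coord_le.
Qed.

Lemma classC_near1_differentiable (f : V -> W) (x : V) :
  classC_near 1 x f -> differentiable f x.
Proof.
move=> fC.
pose d0 (h : V) : W := \sum_i coord i h *: 'D_(cvec cV i) f x.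
have d0_lin : linear d0.
  move=> a u v; rewrite /d0 scaler_sumr -big_split /=; apply: eq_bigr => i _.
  by rewrite coord_linear scalerDl scalerA.
pose d : {linear V -> W} := HB.pack d0 (GRing.isLinear.Build R V W *:%R d0 d0_lin).
pose D := \sum_(i : cindex cV) `|'D_(cvec cV i) f x|.
have D0 : 0 <= D by rewrite sumr_ge0.
have dD h : `|d h| <= D * `|h|.
  apply: (le_trans (ler_norm_sum _ _ _)); rewrite mulr_suml ler_sum // => i _.
  by rewrite normrZ mulrC ler_wpM2l // coord_le.
have dc : continuous d.
  move=> h; apply/cvgrPdist_le => e e0; apply/nearW_radius.
  exists (e / (D + 1)); first by rewrite divr_gt0 // ltr_wpDl.
  move=> k; rewrite ltr_pdivlMr; last by rewrite ltr_wpDl.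
  move=> kh; rewrite -linearB; apply: (le_trans (dD _)).
  by rewrite distrC; have := normr_ge0 (k - h); nra.
have fd : f \o shift x = cst (f x) + d +o_ 0 id.
  apply/eqaddoP => e e0; apply/nearW_radius.
  have [r r0 Hr] := classC_near1_strict fC e0.
  exists r => // h hr.
  have := Hr x (h + x); rewrite subrr normr0 addrK => /(_ r0).
  rewrite subr0 in hr; move=> /(_ hr); congr (_ <= _); congr (`|_|).
  by rewrite /= !fctE opprD addrA.
apply/diff_locallyP; have -> : 'd f x = d :> (V -> W) by exact: diff_unique.
by split.
Qed.

Lemma derive_coord_sum (f : V -> W) (x w : V) :
  differentiable f x -> 'D_w f x = \sum_i coord i w *: 'D_(cvec cV i) f x.
Proof.
move=> fd; rewrite deriveE // [in LHS](coord_sum cV w) linear_sum.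
by apply: eq_bigr => i _; rewrite linearZ deriveE.
Qed.

End StrictDifferentiability.

(** * Elementary properties of the classes C^n *)

Section ClassC.
Context {R : realType} {V W : normedModType R}.

Lemma classCW (n : nat) (U : set V) (f : V -> W) : classC n.+1 U f -> classC n U f.
Proof.
elim: n f => [f []//|n IHn f [fc fC]]; split=> // w.
by have [fd fdC] := fC w; split => //; exact: IHn.
Qed.

Lemma classC_near1W (x : V) (f : V -> W) : classC_near 2 x f -> classC_near 1 x f.
Proof. by move=> [U Ux /classCW]; exists U. Qed.

Lemma classC_near_derive (n : nat) (x w : V) (f : V -> W) :
  classC_near n.+1 x f -> classC_near n x ('D_w f).
Proof. by move=> [U Ux [_ fC]]; exists U => //; have [] := fC w. Qed.

Lemma classC_near_near (n : nat) (x : V) (f : V -> W) :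
  classC_near n x f -> \forall y \near x, classC_near n y f.
Proof.
move=> [U [Uo Ux] UC]; have : \forall y \near x, U y by exact: open_nbhs_nbhs.
by apply: filterS => y Uy; exists U.
Qed.

Lemma classC_near_continuous (n : nat) (x : V) (f : V -> W) :
  classC_near n x f -> {for x, continuous f}.
Proof. by case: n => [|n] [U [Uo Ux] [fc _]]; exact: fc. Qed.

Lemma classC_near1_derivable (x w : V) (f : V -> W) :
  classC_near 1 x f -> derivable f x w.
Proof. by move=> [U [Uo Ux] [_ fC]]; have [fd _] := fC w; exact: fd. Qed.

Lemma smooth_classC_near (n : nat) (x : V) (f : V -> W) :
  smooth_near x f -> classC_near n x f.
Proof. by move=> [U Ux UC]; exists U. Qed.

End ClassC.

(** * Coordinates on column vectors and on their product with the line *)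

Section CoordinateInstances.
Context {R : realType}.

Lemma mx_entry_le (p q : nat) (A : 'M[R]_(p, q)) i j : `|A i j| <= `|A|.
Proof. by rewrite [leRHS]/Num.Def.normr /= mx_normrE; exact: (le_bigmax _ _ (i, j)). Qed.

Lemma mx_norm_le (p q : nat) (A : 'M[R]_(p, q)) (e : R) :
  0 <= e -> (forall i j, `|A i j| <= e) -> `|A| <= e.
Proof.
move=> e0 H; rewrite /Num.Def.normr /= mx_normrE; apply: bigmax_le => // -[i j] _.
Qed.

Section ColumnCoordinates.
Variable p : nat.

Fact cV_coord_linear (i : 'I_p) (a : R) (u v : 'cV[R]_p) :
  (a *: u + v) i 0 = a * u i 0 + v i 0.
Proof. by rewrite !mxE. Qed.

Fact cV_coord_sum (v : 'cV[R]_p) : v = \sum_i v i 0 *: delta_mx i 0.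
Proof.
rewrite [LHS]matrix_sum_delta; apply: eq_bigr => i _.
by rewrite big_ord1.
Qed.

Definition cV_coordinates : coordinates 'cV[R]_p :=
  Coordinates cV_coord_linear cV_coord_sum (fun i v => mx_entry_le v i 0).

End ColumnCoordinates.

Section PairCoordinates.
Variables (V : normedModType R) (cV : coordinates V).

Definition pairR_vec (i : (cindex cV + unit)%type) : V * R :=
  if i is inl j then (cvec cV j, 0) else (0, 1).

Definition pairR_coord (i : (cindex cV + unit)%type) (v : V * R) : R :=
  if i is inl j then coord j v.1 else v.2.

Fact pairR_coord_linear i (a : R) (u v : V * R) :
  pairR_coord i (a *: u + v) = a * pairR_coord i u + pairR_coord i v.
Proof. by case: i => [i|] //=; exact: coord_linear. Qed.

Fact pairR_coord_sum v : v = \sum_i pairR_coord i v *: pairR_vec i.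
Proof.
case: v => v z; rewrite big_sumType /= (big_pred1 tt) => [|[]//]; rewrite {1}(coord_sum cV v).
apply: injective_projections => /=.
  by rewrite (raddf_sum fst) /= scaler0 addr0.
by rewrite (raddf_sum snd) /= big1 ?add0r ?[_ *: _]mulr1 // => i _; rewrite scaler0.
Qed.

Fact pairR_coord_le i v : `|pairR_coord i v| <= `|v|.
Proof. by case: i v => [i|[]] [v z] /=; rewrite prod_normE le_max ?coord_le ?lexx ?orbT. Qed.

Definition pairR_coordinates : coordinates (V * R)%type :=
  Coordinates pairR_coord_linear pairR_coord_sum pairR_coord_le.

End PairCoordinates.

End CoordinateInstances.

(** * Matrix norm estimates *)

Section MatrixNorm.
Context {R : realType}.

(** The norm is the largest absolute value of an entry, hence the factor [q], the inner
    dimension. *)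
Lemma mulmx_norm_le (p q r : nat) (A : 'M[R]_(p, q)) (B : 'M[R]_(q, r)) :
  `|A *m B| <= q%:R * `|A| * `|B|.
Proof.
apply: mx_norm_le => [|i j]; first by rewrite !mulr_ge0.
rewrite mxE (le_trans (ler_norm_sum _ _ _)) //.
apply: (@le_trans _ _ (\sum_(k < q) `|A| * `|B|)).
  by apply: ler_sum => k _; rewrite normrM ler_pM // mx_entry_le.
by rewrite sumr_const card_ord -[leLHS]mulr_natl mulrA.
Qed.

Lemma col_mx_norm_le (p q r : nat) (A : 'M[R]_(p, r)) (B : 'M[R]_(q, r)) (e : R) :
  0 <= e -> `|A| <= e -> `|B| <= e -> `|col_mx A B| <= e.
Proof.
move=> e0 Ae Be; apply: mx_norm_le => // i j.
by rewrite mxE; case: (fintype.split i) => k; apply: le_trans (mx_entry_le _ _ _) _.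
Qed.

Lemma usubmx_norm_le (p q r : nat) (A : 'M[R]_(p + q, r)) : `|usubmx A| <= `|A|.
Proof. by apply: mx_norm_le => // i j; rewrite mxE mx_entry_le. Qed.

Lemma dsubmx_norm_le (p q r : nat) (A : 'M[R]_(p + q, r)) : `|dsubmx A| <= `|A|.
Proof. by apply: mx_norm_le => // i j; rewrite mxE mx_entry_le. Qed.

Lemma trmx_norm_le (p q : nat) (A : 'M[R]_(p, q)) : `|A^T| <= `|A|.
Proof. by apply: mx_norm_le => // i j; rewrite mxE mx_entry_le. Qed.

Lemma invmx_sub (n : nat) (A B : 'M[R]_n) : A \in unitmx -> B \in unitmx ->
  invmx A - invmx B = invmx B *m (B - A) *m invmx A.
Proof.
by move=> uA uB; rewrite mulmxBr mulmxBl mulVmx // mul1mx -mulmxA mulmxV // mulmx1.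
Qed.

(** By the resolvent identity [invmx A] deviates from [invmx B] by at most half of its own norm;
    absorbing this half gives the bound [2 * |invmx B|]. *)
Lemma invmx_bounded_near (n : nat) (B : 'M[R]_n) : B \in unitmx ->
  exists2 C : R, 0 <= C & exists2 r : R, 0 < r &
    forall A, A \in unitmx -> `|A - B| < r -> `|invmx A| <= C.
Proof.
move=> uB; pose c := n%:R * (n%:R * `|invmx B|).
have c0 : 0 <= c by rewrite !mulr_ge0.
exists (2 * `|invmx B|); first by rewrite mulr_ge0.
exists (1 / (2 * (c + 1))); first by rewrite divr_gt0 // mulr_gt0 // ltr_wpDl.
move=> A uA; rewrite ltr_pdivlMr; last by rewrite mulr_gt0 // ltr_wpDl.
move=> AB.
have : `|invmx A - invmx B| <= c * `|A - B| * `|invmx A|.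
  rewrite invmx_sub // (le_trans (mulmx_norm_le _ _)) // -/c.
  rewrite ler_wpM2r // /c -mulrA ler_wpM2l // -opprB mulmxN normrN.
  exact: mulmx_norm_le.
have := ler_normD (invmx A - invmx B) (invmx B); rewrite subrK.
have := normr_ge0 (invmx A); have := normr_ge0 (A - B); nra.
Qed.

(** Symmetry and idempotence make [P i i] the sum of the squares of row [i]. Hence [P i i] is at
    most 1, and it dominates the square of every entry of the row. *)
Lemma orthogonal_projection_norm_le (n : nat) (X : set 'cV[R]_n) (P : 'M[R]_n) :
  orthogonal_projection X P -> `|P| <= 1.
Proof.
move=> [PT PP _]; apply: mx_norm_le => // i j.
have Pii : P i i = \sum_k P i k ^+ 2.
  rewrite -{1}PP mxE; apply: eq_bigr => k _.
  by rewrite expr2 -[in X in _ * X]PT mxE.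
have Pk k : P i k ^+ 2 <= P i i.
  by rewrite Pii (bigD1 k) //= lerDl sumr_ge0 // => l _; rewrite sqr_ge0.
have := Pk i; have := Pk j; rewrite !expr2 ler_norml => h1 h2.
have Pi1 : P i i <= 1 by nra.
by apply/andP; split; nra.
Qed.

(* If no orthogonal projection exists, [pos_proj] is the default matrix of [get]. *)
Lemma pos_proj_bounded (n : nat) :
  exists2 C : R, 0 <= C & forall A : 'M[R]_n, `|pos_proj A| <= C.
Proof.
exists (1 + `|point : 'M[R]_n|) => [|A]; first by rewrite addr_ge0.
rewrite /pos_proj; case: (pselect (exists P, orthogonal_projection (pos_eigenspan A) P)).
  move=> [P HP]; have := @getPex _ [set Pi | orthogonal_projection (pos_eigenspan A) Pi].
  move=> /(_ (ex_intro _ P HP)) /= /orthogonal_projection_norm_le h.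
  by apply: (le_trans h); rewrite lerDl.
move=> nP; rewrite getPN ?lerDr //; by move=> P HP; apply: nP; exists P.
Qed.

End MatrixNorm.

(** * Calculus of locally Lipschitz functions *)

Section LocallyLipschitz.
Context {R : realType}.

Lemma locally_lipschitz_bounded (V W : normedModType R) (f : V -> W) (x : V) :
  locally_lipschitz f x -> exists2 C : R, 0 <= C & exists2 r : R, 0 < r &
    forall y, `|y - x| < r -> `|f y| <= C.
Proof.
move=> [K K0 [r r0 H]]; exists (K * r + `|f x|).
  by rewrite addr_ge0 // mulr_ge0 // ltW.
exists r => // y yr; rewrite -(subrK (f x) (f y)) (le_trans (ler_normD _ _)) //.
rewrite lerD2r; apply: (le_trans (H _ _ yr _)); first by rewrite subrr normr0.
by rewrite ler_wpM2l // ltW.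
Qed.

Lemma locally_lipschitz_continuous (V W : normedModType R) (f : V -> W) (x : V) :
  locally_lipschitz f x -> {for x, continuous f}.
Proof.
move=> [K K0 [r r0 H]]; apply/cvgrPdist_le => e e0; apply/nearW_radius.
have K1 : 0 < K + 1 by rewrite ltr_wpDl.
exists (Num.min r (e / (K + 1))); first by rewrite lt_min r0 divr_gt0.
move=> y; rewrite lt_min ltr_pdivlMr // => /andP[yr ye].
apply: (le_trans (H _ _ _ yr)); first by rewrite subrr normr0.
by rewrite distrC; have := normr_ge0 (y - x); nra.
Qed.

Lemma locally_lipschitz_fst (V W : normedModType R) (f : V -> W) (x : V * R) :
  locally_lipschitz f x.1 -> locally_lipschitz (fun q : V * R => f q.1) x.
Proof.
have fst_le (q : V * R) : `|q.1| <= `|q| by rewrite prod_normE le_max lexx.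
move=> [K K0 [r r0 H]]; exists K => //; exists r => // y z yr zr.
have := H _ _ (le_lt_trans (fst_le _) yr) (le_lt_trans (fst_le _) zr).
by move=> h; apply: (le_trans h); rewrite ler_wpM2l //; exact: (fst_le (y - z)).
Qed.

Lemma locally_lipschitz_pair (V W W' : normedModType R) (f : V -> W) (g : V -> W')
    (x : V) :
  locally_lipschitz f x -> locally_lipschitz g x ->
  locally_lipschitz (fun y => (f y, g y)) x.
Proof.
move=> [K K0 [r r0 Hf]] [K' K'0 [r' r'0 Hg]].
exists (K + K'); first exact: addr_ge0.
exists (Num.min r r'); first by rewrite lt_min r0.
move=> y z; rewrite !lt_min => /andP[yr yr'] /andP[zr zr'].
rewrite prod_normE ge_max /= mulrDl.
have := Hf _ _ yr zr; have := Hg _ _ yr' zr'.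
have : 0 <= K * `|y - z| by rewrite mulr_ge0.
have : 0 <= K' * `|y - z| by rewrite mulr_ge0.
by move=> *; apply/andP; split; lra.
Qed.

Section Matrices.
Variables (V : normedModType R) (x : V).

Lemma locally_lipschitz_mulmx (p q r : nat) (f : V -> 'M[R]_(p, q))
    (g : V -> 'M[R]_(q, r)) :
  locally_lipschitz f x -> locally_lipschitz g x ->
  locally_lipschitz (fun y => f y *m g y) x.
Proof.
move=> fL gL; have [C C0 [d d0 Cf]] := locally_lipschitz_bounded fL.
have [C' C'0 [d' d'0 Cg]] := locally_lipschitz_bounded gL.
case: fL gL => [K K0 [e e0 Hf]] [K' K'0 [e' e'0 Hg]].
exists (q%:R * (K * C' + C * K')); first by rewrite mulr_ge0 // addr_ge0 // mulr_ge0.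
exists (Num.min (Num.min d d') (Num.min e e')); first by rewrite !lt_min d0 d'0 e0.
move=> y z; rewrite !lt_min => /andP[/andP[yd yd'] /andP[ye ye']].
move=> /andP[/andP[zd zd'] /andP[ze ze']].
have -> : f y *m g y - f z *m g z = (f y - f z) *m g y + f z *m (g y - g z).
  by rewrite mulmxBl mulmxBr addrA subrK.
apply: (le_trans (ler_normD _ _)).
have h1 := mulmx_norm_le (f y - f z) (g y).
have h2 := mulmx_norm_le (f z) (g y - g z).
have h3 : `|f y - f z| * `|g y| <= (K * `|y - z|) * C' by rewrite ler_pM // ?Hf ?Cg.
have h4 : `|f z| * `|g y - g z| <= C * (K' * `|y - z|) by rewrite ler_pM // ?Hg ?Cf.
apply: (le_trans (lerD h1 h2)); rewrite -!mulrA -mulrDr ler_wpM2l //.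
by apply: (le_trans (lerD h3 h4)); rewrite le_eqVlt; apply/orP; left; apply/eqP; ring.
Qed.

Lemma locally_lipschitz_invmx (n : nat) (f : V -> 'M[R]_n) :
  locally_lipschitz f x -> (\forall y \near x, f y \in unitmx) ->
  locally_lipschitz (fun y => invmx (f y)) x.
Proof.
move=> fL uf; have fx := nbhs_singleton uf.
have [C C0 [d d0 HC]] := invmx_bounded_near fx.
have /cvgrPdist_lt/(_ _ d0)/nearW_radius[d' d'0 fd] := locally_lipschitz_continuous fL.
case: fL uf => [K K0 [e e0 Hf]] /nearW_radius[e' e'0 uf].
exists (n%:R * (n%:R * C * K) * C); first by rewrite !mulr_ge0.
exists (Num.min d' (Num.min e e')); first by rewrite !lt_min d'0 e0.
move=> y z; rewrite !lt_min => /andP[yd /andP[ye ye']] /andP[zd /andP[ze ze']].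
have Cy : `|invmx (f y)| <= C by apply: HC; rewrite ?uf // distrC fd.
have Cz : `|invmx (f z)| <= C by apply: HC; rewrite ?uf // distrC fd.
rewrite invmx_sub ?uf //; apply: (le_trans (mulmx_norm_le _ _)).
have h : `|invmx (f z) *m (f z - f y)| <= n%:R * C * (K * `|y - z|).
  apply: (le_trans (mulmx_norm_le _ _)); rewrite distrC.
  by rewrite ler_pM ?mulr_ge0 ?Hf // ler_wpM2l.
apply: (@le_trans _ _ (n%:R * (n%:R * C * (K * `|y - z|)) * C)).
  by rewrite ler_pM ?mulr_ge0 // ler_wpM2l.
by rewrite le_eqVlt; apply/orP; left; apply/eqP; ring.
Qed.

Lemma locally_lipschitz_trmx (p q : nat) (f : V -> 'M[R]_(p, q)) :
  locally_lipschitz f x -> locally_lipschitz (fun y => (f y)^T) x.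
Proof.
move=> [K K0 [r r0 H]]; exists K => //; exists r => // y z yr zr.
by rewrite -linearB /= (le_trans (trmx_norm_le _)) // H.
Qed.

Lemma locally_lipschitz_col_mxN (p q r : nat) (f : V -> 'M[R]_(p, r))
    (g : V -> 'M[R]_(q, r)) :
  locally_lipschitz f x -> locally_lipschitz g x ->
  locally_lipschitz (fun y => col_mx (- f y) (g y)) x.
Proof.
move=> [K K0 [e e0 Hf]] [K' K'0 [e' e'0 Hg]].
exists (K + K'); first exact: addr_ge0.
exists (Num.min e e'); first by rewrite lt_min e0.
move=> y z; rewrite !lt_min => /andP[ye ye'] /andP[ze ze'].
have := Hf _ _ ye ze; have := Hg _ _ ye' ze'.
have : 0 <= K * `|y - z| by rewrite mulr_ge0.
have : 0 <= K' * `|y - z| by rewrite mulr_ge0.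
move=> a b c d.
rewrite opp_col_mx add_col_mx -opprD mulrDl.
by apply: col_mx_norm_le; rewrite ?normrN; lra.
Qed.

End Matrices.

End LocallyLipschitz.

(** * Derivatives along curves and of components *)

Section ChainRule.
Context {R : realType}.

Lemma is_derive_curve (V W : normedModType R) (c : R -> V) (f : V -> W) (t : R) (w : V) :
  is_derive t (1 : R) c w -> differentiable f (c t) ->
  is_derive t (1 : R) (f \o c) ('D_w f (c t)).
Proof.
move=> [dc cw] df; have dc' : differentiable c t by apply/derivable1_diffP.
have dfc := differentiable_comp dc' df.
split; first exact/derivable1_diffP.
by rewrite deriveE // diff_comp //= deriveE // -cw deriveE.
Qed.

Lemma is_derive_entry (V : normedModType R) (p q : nat) (f : V -> 'M[R]_(p, q))
    (x v : V) (d : 'M[R]_(p, q)) i j :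
  is_derive x v f d -> is_derive x v (fun y => f y i j) (d i j).
Proof.
move=> /is_deriveP_eps H; apply/is_deriveP_eps => e e0.
have [r r0 Hr] := H _ e0; exists r => // t /Hr; apply: le_trans.
have -> : f (t *: v + x) i j - f x i j - t *: d i j = (f (t *: v + x) - f x - t *: d) i j.
  by rewrite !mxE.
exact: mx_entry_le.
Qed.

Lemma derive_comp (U V W : normedModType R) (g : U -> V) (f : V -> W) (u w : U) :
  differentiable g u -> differentiable f (g u) ->
  'D_w (f \o g) u = 'D_('D_w g u) f (g u).
Proof.
move=> dg df; have dfg := differentiable_comp dg df.
by rewrite deriveE // diff_comp //= deriveE // deriveE.
Qed.

Lemma is_derive_snd (V W : normedModType R) (f : V * R -> W) (u : V) (t : R) :
  derivable f (u, t) (0, 1) ->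
  is_derive t (1 : R) (fun s => f (u, s)) ('D_(0, 1) f (u, t)).
Proof.
move=> /derivableP/is_deriveP_eps H; apply/is_deriveP_eps => e e0.
have [r r0 Hr] := H _ e0; exists r => // s sr; have := Hr s sr.
suff -> : s *: (0, 1) + (u, t) = (u, s *: 1 + t) :> V * R by [].
by apply: injective_projections => /=; rewrite ?scaler0 ?add0r.
Qed.

Lemma is_derive1_quotient (W : normedModType R) (g : R -> W) (d : W) :
  is_derive (0 : R) (1 : R) g d ->
  (fun s => s^-1 *: (g s - g 0)) @ 0^' --> d.
Proof.
move=> [gd <-]; have : (fun s => s^-1 *: ((g \o shift 0) (s *: 1) - g 0)) @ 0^' --> 'D_1 g 0
  by exact: gd.
by apply: cvg_trans; apply: near_eq_cvg; near=> s; rewrite /= addr0 scaler1.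
Unshelve. all: by end_near. Qed.

Lemma cvg_mulmx00 (T : Type) (F : set_system T) (FF : Filter F) (n : nat)
    (f : T -> 'rV[R]_n) (g : T -> 'cV[R]_n) (a : 'rV[R]_n) (b : 'cV[R]_n) :
  f @ F --> a -> g @ F --> b -> (fun t => (f t *m g t) 0 0) @ F --> (a *m b) 0 0.
Proof.
move=> fa gb; rewrite mxE.
have -> : (fun t => (f t *m g t) 0 0) = (fun t => \sum_j f t 0 j * g t j 0).
  by apply/funext => t; rewrite mxE.
elim: (index_enum _) => [|i r IHr].
  by rewrite big_nil; under eq_cvg do rewrite big_nil; exact: cvg_cst.
rewrite big_cons; under eq_cvg do rewrite big_cons.
apply: cvgD => //; apply: cvgM.
  by apply: (cvg_comp f (fun M : 'rV[R]_n => M 0 i) fa); exact: (@coord_continuous R 1 n 0 i a).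
by apply: (cvg_comp g (fun M : 'cV[R]_n => M i 0) gb); exact: (@coord_continuous R n 1 i 0 b).
Qed.

End ChainRule.

(** * Lipschitz continuity of compositions, assembled matrices and Jacobians *)

Section MoreLipschitz.
Context {R : realType}.

Lemma locally_lipschitz_comp (U V W : normedModType R) (g : U -> V) (f : V -> W) (u : U) :
  locally_lipschitz g u -> locally_lipschitz f (g u) -> locally_lipschitz (f \o g) u.
Proof.
move=> gL; have gc := locally_lipschitz_continuous gL.
case: gL => [K K0 [r r0 Hg]] [K' K'0 [r' r'0 Hf]].
have /cvgrPdist_lt/(_ _ r'0)/nearW_radius[d d0 Hd] := gc.
exists (K' * K); first exact: mulr_ge0.
exists (Num.min r d); first by rewrite lt_min r0.
move=> y z; rewrite !lt_min => /andP[yr yd] /andP[zr zd].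
apply: (le_trans (Hf _ _ _ _)).
- by rewrite distrC Hd.
- by rewrite distrC Hd.
- by rewrite -mulrA ler_wpM2l // Hg.
Qed.

Lemma locally_lipschitz_eq (V W : normedModType R) (f g : V -> W) (x : V) :
  (\forall y \near x, f y = g y) -> locally_lipschitz f x -> locally_lipschitz g x.
Proof.
move=> /nearW_radius[d d0 fg] [K K0 [r r0 H]]; exists K => //.
exists (Num.min r d); first by rewrite lt_min r0.
move=> y z; rewrite !lt_min => /andP[yr yd] /andP[zr zd].
by rewrite -!fg // H.
Qed.

Lemma locally_lipschitz_mx (V : normedModType R) (p q : nat) (F : 'I_q -> V -> 'cV[R]_p)
    (x : V) :
  (forall j, locally_lipschitz (F j) x) ->
  locally_lipschitz (fun y => \matrix_(i, j) F j y i 0) x.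
Proof.
move=> FL; have H j : exists Kr : R * R, [/\ 0 <= Kr.1, 0 < Kr.2 & forall y z,
    `|y - x| < Kr.2 -> `|z - x| < Kr.2 -> `|F j y - F j z| <= Kr.1 * `|y - z|].
  by have [K K0 [r r0 ?]] := FL j; exists (K, r).
have [Kr HKr] := choice H.
exists (\sum_j (Kr j).1); first by apply: sumr_ge0 => j _; have [] := HKr j.
have : \forall y \near x, forall j, `|y - x| < (Kr j).2.
  apply: filter_forall => j; apply/nearW_radius; exists (Kr j).2 => //.
  by have [] := HKr j.
move=> /nearW_radius[r r0 Hr]; exists r => // y z yr zr.
have S0 j : 0 <= (Kr j).1 by have [] := HKr j.
apply: mx_norm_le => [|i j]; first by rewrite mulr_ge0 // sumr_ge0.
rewrite !mxE; apply: (@le_trans _ _ ((Kr j).1 * `|y - z|)).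
  have [_ _ h] := HKr j; apply: le_trans (h y z (Hr _ yr j) (Hr _ zr j)).
  have -> : F j y i 0 - F j z i 0 = (F j y - F j z) i 0 by rewrite !mxE.
  exact: mx_entry_le.
by rewrite ler_wpM2r // (bigD1 j) //= lerDl sumr_ge0.
Qed.

Lemma locally_lipschitz_block_diag (V : normedModType R) (p q : nat)
    (f : V -> 'M[R]_p) (g : V -> 'M[R]_q) (x : V) :
  locally_lipschitz f x -> locally_lipschitz g x ->
  locally_lipschitz (fun y => block_mx (f y) 0 0 (g y)) x.
Proof.
move=> [K K0 [e e0 Hf]] [K' K'0 [e' e'0 Hg]].
exists (K + K'); first exact: addr_ge0.
exists (Num.min e e'); first by rewrite lt_min e0.
move=> y z; rewrite !lt_min => /andP[ye ye'] /andP[ze ze'].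
have := Hf _ _ ye ze; have := Hg _ _ ye' ze'.
have : 0 <= K * `|y - z| by rewrite mulr_ge0.
have : 0 <= K' * `|y - z| by rewrite mulr_ge0.
move=> a b c d; rewrite mulrDl.
have S0 : 0 <= K * `|y - z| + K' * `|y - z| by exact: addr_ge0.
rewrite opp_block_mx add_block_mx !subrr.
apply: mx_norm_le => // i j; rewrite mxE.
case: (fintype.split i) => i'; rewrite mxE; case: (fintype.split j) => j'.
- by apply: (le_trans (mx_entry_le _ _ _)); lra.
- by rewrite mxE normr0.
- by rewrite mxE normr0.
- by apply: (le_trans (mx_entry_le _ _ _)); lra.
Qed.

End MoreLipschitz.

Section JacobianLipschitz.
Context {R : realType}.

Definition jac (p q : nat) (f : 'cV[R]_p -> 'cV[R]_q) (u : 'cV[R]_p) : 'M[R]_(q, p) :=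
  \matrix_(i, j) ('D_(delta_mx j 0) f u) i 0.

Lemma jacE (p q : nat) (f : 'cV[R]_p -> 'cV[R]_q) (u w : 'cV[R]_p) :
  differentiable f u -> 'D_w f u = jac f u *m w.
Proof.
move=> df; rewrite (derive_coord_sum (cV_coordinates p)) //.
apply/matrixP => i j; rewrite summxE mxE; apply: eq_bigr => l _.
by rewrite !mxE ord1 mulrC.
Qed.

Lemma jac_locally_lipschitz (p q : nat) (f : 'cV[R]_p -> 'cV[R]_q) (u : 'cV[R]_p) :
  classC_near 2 u f -> locally_lipschitz (jac f) u.
Proof.
move=> fC; apply: (@locally_lipschitz_mx _ _ _ _ (fun j => 'D_(delta_mx j 0) f)) => j.
apply: (classC_near1_locally_lipschitz (cV_coordinates p)).
exact: classC_near_derive.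
Qed.

End JacobianLipschitz.

Lemma posdef_unitmx (R : realType) (n : nat) (A : 'M[R]_n) : posdef A -> A \in unitmx.
Proof.
move=> [_ Apos]; rewrite -unitmx_tr -row_free_unit -kermx_eq0; apply/rowV0P => v.
move=> /sub_kermxP vA; have [->|v0] := eqVneq v 0; first by [].
have vT0 : v^T != 0 by apply: contraNneq v0 => vT; rewrite -[v]trmxK vT trmx0.
have := Apos _ vT0; rewrite trmxK.
have -> : v *m A *m v^T = v *m (v *m A^T)^T by rewrite trmx_mul trmxK mulmxA.
by rewrite vA trmx0 mulmx0 mxE ltxx.
Qed.

Lemma near_continuous (T T' : topologicalType) (f : T -> T') (x : T) (P : T' -> Prop) :
  {for x, continuous f} -> (\forall y \near f x, P y) -> \forall z \near x, P (f z).
Proof. by move=> fc /fc. Qed.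

(** * Monotonicity of the shock speed at the base state *)

Section ShockSpeed.
Context {R : realType} {h m : nat}.
Variables (S : system R h m) (F : fields R h m) (W : waves R h m) (k : 'I_(h + m)).
Hypothesis S_smooth : smooth_coefficients S.
Hypothesis S_conservative : conservative_form S.
Hypothesis S_structure : structure_conditions S.
Hypothesis F_fields : characteristic_fields S F k.
Hypothesis W_hugoniot : hugoniot_curves S F W.

Let U := ustar S.
Let N := (h + m)%N.

Lemma Emx_locally_lipschitz : locally_lipschitz (Emx S) U.
Proof.
case: S_smooth => [[E1 E2] _ _ _ _].
by apply: locally_lipschitz_block_diag;
  apply: (classC_near1_locally_lipschitz (cV_coordinates N)); exact: smooth_classC_near.
Qed.

Lemma Emx_unit_near : \forall u \near U, Emx S u \in unitmx.
Proof. by case: S_structure => [_ _ Epos _ _]; apply: filterS Epos => u; exact: posdef_unitmx. Qed.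

(* [Mc E] is the Jacobian of [g o v]. *)
Lemma multiplier_locally_lipschitz (Mc : 'cV[R]_N -> 'M[R]_N) :
  (\forall u \near U, Mc u \in unitmx /\ forall w : 'cV[R]_N,
     'D_w (g_ S \o v_ S) u = Mc u *m Emx S u *m w /\
     'D_w (f_ S \o v_ S) u = Mc u *m Amx S u *m w) ->
  locally_lipschitz Mc U.
Proof.
case: S_conservative => [fS gS vS _ _] HMc.
have vC n : classC_near n U (v_ S) by exact: smooth_classC_near.
have gC n : classC_near n (v_ S U) (g_ S) by exact: smooth_classC_near.
have vd : \forall u \near U, differentiable (v_ S) u.
  apply: filterS (classC_near_near (vC 1)) => u.
  exact: (classC_near1_differentiable (cV_coordinates N)).
have gd : \forall u \near U, differentiable (g_ S) (v_ S u).
  apply: (near_continuous (P := fun w => differentiable (g_ S) w) (classC_near_continuous (vC 1))).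
  apply: filterS (classC_near_near (gC 1)) => u.
  exact: (classC_near1_differentiable (cV_coordinates N)).
have JL : locally_lipschitz (fun u => jac (g_ S) (v_ S u) *m jac (v_ S) u) U.
  apply: locally_lipschitz_mulmx; last exact: jac_locally_lipschitz.
  apply: (locally_lipschitz_comp (g := v_ S)); last exact: jac_locally_lipschitz.
  exact: (classC_near1_locally_lipschitz (cV_coordinates N)).
have EL := locally_lipschitz_invmx Emx_locally_lipschitz Emx_unit_near.
apply: (locally_lipschitz_eq _ (locally_lipschitz_mulmx JL EL)).
near=> u.
have [_ Mu] : Mc u \in unitmx /\ forall w : 'cV[R]_N,
     'D_w (g_ S \o v_ S) u = Mc u *m Emx S u *m w /\
     'D_w (f_ S \o v_ S) u = Mc u *m Amx S u *m w by near: u.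
have uE : Emx S u \in unitmx by near: u; exact: Emx_unit_near.
suff -> : jac (g_ S) (v_ S u) *m jac (v_ S) u = Mc u *m Emx S u.
  by rewrite -mulmxA mulmxV // mulmx1.
have dv : differentiable (v_ S) u by near: u.
have dg : differentiable (g_ S) (v_ S u) by near: u.
apply/matrixP => i j.
have Hw (w : 'cV[R]_N) : jac (g_ S) (v_ S u) *m jac (v_ S) u *m w = Mc u *m Emx S u *m w.
  by have [<- _] := Mu w; rewrite derive_comp // jacE // [in RHS]jacE // mulmxA.
have := Hw (delta_mx j 0); rewrite -!colE => /colP/(_ i).
by rewrite !mxE.
Unshelve. all: by end_near. Qed.

(** Symmetry of [Amx] and [Emx] turns a right eigenvector of the pencil into a left one; this is the
    covector against which the Rankine-Hugoniot relation is tested. *)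
Lemma left_eigenvector (u : 'cV[R]_N) (r : 'cV[R]_N) (a : R) :
  Emx S u \in unitmx -> (Emx S u)^T = Emx S u -> (Amx S u)^T = Amx S u ->
  EA S u *m r = a *: r -> r^T *m Amx S u = a *: (r^T *m Emx S u).
Proof.
move=> uE ET AT; rewrite /EA => EAr.
have Ar : Amx S u *m r = a *: (Emx S u *m r).
  by rewrite scalemxAr -EAr !mulmxA mulmxV // mul1mx.
by rewrite -{1}AT -trmx_mul Ar linearZ /= trmx_mul ET.
Qed.

(* Differentiating the Rankine-Hugoniot relation along the curve and testing
   it with the left eigenvector gives
   (lambda - sigma) r^T E h' = sigma' r^T Mc^-1 (g(h) - g(u_star));
   dividing by s and letting s -> 0 yields sigma'(0) = (lambda o h)'(0) / 2. *)
Lemma shock_speed_slope_pos :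
  0 < 'D_(0, 1) (fun q : 'cV[R]_N * R => sigma W k q.1 q.2) (U, 0).
Proof.
case: (F_fields) => [FC Feig _ [_ lamU0] [_ [d d0 Hd]]].
have [lamC rC] := FC k.
have [hC sC hinit HRH] := W_hugoniot k.
case: (S_conservative) => [fS gS vS _ [Mc HMc]].
case: (S_structure) => [_ Asym Epos _ _].
have McL := multiplier_locally_lipschitz HMc.
have [hU sU [c c0 dh0]] := nbhs_singleton hinit.
set H := (fun q : 'cV[R]_N * R => hcurve W k q.1 q.2) in hC.
set Sg := (fun q : 'cV[R]_N * R => sigma W k q.1 q.2) in sC *.
pose hs s := hcurve W k U s; pose ss s := sigma W k U s.
pose dh s := 'D_(0, 1) H (U, s); pose ds s := 'D_(0, 1) Sg (U, s).
have pairc : {for (0 : R), continuous (fun s : R => (U, s))}.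
  have cU : (fun=> U) @ (0 : R) --> U by exact: cvg_cst.
  have ci : id @ (0 : R) --> (0 : R) by exact: cvg_id.
  exact: cvg_pair cU ci.
have dhP : \forall s \near (0 : R), is_derive s (1 : R) hs (dh s).
  apply: filterS (near_continuous pairc (classC_near_near (classC_near1W hC))) => s Cs.
  apply: (is_derive_snd (f := H)); exact: classC_near1_derivable.
have dsP : \forall s \near (0 : R), is_derive s (1 : R) ss (ds s).
  apply: filterS (near_continuous pairc (classC_near_near (classC_near1W sC))) => s Cs.
  apply: (is_derive_snd (f := Sg)); exact: classC_near1_derivable.
have hs0 : hs 0 = U by [].
have ss0 : ss 0 = 0 by rewrite /ss sU.
have dh0E : dh 0 = c *: rv F k U.
  have [_ <-] := dh0; by have [_ <-] := nbhs_singleton dhP.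
have dhc : {for (0 : R), continuous dh}.
  apply: (@continuous_comp _ _ _ (fun s : R => (U, s)) ('D_(0, 1) H)) => //.
  exact: classC_near_continuous (classC_near_derive _ hC).
have dsc : {for (0 : R), continuous ds}.
  apply: (@continuous_comp _ _ _ (fun s : R => (U, s)) ('D_(0, 1) Sg)) => //.
  exact: classC_near_continuous (classC_near_derive _ sC).
have hsc : {for (0 : R), continuous hs}.
  exact: is_derive1_continuous (nbhs_singleton dhP).
have nearh (P : 'cV[R]_N -> Prop) : (\forall u \near U, P u) -> \forall s \near (0 : R), P (hs s).
  by move=> PU; apply: near_continuous hsc _; rewrite hs0.
(* [rho] cancels the multiplier: [rho *m Mc] is the transposed eigenvector, so that testing the
   Jacobians of [g o v] and [f o v] leaves only multiples of [eta]. *)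
pose rho u := (rv F k u)^T *m invmx (Mc u).
have rhoc : {for (0 : R), continuous (rho \o hs)}.
  apply: (@continuous_comp _ _ _ hs rho); first exact: hsc.
  rewrite hs0; apply: locally_lipschitz_continuous.
  apply: locally_lipschitz_mulmx.
    apply: locally_lipschitz_trmx.
    exact: (classC_near1_locally_lipschitz (cV_coordinates N) (classC_near1W rC)).
  by apply: locally_lipschitz_invmx => //; apply: filterS HMc => u [].
pose eta u := (rv F k u)^T *m Emx S u.
have etac : {for (0 : R), continuous (eta \o hs)}.
  apply: (@continuous_comp _ _ _ hs eta); first exact: hsc.
  rewrite hs0; apply: locally_lipschitz_continuous.
  apply: locally_lipschitz_mulmx; last exact: Emx_locally_lipschitz.
  apply: locally_lipschitz_trmx.
  exact: (classC_near1_locally_lipschitz (cV_coordinates N) (classC_near1W rC)).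
pose fv := f_ S \o v_ S; pose gv := g_ S \o v_ S.
have vd : \forall u \near U, differentiable (v_ S) u.
  apply: filterS (classC_near_near (smooth_classC_near 1 vS)) => u.
  exact: (classC_near1_differentiable (cV_coordinates N)).
have vc := classC_near_continuous (smooth_classC_near 1 vS).
have gvd : \forall u \near U, differentiable gv u.
  have : \forall u \near U, differentiable (g_ S) (v_ S u).
    apply: (near_continuous (P := fun w => differentiable (g_ S) w) vc).
    apply: filterS (classC_near_near (smooth_classC_near 1 gS)) => u.
    exact: (classC_near1_differentiable (cV_coordinates N)).
  by apply: filterS2 vd => u; exact: differentiable_comp.
have fvd : \forall u \near U, differentiable fv u.
  have : \forall u \near U, differentiable (f_ S) (v_ S u).
    apply: (near_continuous (P := fun w => differentiable (f_ S) w) vc).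
    apply: filterS (classC_near_near (smooth_classC_near 1 fS)) => u.
    exact: (classC_near1_differentiable (cV_coordinates N)).
  by apply: filterS2 vd => u; exact: differentiable_comp.
have RH : \forall s \near (0 : R), fv (hs s) = ss s *: (gv (hs s) - gv U) + fv U.
  apply: filterS (near_continuous pairc HRH) => s /= HH.
  by rewrite /fv /gv /= -HH subrK.
(* The relation is differentiated at each [s] near 0, so it must hold on a neighbourhood of [s] and
   not only at [s]. *)
have nRH : \forall s \near (0 : R), \forall t \near s,
    fv (hs t) = ss t *: (gv (hs t) - gv U) + fv U.
  exact: near_join RH.
have key : \forall s \near (0 : R),
    (lam F k (hs s) - ss s) * (eta (hs s) *m dh s) 0 0 =
    ds s * (rho (hs s) *m (gv (hs s) - gv U)) 0 0.
  near=> s.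
  have dhs : is_derive s (1 : R) hs (dh s) by near: s.
  have dss : is_derive s (1 : R) ss (ds s) by near: s.
  have gvs : differentiable gv (hs s) by near: s; exact: nearh gvd.
  have fvs : differentiable fv (hs s) by near: s; exact: nearh fvd.
  have [uM HM] : Mc (hs s) \in unitmx /\ forall w : 'cV[R]_N,
     'D_w gv (hs s) = Mc (hs s) *m Emx S (hs s) *m w /\
     'D_w fv (hs s) = Mc (hs s) *m Amx S (hs s) *m w by near: s; exact: nearh HMc.
  have [HG HF] := HM (dh s).
  have dfv := is_derive_curve dhs fvs; have dgv := is_derive_curve dhs gvs.
  have sRH : \forall t \near s, fv (hs t) = ss t *: (gv (hs t) - gv U) + fv U by near: s.
  have uE : Emx S (hs s) \in unitmx by near: s;
    exact: (nearh (fun u => Emx S u \in unitmx) Emx_unit_near).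
  have ET : (Emx S (hs s))^T = Emx S (hs s).
    near: s; apply: (nearh (fun u => (Emx S u)^T = Emx S u)).
    by apply: filterS Epos => u [].
  have AT : (Amx S (hs s))^T = Amx S (hs s) by near: s;
    exact: (nearh (fun u => (Amx S u)^T = Amx S u) Asym).
  have eig : EA S (hs s) *m rv F k (hs s) = lam F k (hs s) *: rv F k (hs s).
    near: s; apply: (nearh (fun u => EA S u *m rv F k u = lam F k u *: rv F k u)).
    by apply: filterS Feig => u /(_ k)[].
  have := left_eigenvector uE ET AT eig; rewrite -/(eta (hs s)) => lefteig.
  have E1 : 'D_(dh s) fv (hs s) =
      ds s *: (gv (hs s) - gv U) + ss s *: 'D_(dh s) gv (hs s).
    apply/colP => i; rewrite !mxE -/(gv (hs s)) -/(gv U).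
    have df_i := is_derive_entry i 0 dfv; have dg_i := is_derive_entry i 0 dgv.
    have [_ <-] := df_i.
    pose rhs t := ss t * (gv (hs t) i 0 - gv U i 0) + fv U i 0.
    have : is_derive s (1 : R) rhs
        (ss s *: ('D_(dh s) gv (hs s) i 0 - 0) + (gv (hs s) i 0 - gv U i 0) *: ds s + 0).
      have d1 := is_derive_cst (gv U i 0) s (1 : R).
      have d2 := is_derive_cst (fv U i 0) s (1 : R).
      exact: (is_deriveD (is_deriveM dss (is_deriveB dg_i d1)) d2).
    rewrite subr0 addr0 => -[_ E]; rewrite addrC [ds s * _]mulrC -E.
    apply: near_eq_derive.
    by apply: filterS sRH => t /= ->; rewrite !mxE.
  have := congr1 (fun w => (rho (hs s) *m w) 0 0) E1.
  rewrite HG HF mulmxDr -!scalemxAr.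
  have rhoM : rho (hs s) *m Mc (hs s) = (rv F k (hs s))^T.
    by rewrite /rho -mulmxA mulVmx // mulmx1.
  rewrite !mulmxA rhoM lefteig -/(eta (hs s)) -scalemxAl.
  rewrite [in RHS]mxE 3!(mxE scalemx_key) => E2.
  by rewrite mulrBl E2 addrK.
have lamd : differentiable (lam F k) (hs 0).
  by rewrite hs0; exact: (classC_near1_differentiable (cV_coordinates N) (classC_near1W lamC)).
have dlam := is_derive_curve (nbhs_singleton dhP) lamd.
set D := 'D_(dh 0) (lam F k) (hs 0) in dlam.
have D0 : 0 < D.
  have -> : D = c * 'D_(rv F k U) (lam F k) U.
    by rewrite /D dh0E deriveE // linearZ -deriveE // hs0.
  by apply: mulr_gt0 => //; exact: lt_le_trans d0 (nbhs_singleton Hd).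
have dlams := is_deriveB dlam (nbhs_singleton dsP).
have q1 := is_derive1_quotient dlams.
have q2 := is_derive1_quotient (is_derive_curve (nbhs_singleton dhP) (nbhs_singleton (nearh _
  gvd))).
have [r0 _] := nbhs_singleton Feig k.
have [uM0 /(_ (dh 0))[HG0 _]] := nbhs_singleton HMc.
(* [e] is [c] times r_k^T E r_k, positive since E is positive definite. It is also the limit of the
   tested difference quotient of [g o v], so after division by [s] both sides of [key] carry the
   same nonzero factor in the limit. *)
pose e := (eta (hs 0) *m dh 0) 0 0.
have e0 : 0 < e.
  rewrite /e /eta dh0E hs0 -scalemxAr mxE; apply: mulr_gt0 => //.
  have [_ Ep] := nbhs_singleton Epos; exact: Ep r0.
have c1 : (fun s => (eta (hs s) *m dh s) 0 0) @ 0^' --> e.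
  by apply: cvg_mulmx00; [apply: (cvg_within_filter (f := eta \o hs));
    exact: etac|apply: (cvg_within_filter (f := dh)); exact: dhc].
have c2 : (fun s => (rho (hs s) *m (s^-1 *: (gv (hs s) - gv (hs 0)))) 0 0) @ 0^' --> e.
  have -> : e = (rho (hs 0) *m 'D_(dh 0) gv (hs 0)) 0 0.
    by rewrite /e /eta /rho hs0 HG0 !mulmxA -[_ *m invmx _ *m Mc _]mulmxA mulVmx // mulmx1.
  by apply: cvg_mulmx00; [apply: (cvg_within_filter (f := rho \o hs)); exact: rhoc|exact: q2].
have c3 : ds @ 0^' --> ds 0 by apply: cvg_within_filter.
pose quo s := s^-1 *: ((lam F k \o hs) s - ss s - ((lam F k \o hs) 0 - ss 0))
  * (eta (hs s) *m dh s) 0 0.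
have L1 : quo @ 0^' --> (D - ds 0) * e by exact: cvgM q1 c1.
have L2 : (fun s => ds s * (rho (hs s) *m (s^-1 *: (gv (hs s) - gv (hs 0)))) 0 0) @ 0^'
    --> ds 0 * e by exact: cvgM c3 c2.
have L3 : quo @ 0^' --> ds 0 * e.
  apply: cvg_trans L2; apply: near_eq_cvg.
  rewrite near_withinE; apply: filterS key => s E _.
  rewrite /quo /= hs0 lamU0 ss0 !subr0 -!scalemxAr [in LHS]mxE.
  by rewrite mulrCA -E mulrA.
have : (D - ds 0) * e = ds 0 * e by exact: (norm_cvg_unique L1 L3).
move=> /(mulIf (lt0r_neq0 e0)) E; rewrite -/(ds 0); lra.
Unshelve. all: by end_near. Qed.

End ShockSpeed.

(** * The characteristic curve in center manifold coordinates *)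

Section CharacteristicCurves.
(* The data stand for the k-th field: [ic] and [hc] for the curves i_k and h_k,
   [hd] for the derivative of h_k in s, [bb] for the layer curve (u, z_c) and
   [vf] for its vector field (r_c, theta_c), [sg], [su], [sb] for sigma_k and the
   two critical parameters.  [char_curve] is gamma_k in the coordinates (u, z_c) of
   the center manifold. *)
Context {R : realType} {X : normedModType R}.
Variables (x0 : X) (rho K c : R).
Variables (lam : X -> R) (rk : X -> X) (vf : X * R -> X * R).
Variables (ic hc : X -> R -> X) (hd : X * R -> X) (bb : X -> R -> X * R).
Variables (sg : X -> R -> R) (su sb : X -> R).

Hypothesis rho0 : 0 < rho.
Hypothesis rho1 : rho <= 1.
Hypothesis K1 : 1 <= K.
Hypothesis c0 : 0 < c.

Hypothesis lam0 : lam x0 = 0.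
Hypothesis lam_lip : forall u v, `|u - x0| < rho -> `|v - x0| < rho ->
  `|lam u - lam v| <= K * `|u - v|.
Hypothesis rk_lip : forall u v, `|u - x0| < rho -> `|v - x0| < rho ->
  `|rk u - rk v| <= K * `|u - v|.
Hypothesis rk_bound : forall u, `|u - x0| < rho -> `|rk u| <= K.
Hypothesis vf_lip : forall p q, `|p - (x0, 0)| < rho -> `|q - (x0, 0)| < rho ->
  `|vf p - vf q| <= K * `|p - q|.
Hypothesis vf_bound : forall p, `|p - (x0, 0)| < rho -> `|vf p| <= K.
Hypothesis ic0 : forall u, `|u - x0| < rho -> ic u 0 = u.
Hypothesis ic_ode : forall u s, `|u - x0| < rho -> `|s| < rho ->
  is_derive s (1 : R) (ic u) (rk (ic u s)).
Hypothesis bb0 : forall u, `|u - x0| < rho -> bb u 0 = (u, 0).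
Hypothesis bb_ode : forall u s, `|u - x0| < rho -> `|s| < rho ->
  is_derive s (1 : R) (bb u) (vf (bb u s)).
Hypothesis hc0 : forall u, `|u - x0| < rho -> hc u 0 = u.
Hypothesis hc_deriv : forall u s, `|u - x0| < rho -> `|s| < rho ->
  is_derive s (1 : R) (hc u) (hd (u, s)).
Hypothesis hd_lip : forall u v s t, `|u - x0| < rho -> `|v - x0| < rho ->
  `|s| < rho -> `|t| < rho -> `|hd (u, s) - hd (v, t)| <= K * (`|u - v| + `|s - t|).
Hypothesis hd_bound : forall u s, `|u - x0| < rho -> `|s| < rho -> `|hd (u, s)| <= K.
Hypothesis sg0 : forall u, `|u - x0| < rho -> sg u 0 = lam u.
Hypothesis sg_lip : forall u v s, `|u - x0| < rho -> `|v - x0| < rho -> `|s| < rho ->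
  `|sg u s - sg v s| <= K * `|u - v|.
Hypothesis sg_slope : forall u s t, `|u - x0| < rho -> `|s| < rho -> `|t| < rho ->
  s <= t -> c * (t - s) <= sg u t - sg u s.
Hypothesis lam_slope : forall u s t, `|u - x0| < rho -> `|s| < rho -> `|t| < rho ->
  s <= t -> c * (t - s) <= lam (ic u t) - lam (ic u s).
Hypothesis suP : forall u, `|u - x0| < rho -> `|su u| <= K * `|lam u| /\ sg u (su u) = 0.
Hypothesis sbP : forall u, `|u - x0| < rho ->
  `|sb u| <= K * `|lam u| /\ lam (ic u (sb u)) = 0.
Hypothesis su_contact : forall u, `|u - x0| < rho -> lam u <= 0 -> 0 <= su u ->
  bb u (su u) = (hc u (su u), 0).
Hypothesis rk_vf : forall u, `|u - x0| < rho -> lam u = 0 -> rk u = (vf (u, 0)).1.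

Definition wave_curve (u : X) (s : R) : X := if 0 <= s then hc u s else ic u s.

Definition char_curve (u : X) (s : R) : X * R :=
  if lam u < 0 then if s < su u then bb u s else (wave_curve u s, 0)
  else if s < sb u then bb (wave_curve u (sb u)) (s - sb u) else (wave_curve u s, 0).

(** Two nested scales. During times below [curve_radius], curves of speed at most [K] move by less
    than [rho / 4] and stay where the data are controlled. For states within [state_radius] the
    critical parameters are small with respect to [curve_radius]; the power of [K] leaves room for
    the longest chain of bounds by [K], the one for [su] at a displaced state. *)
Definition curve_radius := rho / (4 * K).
Definition state_radius := curve_radius / (20 * K ^+ 6).

Let K0 : 0 <= K. Proof. exact: le_trans ler01 K1. Qed.
Let K0' : 0 < K. Proof. exact: lt_le_trans ltr01 K1. Qed.

Let curve_radius_gt0 : 0 < curve_radius. Proof. by rewrite divr_gt0 // mulr_gt0. Qed.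

Fact curve_radiusK : K * curve_radius = rho / 4. Proof.
by rewrite /curve_radius; field; rewrite gt_eqF. Qed.

Fact curve_radius_le : curve_radius <= rho / 4.
Proof. by rewrite -curve_radiusK ler_peMl // ltW. Qed.

Let state_radius_gt0 : 0 < state_radius. Proof. by rewrite divr_gt0 // mulr_gt0 // exprn_gt0. Qed.

Fact state_radiusK : K ^+ 6 * state_radius = curve_radius / 20.
Proof. by rewrite /state_radius; field; rewrite gt_eqF. Qed.

Fact state_radiusXK n : (n <= 6)%N -> K ^+ n * state_radius <= curve_radius / 20.
Proof.
move=> n6; rewrite -state_radiusK ler_wpM2r ?(ltW state_radius_gt0) //.
by rewrite -(subnK n6) exprD ler_peMl ?exprn_ge0 // exprn_ege1.
Qed.

Fact in_state_ball (u : X) : `|u - x0| < curve_radius -> `|u - x0| < rho.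
Proof. by move=> h; apply: (lt_le_trans h); have := curve_radius_le; have := rho0; lra. Qed.

Fact in_time_ball (s : R) : `|s| < curve_radius -> `|s| < rho.
Proof. by move=> h; apply: (lt_le_trans h); have := curve_radius_le; have := rho0; lra. Qed.

Fact pair_norm_le (x : X) (z e : R) : `|x| <= e -> `|z| <= e -> `|(x, z)| <= e.
Proof. by move=> xe ze; rewrite prod_normE ge_max /= xe. Qed.

Fact pair_fst_le (p : X * R) : `|p.1| <= `|p|.
Proof. by rewrite prod_normE le_max lexx. Qed.

Fact pair_snd_le (p : X * R) : `|p.2| <= `|p|.
Proof. by rewrite prod_normE le_max lexx orbT. Qed.

Fact norm_pair0 (x : X) : `|(x, 0 : R)| = `|x|.
Proof. by rewrite prod_normE /= normr0; apply/max_idPl. Qed.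

Fact pair0B (x y : X) : (x, 0 : R) - (y, 0) = (x - y, 0).
Proof. by apply: injective_projections; rewrite //= subrr. Qed.

(** * Displacement, Taylor expansion and composition of the three curves *)

Lemma ic_close (u : X) (s : R) : `|u - x0| < curve_radius -> `|s| < curve_radius ->
  `|ic u s - x0| < rho /\ `|ic u s - u| <= K * `|s|.
Proof.
move=> ur sr; rewrite -{3}(ic0 (in_state_ball ur)).
apply: (solution_trapped rk_bound K0 (x := ic u) (r := curve_radius)) => //.
  by move=> t tr; exact: ic_ode (in_state_ball ur) (in_time_ball tr).
rewrite ic0 ?in_state_ball // curve_radiusK; have := curve_radius_le; have := rho0; lra.
Qed.

Lemma bb_close (u : X) (s : R) : `|u - x0| < curve_radius -> `|s| < curve_radius ->
  `|bb u s - (x0, 0)| < rho /\ `|bb u s - (u, 0)| <= K * `|s|.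
Proof.
move=> ur sr; rewrite -(bb0 (in_state_ball ur)).
apply: (solution_trapped vf_bound K0 (x := bb u) (r := curve_radius)) => //.
  by move=> t tr; exact: bb_ode (in_state_ball ur) (in_time_ball tr).
rewrite bb0 ?in_state_ball // pair0B norm_pair0 curve_radiusK; have := curve_radius_le;
  have := rho0; lra.
Qed.

Fact between_time (s t : R) : `|s| < curve_radius -> between 0 s t -> `|t| < curve_radius.
Proof. by move=> sr /between0_norm /le_lt_trans; apply. Qed.

Lemma hc_close (u : X) (s : R) : `|u - x0| < curve_radius -> `|s| < curve_radius ->
  `|hc u s - u| <= K * `|s|.
Proof.
move=> ur sr; rewrite -{2}(hc0 (in_state_ball ur)) -{2}(subr0 s).
apply: (mean_value_ineq (g' := fun t => hd (u, t))) => t /(between_time sr) /in_time_ball tr.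
  exact: hc_deriv (in_state_ball ur) tr.
exact: hd_bound (in_state_ball ur) tr.
Qed.

Lemma wave_curve_close (u : X) (s : R) : `|u - x0| < curve_radius -> `|s| < curve_radius ->
  `|wave_curve u s - u| <= K * `|s|.
Proof.
by move=> ur sr; rewrite /wave_curve; case: ifP => _; [exact: hc_close|have [] := ic_close ur sr].
Qed.

Lemma ic_taylor (u : X) (s : R) : `|u - x0| < curve_radius -> `|s| < curve_radius ->
  `|ic u s - u - s *: rk u| <= K * K * `|s| ^+ 2.
Proof.
move=> ur sr; have := solution_taylor rk_lip K0 K0 (x := ic u) (t := s).
rewrite ic0 ?in_state_ball //; apply => t /(between_time sr) tr.
have [] := ic_close ur tr; split => //; exact: ic_ode (in_state_ball ur) (in_time_ball tr).
Qed.

Lemma bb_taylor (u : X) (s : R) : `|u - x0| < curve_radius -> `|s| < curve_radius ->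
  `|bb u s - (u, 0) - s *: vf (u, 0)| <= K * K * `|s| ^+ 2.
Proof.
move=> ur sr; have := solution_taylor vf_lip K0 K0 (x := bb u) (t := s).
rewrite bb0 ?in_state_ball //; apply => t /(between_time sr) tr.
have [] := bb_close ur tr; split => //; exact: bb_ode (in_state_ball ur) (in_time_ball tr).
Qed.

Lemma hc_taylor (u : X) (s : R) : `|u - x0| < curve_radius -> `|s| < curve_radius ->
  `|hc u s - u - s *: hd (u, 0)| <= K * `|s| ^+ 2.
Proof.
move=> ur sr; rewrite -{2}(hc0 (in_state_ball ur)).
apply: (taylor1_bound (g' := fun t => hd (u, t))) => // t /(between_time sr) /in_time_ball tr.
  exact: hc_deriv (in_state_ball ur) tr.
have := @hd_lip u u t 0 (in_state_ball ur) (in_state_ball ur) tr.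
by rewrite normr0 subrr normr0 add0r subr0; apply.
Qed.

Fact close_time (s : R) : `|s| < curve_radius -> 2 * K * `|s| <= 1.
Proof. by move=> sr; have := ler_wpM2l K0 (ltW sr); have := rho1; have := curve_radiusK; lra. Qed.

(** Both sides solve the same equation with the same initial state, so [solutions_close] bounds
    their distance by 0. *)
Lemma ic_add (u : X) (a s : R) : `|u - x0| < curve_radius -> `|ic u a - x0| < curve_radius ->
  `|a| < curve_radius / 2 -> `|s| < curve_radius / 2 -> ic (ic u a) s = ic u (a + s).
Proof.
move=> ur vr ar sr; apply/eqP; rewrite -subr_eq0 -normr_le0.
have sr1 : `|s| < curve_radius by have := curve_radius_gt0; lra.
have := @solutions_close _ _ rk x0 rho K rk_lip K0 (ic (ic u a)) (fun t => ic u (a + t)) s.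
rewrite ic0 ?in_state_ball // addr0 subrr normr0 mulr0; apply; last exact: close_time.
move=> t bt; have tr := between0_norm bt.
have tr1 : `|t| < curve_radius by apply: le_lt_trans tr _.
have atr : `|a + t| < curve_radius by apply: (le_lt_trans (ler_normD _ _)); lra.
have [? _] := ic_close vr tr1; have [? _] := ic_close ur atr; split => //.
  exact: ic_ode (in_state_ball vr) (in_time_ball tr1).
have /is_deriveP_eps H := ic_ode (in_state_ball ur) (in_time_ball atr).
apply/is_deriveP_eps => e e0; have [r r0 Hr] := H e e0; exists r => // w /Hr.
by rewrite addrCA.
Qed.

(** After time [s] the orbit [bb u] has in general a nonzero z_c and cannot be restarted as some
    [bb v]. Lipschitz dependence on the initial point replaces the semigroup identity. *)
Lemma bb_shift_close (u v : X) (s t : R) : `|u - x0| < curve_radius -> `|v - x0| < curve_radius ->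
  `|s| < curve_radius / 2 -> `|t| < curve_radius / 2 ->
    `|bb v t - bb u (s + t)| <= 2 * `|(v, 0) - bb u s|.
Proof.
move=> ur vr ar sr.
have sr1 : `|t| < curve_radius by have := curve_radius_gt0; lra.
have := @solutions_close _ _ vf (x0, 0) rho K vf_lip K0 (bb v) (fun t => bb u (s + t)) t.
rewrite bb0 ?in_state_ball // addr0; apply; last exact: close_time.
move=> w bw; have wr := between0_norm bw.
have wr1 : `|w| < curve_radius by apply: le_lt_trans wr _.
have swr : `|s + w| < curve_radius by apply: (le_lt_trans (ler_normD _ _)); lra.
have [? _] := bb_close vr wr1; have [? _] := bb_close ur swr; split => //.
  exact: bb_ode (in_state_ball vr) (in_time_ball wr1).
have /is_deriveP_eps H := bb_ode (in_state_ball ur) (in_time_ball swr).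
apply/is_deriveP_eps => e e0; have [r r0 Hr] := H e e0; exists r => // p /Hr.
by rewrite addrCA.
Qed.

(** * Order of contact of the Hugoniot and integral curves with the layer curve *)

Lemma su_gt0 (u : X) : `|u - x0| < rho -> `|su u| < rho -> lam u < 0 -> 0 < su u.
Proof.
move=> ur sur lu; rewrite ltNge; apply/negP => s0.
have := @sg_slope u (su u) 0 ur sur; rewrite normr0 => /(_ rho0 s0).
have [_ ->] := suP ur; rewrite sg0 //.
have : 0 <= c * (0 - su u) by rewrite mulr_ge0 ?(ltW c0) //; lra.
lra.
Qed.

(* The difference vanishes at [0] and at [su u], by the normalization of the
   Hugoniot curve. *)
Lemma hc_bb_close (u : X) (s : R) :
  `|u - x0| < curve_radius -> `|su u| < curve_radius -> `|s| < curve_radius -> lam u < 0 ->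
  `|(hd (u, 0), 0) - vf (u, 0)| <= (K + K * K) * `|su u| /\
  `|(hc u s, 0) - bb u s| <= 4 * (K + K * K) * `|s| * `|s - su u|.
Proof.
move=> ur sur sr lu; have su0 := su_gt0 (in_state_ball ur) (in_time_ball sur) lu.
pose g t := (hc u t, 0 : R) - bb u t.
pose g' t := (hd (u, t), 0 : R) - vf (bb u t).
(* [K + K * K] is a Lipschitz constant of [g']: [K] comes from [hd], and [K * K] from [vf] along
   [bb], whose speed is at most [K]. *)
have := @two_zeros_bound _ _ g g' curve_radius (su u) s (K + K * K).
rewrite /g /g' bb0 ?in_state_ball // hc0 ?in_state_ball // subrr.
rewrite su_contact ?in_state_ball ?(ltW lu) ?(ltW su0) // subrr; apply => //; last first.
- by rewrite gt_eqF.
- by rewrite addr_ge0 // mulr_ge0.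
- move=> t w tr wr.
  have [bt _] := bb_close ur tr; have [bw _] := bb_close ur wr.
  have H1 := @hd_lip u u t w (in_state_ball ur) (in_state_ball ur) (in_time_ball tr) (in_time_ball
    wr).
  have H2 := vf_lip bt bw.
  have H3 : `|bb u t - bb u w| <= K * `|t - w|.
    apply: (mean_value_ineq (g' := fun v => vf (bb u v))) => v /between_norm vr.
      have {}vr : `|v| < curve_radius by apply: (le_lt_trans vr); rewrite gt_max wr.
      exact: bb_ode (in_state_ball ur) (in_time_ball vr).
    have {}vr : `|v| < curve_radius by apply: (le_lt_trans vr); rewrite gt_max wr.
    by apply: vf_bound; have [] := bb_close ur vr.
  have -> : (hd (u, t), 0) - vf (bb u t) - ((hd (u, w), 0) - vf (bb u w)) =
      (hd (u, t) - hd (u, w), 0) - (vf (bb u t) - vf (bb u w)) :> X * R.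
    by rewrite -pair0B !opprD !opprK !addrA [X in X + _ = _]addrAC.
  apply: (le_trans (ler_normB _ _)); rewrite norm_pair0 mulrDl lerD //.
    by move: H1; rewrite subrr normr0 add0r.
  by apply: (le_trans H2); rewrite -mulrA ler_wpM2l.
- move=> t tr.
  have hd' := hc_deriv (in_state_ball ur) (in_time_ball tr);
    have bd' := bb_ode (in_state_ball ur) (in_time_ball tr).
  apply: is_deriveB; apply/is_deriveP_eps => e e0.
  have [r r0 Hr] := (is_deriveP_eps _ _ _ _).1 hd' e e0; exists r => // w /Hr.
  suff -> : (hc u (w *: 1 + t), 0) - (hc u t, 0) - w *: (hd (u, t), 0) =
      (hc u (w *: 1 + t) - hc u t - w *: hd (u, t), 0) :> X * R by rewrite norm_pair0.
  by apply: injective_projections; rewrite //= scaler0 !subrr.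
Qed.

Fact state_radius_le : state_radius <= curve_radius / 20.
Proof. by have := state_radiusXK (n := 0) isT; rewrite expr0 mul1r. Qed.

Lemma critical_small (u : X) : `|u - x0| < state_radius ->
  [/\ `|u - x0| < curve_radius / 20, `|lam u| <= K * state_radius, `|su u| <= curve_radius / 20 &
    `|sb u| <= curve_radius / 20].
Proof.
move=> ur; have ur1 : `|u - x0| < curve_radius / 20 by apply: lt_le_trans state_radius_le.
have ur' : `|u - x0| < rho by apply: in_state_ball; have := curve_radius_gt0; lra.
have lu : `|lam u| <= K * state_radius.
  have := @lam_lip u x0 ur'; rewrite subrr normr0 lam0 subr0 => /(_ rho0) h.
  by apply: (le_trans h); rewrite ler_wpM2l // ltW.
have Klu : K * `|lam u| <= curve_radius / 20.
  apply: (le_trans _ (state_radiusXK (n := 2) isT)).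
  by rewrite expr2 -mulrA ler_wpM2l.
have [su1 _] := suP ur'; have [sb1 _] := sbP ur'.
by split => //; [apply: le_trans su1 _|apply: le_trans sb1 _].
Qed.

Fact in_curve_radius (u : X) : `|u - x0| < state_radius -> `|u - x0| < curve_radius.
Proof. by move=> /critical_small[h _ _ _]; apply: (lt_trans h); have := curve_radius_gt0; lra. Qed.

(* The curve through [u] of slope [hd (u, 0)] and the layer curve agree up to
   O(|lambda_k|) to first order.  When lambda_k < 0 they have the common zeros
   [0] and [su u]; the general case follows by moving [u] along [ic] to a state
   with lambda_k < 0. *)
Lemma contact_order :
  exists2 C : R, 0 <= C & forall u, `|u - x0| < state_radius ->
    `|(hd (u, 0), 0) - vf (u, 0)| <= C * `|lam u|.
Proof.
pose M := K + K * K.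
have M0 : 0 <= M by rewrite addr_ge0 // mulr_ge0.
(* The first term is the bound at the displaced state [w], where |lambda_k| is at most
   [(1 + K ^+ 3) * |lam u|] up to a multiple of [e]; the second is the variation of [hd] and [vf]
   between [u] and [w]. *)
pose C := M * K * (1 + K ^+ 3) + 2 * K ^+ 3.
have C0 : 0 <= C by rewrite addr_ge0 // !mulr_ge0 ?exprn_ge0 // addr_ge0 ?exprn_ge0.
exists C => // u ur; have [ur20 lu sur sbr] := critical_small ur.
have ur1 := in_curve_radius ur.
(* Going [e] beyond the zero of lambda_k on the integral curve makes lambda_k(w) strictly negative;
   [e] is sent to 0 at the end. *)
have key e : 0 < e -> e <= state_radius -> `|(hd (u, 0), 0) - vf (u, 0)| <= C * (`|lam u| + e).
  move=> e0 er; have [sbl sb0] := sbP (in_state_ball ur1).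
  pose s := sb u - e; pose w := ic u s.
  have sl : `|s| <= K * `|lam u| + e.
    by apply: (le_trans (ler_normB _ _)); rewrite (gtr0_norm e0) lerD2r.
  have sr : `|s| < curve_radius.
    apply: (le_lt_trans (ler_normB _ _)); rewrite (gtr0_norm e0).
    by have := state_radius_le; have := curve_radius_gt0; lra.
  have [wr wu] := ic_close ur1 sr; rewrite -/w in wr wu.
  have wu' : `|w - u| <= K * (K * `|lam u| + e).
    by apply: (le_trans wu); rewrite ler_wpM2l.
  have K2 : K * (K * `|lam u| + e) <= curve_radius / 10.
    have h1 : K * (K * `|lam u|) <= K * (K * (K * state_radius)) by rewrite !ler_wpM2l.
    have h2 : K * e <= K * state_radius by rewrite ler_wpM2l.
    have := state_radiusXK (n := 3) isT; have := state_radiusXK (n := 1) isT.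
    rewrite !exprS expr0 !mulr1 -!mulrA; lra.
  have wr1 : `|w - x0| < curve_radius.
    by rewrite -(subrKA u); apply: (le_lt_trans (ler_normD _ _)); have := curve_radius_gt0; lra.
  have lw : lam w < 0.
    have := @lam_slope u s (sb u) (in_state_ball ur1) (in_time_ball sr) _ _.
    rewrite sb0 -/w => /(_ _ _)h.
    have : c * (sb u - s) <= 0 - lam w.
      apply: h; first by apply: in_time_ball; have := curve_radius_gt0; lra.
      by rewrite /s; lra.
    have -> : sb u - s = e by rewrite /s; ring.
    have : 0 < c * e by rewrite mulr_gt0.
    lra.
  have lwl : `|lam w| <= `|lam u| + K * (K * (K * `|lam u| + e)).
    have := lam_lip wr (in_state_ball ur1) => h.
    have h2 : K * `|w - u| <= K * (K * (K * `|lam u| + e)) by rewrite ler_wpM2l.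
    have := ler_normD (lam w - lam u) (lam u); rewrite subrK; lra.
  have [suw _] := suP wr.
  have swr : `|su w| < curve_radius.
    apply: (le_lt_trans suw).
    have h1 : K * (`|lam u| + K * (K * (K * `|lam u| + e))) <=
              K * (K * state_radius + K * (K * (K * (K * state_radius) + state_radius))).
      by rewrite ler_wpM2l // lerD // !ler_wpM2l // lerD // ler_wpM2l.
    have h2 : K * `|lam w| <= K * (`|lam u| + K * (K * (K * `|lam u| + e))).
      by rewrite ler_wpM2l.
    have := state_radiusXK (n := 2) isT; have := state_radiusXK (n := 5) isT;
      have := state_radiusXK (n := 3) isT.
    have := curve_radius_gt0; lra.
  have r00 : `|0 : R| < curve_radius by rewrite normr0.
  have [gw _] := hc_bb_close wr1 swr r00 lw.
  have h3 := @hd_lip u w 0 0 (in_state_ball ur1) wr (in_time_ball r00) (in_time_ball r00).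
  have h4 : `|vf (u, 0) - vf (w, 0)| <= K * `|u - w|.
    have := @vf_lip (u, 0) (w, 0); rewrite !pair0B !norm_pair0; apply => //.
    exact: in_state_ball.
  have -> : (hd (u, 0), 0) - vf (u, 0) = ((hd (w, 0), 0) - vf (w, 0)) +
      ((hd (u, 0) - hd (w, 0), 0) - (vf (u, 0) - vf (w, 0))) :> X * R.
    rewrite -pair0B; set a := (hd (u, 0), 0); set b := vf (w, 0); set a' := (hd (w, 0), 0).
    by rewrite [RHS]addrACA [a' + _]addrC subrK opprB addKr.
  apply: (le_trans (ler_normD _ _)).
  have := ler_normB (hd (u, 0) - hd (w, 0), 0 : R) (vf (u, 0) - vf (w, 0)).
  rewrite norm_pair0 => h5.
  rewrite subrr normr0 addr0 in h3.
  have h6 : `|(hd (w, 0), 0) - vf (w, 0)| <= M * (K * (`|lam u| + K * (K * (K * `|lam u| + e)))).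
    apply: (le_trans gw); rewrite ler_wpM2l // (le_trans suw) //.
    by rewrite ler_wpM2l.
  have h7 : K * `|u - w| <= K * (K * (K * `|lam u| + e)) by rewrite distrC ler_wpM2l.
  suff : M * (K * (`|lam u| + K * (K * (K * `|lam u| + e)))) +
     2 * (K * (K * (K * `|lam u| + e))) <= C * (`|lam u| + e) by lra.
  rewrite -subr_ge0.
  have -> : C * (`|lam u| + e) - (M * (K * (`|lam u| + K * (K * (K * `|lam u| + e)))) +
     2 * (K * (K * (K * `|lam u| + e)))) =
     (M * K + M * K ^+ 3 * (K - 1) + 2 * K ^+ 2 * (K - 1)) * e by rewrite /C; ring.
  have K10 : 0 <= K - 1 by rewrite subr_ge0.
  by rewrite mulr_ge0 ?(ltW e0) // !addr_ge0 // !mulr_ge0 ?exprn_ge0.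
apply/ler_addgt0Pr => e e0.
pose e' := Num.min state_radius (e / (C + 1)).
have C1 : 0 < C + 1 by rewrite ltr_wpDl.
have e'0 : 0 < e' by rewrite lt_min state_radius_gt0 divr_gt0.
have := key e' e'0; rewrite ge_min lexx => /(_ isT) h.
apply: (le_trans h); rewrite mulrDr lerD2l.
have : e' <= e / (C + 1) by rewrite ge_min lexx orbT.
rewrite ler_pdivlMr // => he; nra.
Qed.

(** The two fields agree at [ic u (sb u)], where lambda_k vanishes; this state is at distance at
    most [K ^+ 2 * |lam u|] from [u], and both fields are Lipschitz. *)
Lemma eigenvector_order (u : X) : `|u - x0| < state_radius ->
  `|rk u - (vf (u, 0)).1| <= 2 * K ^+ 3 * `|lam u|.
Proof.
move=> ur; have [ur20 lu sur sbr] := critical_small ur; have ur1 := in_curve_radius ur.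
have [sbl sb0] := sbP (in_state_ball ur1).
have sr : `|sb u| < curve_radius by have := curve_radius_gt0; lra.
have [wr wu] := ic_close ur1 sr; set w := ic u (sb u) in wr wu sb0.
have wu' : `|w - u| <= K * (K * `|lam u|) by apply: (le_trans wu); rewrite ler_wpM2l.
have E := rk_vf wr sb0.
have h1 := rk_lip (in_state_ball ur1) wr.
have h2 : `|(vf (w, 0)).1 - (vf (u, 0)).1| <= K * `|w - u|.
  have := @vf_lip (w, 0) (u, 0); rewrite !pair0B !norm_pair0 => /(_ wr (in_state_ball ur1)).
  by apply: le_trans; exact: pair_fst_le (vf (w, 0) - vf (u, 0)).
have -> : rk u - (vf (u, 0)).1 = (rk u - rk w) + ((vf (w, 0)).1 - (vf (u, 0)).1).
  by rewrite E subrKA.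
apply: (le_trans (ler_normD _ _)); rewrite [`|u - w|]distrC in h1.
have h3 : K * `|w - u| <= K * (K * (K * `|lam u|)) by rewrite ler_wpM2l.
have -> : 2 * K ^+ 3 * `|lam u| = 2 * (K * (K * (K * `|lam u|))) by ring.
lra.
Qed.

Fact norm_scale (s : R) (p : X * R) : `|s *: p| = `|s| * `|p|.
Proof. exact: normrZ. Qed.

(** The second order remainders add up, and the gap [B] between the initial velocities acts during
    the time [s]. *)
Fact compare_to_bb (y d : X) (u : X) (s A B : R) :
  `|u - x0| < curve_radius -> `|s| < curve_radius ->
  `|y - u - s *: d| <= A * `|s| ^+ 2 -> `|(d, 0) - vf (u, 0)| <= B ->
  `|(y, 0) - bb u s| <= (A + K * K) * `|s| ^+ 2 + `|s| * B.
Proof.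
move=> ur sr ys dB; have H := bb_taylor ur sr.
have -> : (y, 0) - bb u s = (y - u - s *: d, 0) - (bb u s - (u, 0) - s *: vf (u, 0))
    + s *: ((d, 0) - vf (u, 0)) :> X * R.
  have -> : (y - u - s *: d, 0) = (y, 0) - (u, 0) - s *: (d, 0) :> X * R.
    by apply: injective_projections; rewrite //= scaler0 !subr0.
  rewrite scalerBr [X in _ = _ - X + _](_ : _ = bb u s - ((u, 0) + s *: vf (u, 0))); last first.
    by rewrite opprD addrA.
  rewrite opprB -[(y, 0) - _ - _]addrA -opprD.
  set p := (u, 0); set q := s *: (d, 0); set w := s *: vf _.
  rewrite [p + w - _]addrC [(y, 0) - _ + _]addrACA opprD [- p - q + _]addrACA addNr add0r.
  by rewrite -[RHS]addrA [- q + w + _]addrACA addNr subrr !addr0.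
apply: (le_trans (ler_normD _ _)); rewrite norm_scale lerD ?ler_wpM2l //.
by apply: (le_trans (ler_normB _ _)); rewrite norm_pair0 mulrDl lerD.
Qed.

(** Weaker than [hc_bb_close], but valid whatever the sign of lambda_k(u), in particular where no
    contact between the two curves is prescribed. *)
Lemma hc_bb_order : exists2 C : R, 0 <= C & forall u s, `|u - x0| < state_radius ->
  `|s| < curve_radius ->
  `|(hc u s, 0) - bb u s| <= C * `|s| * (`|lam u| + `|s|).
Proof.
have [C C0 HC] := contact_order.
exists (K + K * K + C); first by rewrite !addr_ge0 // mulr_ge0.
move=> u s ur sr; have ur1 := in_curve_radius ur.
apply: (le_trans (compare_to_bb ur1 sr (hc_taylor ur1 sr) (HC _ ur))).
have := normr_ge0 s; have := normr_ge0 (lam u).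
set a := `|s|; set b := `|lam u| => b0 a0.
rewrite -subr_ge0.
have -> : (K + K * K + C) * a * (b + a) - ((K + K * K) * a ^+ 2 + a * (C * b)) =
  (K + K * K) * a * b + C * a ^+ 2 by ring.
by rewrite addr_ge0 // !mulr_ge0 ?addr_ge0 ?mulr_ge0 ?exprn_ge0.
Qed.

Lemma ic_bb_order : exists2 C : R, 0 <= C & forall u s, `|u - x0| < state_radius ->
  `|s| < curve_radius ->
  `|(ic u s, 0) - bb u s| <= C * `|s| * (`|lam u| + `|s|).
Proof.
have [C C0 HC] := contact_order.
have E0 : 0 <= C + 2 * K ^+ 3 by rewrite addr_ge0 // mulr_ge0 // exprn_ge0.
exists (K * K + K * K + (C + 2 * K ^+ 3)); first by rewrite addr_ge0 // addr_ge0 // mulr_ge0.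
move=> u s ur sr; have ur1 := in_curve_radius ur.
have rv : `|(rk u, 0) - vf (u, 0)| <= (C + 2 * K ^+ 3) * `|lam u|.
  have h1 := eigenvector_order ur; have h2 := HC u ur.
  (* The second component of this difference is minus theta_c(u, 0): the estimate obtained from
     Hugoniot curves thus also bounds theta_c by |lambda_k|, as needed for integral curves. *)
  have := pair_snd_le ((hd (u, 0), 0) - vf (u, 0)); rewrite /= => h3.
  rewrite mulrDl; have l0 := normr_ge0 (lam u).
  have p1 : 0 <= C * `|lam u| by rewrite mulr_ge0.
  have p2 : 0 <= 2 * K ^+ 3 * `|lam u| by rewrite !mulr_ge0 ?exprn_ge0.
  by apply: pair_norm_le => /=; lra.
apply: (le_trans (compare_to_bb ur1 sr (ic_taylor ur1 sr) rv)).
have := normr_ge0 s; have := normr_ge0 (lam u).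
set a := `|s|; set b := `|lam u| => b0 a0.
set E := C + 2 * K ^+ 3 in E0 *.
rewrite -subr_ge0.
have -> : (K * K + K * K + E) * a * (b + a) - ((K * K + K * K) * a ^+ 2 + a * (E * b)) =
  (K * K + K * K) * a * b + E * a ^+ 2 by ring.
by rewrite addr_ge0 // !mulr_ge0 ?addr_ge0 ?mulr_ge0 ?exprn_ge0.
Qed.

(** Transversality: [sg] is Lipschitz in the state and has slope at least [c] in the parameter. *)
Lemma su_lip (u v : X) : `|u - x0| < state_radius -> `|v - x0| < state_radius ->
  c * `|su u - su v| <= K * `|u - v|.
Proof.
move=> ur vr; have [_ _ sur _] := critical_small ur; have [_ _ svr _] := critical_small vr.
have ur' := in_state_ball (in_curve_radius ur); have vr' := in_state_ball (in_curve_radius vr).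
have sur1 : `|su u| < rho by apply: in_time_ball; have := curve_radius_gt0; lra.
have svr1 : `|su v| < rho by apply: in_time_ball; have := curve_radius_gt0; lra.
have [_ su0] := suP ur'; have [_ sv0] := suP vr'.
have := sg_lip ur' vr' svr1; rewrite sv0 subr0 => h; apply: le_trans h.
have [uv|/ltW vu] := leP (su u) (su v).
  have := sg_slope ur' sur1 svr1 uv; rewrite su0 subr0 => h.
  rewrite distrC (ger0_norm (x := su v - su u)) ?subr_ge0 //.
  exact: le_trans h (ler_norm _).
have := sg_slope ur' svr1 sur1 vu; rewrite su0 sub0r => h.
rewrite (ger0_norm (x := su u - su v)) ?subr_ge0 //.
by apply: (le_trans h); rewrite -normrN ler_norm.
Qed.

(** * The layer branch of the characteristic curve *)

Lemma wave_curve0 (u : X) : `|u - x0| < rho -> wave_curve u 0 = u.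
Proof. by move=> ur; rewrite /wave_curve lexx hc0. Qed.

(** The branches fit together at the borderline cases: at [s = su u] by the contact condition, and
    at lambda_k(u) = 0 because [su u] and [sb u] both vanish. *)
Lemma char_curve_left (u : X) (s : R) : `|u - x0| < state_radius -> lam u <= 0 -> s <= su u ->
  char_curve u s = bb u s.
Proof.
move=> ur lu ssu; have ur' := in_state_ball (in_curve_radius ur).
have [_ _ sur _] := critical_small ur.
have sur1 : `|su u| < rho by apply: in_time_ball; have := curve_radius_gt0; lra.
rewrite /char_curve; case: ltP => lu'.
  have su0 := su_gt0 ur' sur1 lu'.
  case: ltP => // sus; have -> : s = su u by apply/eqP; rewrite eq_le ssu.
  by rewrite /wave_curve (ltW su0) su_contact // ltW.
have l0 : lam u = 0 by apply/eqP; rewrite eq_le lu.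
have [] := suP ur'; rewrite l0 normr0 mulr0 normr_le0 => /eqP su0 _.
have [] := sbP ur'; rewrite l0 normr0 mulr0 normr_le0 => /eqP sb0 _.
rewrite su0 in ssu; rewrite sb0 subr0 wave_curve0 //; case: ltP => // s0.
have -> : s = 0 by apply/eqP; rewrite eq_le ssu.
by rewrite wave_curve0 // bb0.
Qed.

(* When [t + x] passes the contact point [su u], both |t| and |x| control the
   overshoot [t + x - su u]. *)
Lemma char_curve_bb_close : exists2 C : R, 0 <= C & forall u v t x,
  `|u - x0| < state_radius -> `|v - x0| < state_radius -> `|t| < curve_radius / 4 ->
    `|x| < curve_radius / 4 -> lam u < 0 ->
  t <= su u -> x <= su v -> `|v - u| <= K * `|t| ->
  `|char_curve u (x + t) - bb v x| <= C * (`|(v, 0) - bb u t| + `|t| * `|x|).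
Proof.
pose M := K + K * K; have M0 : 0 <= M by rewrite addr_ge0 // mulr_ge0.
pose q := K * K / c + 1; have q0 : 0 <= q by rewrite addr_ge0 // divr_ge0 ?mulr_ge0 // ltW.
exists (2 + 4 * M * (q + 1)); first by rewrite addr_ge0 // !mulr_ge0 // addr_ge0.
move=> u v t x ur vr tr xr lu tsu xsv vu.
have ur1 := in_curve_radius ur; have vr1 := in_curve_radius vr.
have [_ _ sur _] := critical_small ur.
have r1p := curve_radius_gt0.
have sur1 : `|su u| < curve_radius by lra.
have su0 := su_gt0 (in_state_ball ur1) (in_time_ball sur1) lu.
have bclose : `|bb v x - bb u (x + t)| <= 2 * `|(v, 0) - bb u t|.
  by rewrite [x + t]addrC; apply: bb_shift_close => //; lra.
have n1 := normr_ge0 ((v, 0) - bb u t).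
have tx0 : 0 <= `|t| * `|x| by rewrite mulr_ge0.
rewrite /char_curve lu; case: ltP => [_|ssu].
  apply: (@le_trans _ _ (2 * `|(v, 0) - bb u t|)); first by rewrite distrC.
  have p2 : 0 <= 4 * M * (q + 1) by rewrite !mulr_ge0 // addr_ge0.
  have p3 := mulr_ge0 p2 (addr_ge0 n1 tx0).
  rewrite [X in _ <= X]mulrDl [X in _ <= X + _]mulrDr; lra.
have sx0 : 0 <= x + t by lra.
rewrite /wave_curve sx0.
have xtr : `|x + t| < curve_radius by apply: (le_lt_trans (ler_normD _ _)); lra.
have [_ h1] := hc_bb_close ur1 sur1 xtr lu.
have x0' : 0 <= x by lra.
have ov0 : 0 <= x + t - su u by lra.
have ovx : x + t - su u <= `|x| by rewrite (ger0_norm x0'); lra.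
(* [su v - su u] is at most [K * K / c * |t|] by [su_lip], and [t] itself accounts for the added 1
   in [q]. *)
have ovt : x + t - su u <= q * `|t|.
  have h := su_lip vr ur.
  have h2 : c * `|su v - su u| <= K * (K * `|t|).
    by apply: (le_trans h); rewrite ler_wpM2l.
  have h3 : `|su v - su u| <= K * K / c * `|t|.
    by rewrite -(ler_pM2l c0) (le_trans h2) // mulrA; rewrite le_eqVlt; apply/orP; left;
       apply/eqP; field; rewrite gt_eqF.
  have := ler_norm (su v - su u); have := ler_norm t; rewrite /q mulrDl mul1r; lra.
(* Against the summand [|x|] the overshoot is bounded by [q * |t|], against [|t|] it is bounded by
   [|x|]; both choices produce the product of [|t|] and [|x|]. *)
have h4 : `|x + t| * `|x + t - su u| <= (q + 1) * (`|t| * `|x|).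
  have h5 : `|x + t| <= `|x| + `|t| by exact: ler_normD.
  rewrite (ger0_norm ov0).
  apply: (@le_trans _ _ ((`|x| + `|t|) * (x + t - su u))); first by rewrite ler_wpM2r.
  rewrite mulrDl [X in _ <= X]mulrDl mul1r; apply: lerD; last by rewrite ler_wpM2l.
  by rewrite [`|t| * _]mulrC mulrCA ler_wpM2l.
have h6 : `|(hc u (x + t), 0) - bb u (x + t)| <= 4 * M * ((q + 1) * (`|t| * `|x|)).
  by apply: (le_trans h1); rewrite -mulrA ler_wpM2l // mulr_ge0.
have -> : (hc u (x + t), 0) - bb v x =
   ((hc u (x + t), 0) - bb u (x + t)) - (bb v x - bb u (x + t)).
  by rewrite opprB subrKA.
apply: (le_trans (ler_normB _ _)).
have p1 : 0 <= 4 * M * (q + 1) * `|(v, 0) - bb u t| by rewrite !mulr_ge0 // addr_ge0.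
move: h6 bclose p1 n1 tx0; set A := `|_|; set B := `|_|; set D := `|_ - bb u t|.
set E := `|t| * `|x|; clearbody M q A B D E => h6 bclose p1 n1 tx0; lra.
Qed.

(** A third scale, at which the state [ic u (sb u)] with lambda_k = 0 stays within [state_radius]:
    its distance to [u] is at most [K ^+ 3 * |u - x0|]. *)
Definition wave_radius := state_radius / (20 * K ^+ 3).

Let wave_radius_gt0 : 0 < wave_radius. Proof. by rewrite divr_gt0 // mulr_gt0 // exprn_gt0. Qed.

Fact wave_radiusK : K ^+ 3 * wave_radius = state_radius / 20.
Proof. by rewrite /wave_radius; field; rewrite gt_eqF. Qed.

Fact wave_radius_le : wave_radius <= state_radius / 20.
Proof. by rewrite -wave_radiusK ler_peMl ?(ltW wave_radius_gt0) // exprn_ege1. Qed.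

Lemma sb_small (u : X) : `|u - x0| < wave_radius ->
  `|sb u| <= K * K * `|u - x0| /\ K * `|sb u| < state_radius / 20.
Proof.
move=> ur; have ur2 : `|u - x0| < state_radius by have := wave_radius_le;
  have := state_radius_gt0; lra.
have ur' := in_state_ball (in_curve_radius ur2); have [h _] := sbP ur'.
have := @lam_lip u x0 ur'; rewrite subrr normr0 lam0 subr0 => /(_ rho0) h2.
have h3 : K * `|lam u| <= K * (K * `|u - x0|) by rewrite ler_wpM2l.
have h4 : `|sb u| <= K * K * `|u - x0| by rewrite -mulrA; apply: le_trans h _.
split => //; rewrite -wave_radiusK; apply: (@le_lt_trans _ _ (K * (K * K * `|u - x0|))).
  by rewrite ler_wpM2l.
have -> : K * (K * K * `|u - x0|) = K ^+ 3 * `|u - x0| by ring.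
by rewrite ltr_pM2l // exprn_gt0.
Qed.

Tactic Notation "lra_from" ne_hyp_list(hs) :=
  clear - hs x0 rho K c lam rk vf ic hc hd bb sg su sb rho0 rho1 K1 c0 lam0 lam_lip rk_lip
    rk_bound vf_lip vf_bound ic0 ic_ode bb0 bb_ode hc0 hc_deriv hd_lip hd_bound sg0 sg_lip
    sg_slope lam_slope suP sbP su_contact rk_vf K0 K0' curve_radius_gt0 state_radius_gt0
      wave_radius_gt0; lra.

Definition wave_speed (u : X) (s : R) : R := if 0 <= s then sg u s else lam (wave_curve u s).

(** * The interaction estimates for shocks and rarefactions *)

Lemma shock_interaction : exists2 C : R, 0 <= C & forall u t x,
  `|u - x0| < wave_radius -> `|wave_curve u t - x0| < wave_radius -> `|t| < wave_radius ->
    `|x| < wave_radius ->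
  0 <= t -> sg u t < 0 ->
  (lam (wave_curve u t) <= 0 -> x <= su (wave_curve u t)) -> (0 < lam (wave_curve u t) -> x = 0) ->
  `|char_curve u (x + t) - char_curve (wave_curve u t) x| <= C * (`|t| * (`|sg u t| + `|x|)).
Proof.
have [C C0 HC] := char_curve_bb_close.
pose M := 4 * (K + K * K); have M0 : 0 <= M by rewrite mulr_ge0 // addr_ge0 // mulr_ge0.
pose D := M / c; have D0 : 0 <= D by rewrite divr_ge0 // ltW.
exists (C * (D + 1) + D) => [|u t x ur]; first by rewrite addr_ge0 // mulr_ge0 // addr_ge0.
set v := wave_curve u t => vr tr xr t0 sgt xsu x0E.
have h3 := wave_radius_le; have h2 := state_radius_le; have h20 := state_radius_gt0;
  have h10 := curve_radius_gt0.
have ur2 : `|u - x0| < state_radius by lra. have vr2 : `|v - x0| < state_radius by lra.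
have ur1 := in_curve_radius ur2; have vr1 := in_curve_radius vr2.
have tr1 : `|t| < curve_radius by lra.
have vu : `|v - u| <= K * `|t| by exact: wave_curve_close.
have vE : v = hc u t by rewrite /v /wave_curve t0.
clearbody v.
have [_ _ sur _] := critical_small ur2.
have sur1 : `|su u| < curve_radius by lra.
have r00 : `|0 : R| < rho by rewrite normr0.
have lu : lam u < 0.
  have := sg_slope (in_state_ball ur1) r00 (in_time_ball tr1) t0; rewrite sg0 ?in_state_ball //.
  have : 0 <= c * (t - 0) by rewrite mulr_ge0 ?(ltW c0) // subr0.
  lra.
have [_ su0] := suP (in_state_ball ur1).
have tsu : t <= su u.
  rewrite leNgt; apply/negP => sut.
  have := sg_slope (in_state_ball ur1) (in_time_ball sur1) (in_time_ball tr1) (ltW sut);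
    rewrite su0.
  have : 0 <= c * (t - su u) by rewrite mulr_ge0 ?(ltW c0) // subr_ge0 ltW.
  lra.
have ov : `|t - su u| <= `|sg u t| / c.
  have := sg_slope (in_state_ball ur1) (in_time_ball tr1) (in_time_ball sur1) tsu; rewrite su0.
  rewrite ler_pdivlMr // distrC ger0_norm ?subr_ge0 // (ltr0_norm sgt); lra.
have [_ close] := hc_bb_close ur1 sur1 tr1 lu.
have close' : `|(v, 0) - bb u t| <= D * (`|t| * `|sg u t|).
  rewrite vE; apply: (le_trans close).
  have -> : D * (`|t| * `|sg u t|) = M * `|t| * (`|sg u t| / c) by rewrite /D; ring.
  by rewrite ler_wpM2l // mulr_ge0.
have p0 : 0 <= `|t| * `|sg u t| by rewrite mulr_ge0.
have p1 : 0 <= `|t| * `|x| by rewrite mulr_ge0.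
(* If lambda_k(v) > 0 then [x = 0], and since [sb v <= 0] the curve from [v] is at (v, 0); the bound
   [close'] on its distance to [bb u t] is then the whole estimate. *)
have [lv|lv] := ltP 0 (lam v).
  have xE := x0E lv; have := @char_curve_left u t ur2 (ltW lu) tsu.
  have -> : char_curve v x = (v, 0).
    rewrite xE /char_curve ltNge (ltW lv) /= wave_curve0 ?in_state_ball //.
    case: ltP => // sb0; exfalso.
    have [sbr _ _ sbl] := critical_small vr2.
    have [_ sbv] := sbP (in_state_ball vr1).
    have := @lam_slope v 0 (sb v) (in_state_ball vr1) r00 _ (ltW sb0).
    rewrite sbv ic0 ?in_state_ball // => h.
    have : c * (sb v - 0) <= 0 - lam v by apply: h; apply: in_time_ball; lra_from sbl h10.
    have : 0 <= c * (sb v - 0) by rewrite mulr_ge0 ?(ltW c0) // subr0 ltW.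
    move=> g1 g2; lra_from g1 g2 lv.
  rewrite xE add0r normr0 addr0 => ->; rewrite distrC (le_trans close') // ler_wpM2r //.
  by rewrite lerDr mulr_ge0 // addr_ge0.
rewrite (char_curve_left vr2 lv (xsu lv)).
have := HC u v t x ur2 vr2 _ _ lu tsu (xsu lv) vu => h.
have {}h : `|char_curve u (x + t) - bb v x| <= C * (`|(v, 0) - bb u t| + `|t| * `|x|).
  by apply: h; lra_from tr xr h3 h2 h20 h10.
have h4 : C * (`|(v, 0) - bb u t| + `|t| * `|x|) <= C * (D * (`|t| * `|sg u t|) + `|t| * `|x|).
  by rewrite ler_wpM2l // lerD2r.
apply: (le_trans h); apply: (le_trans h4).
have q1 := mulr_ge0 C0 p0; have q2 := mulr_ge0 D0 p0.
have q3 := mulr_ge0 (mulr_ge0 C0 D0) p1; have q4 := mulr_ge0 D0 p1.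
rewrite -subr_ge0.
have -> : (C * (D + 1) + D) * (`|t| * (`|sg u t| + `|x|)) -
   C * (D * (`|t| * `|sg u t|) + `|t| * `|x|) =
   C * (`|t| * `|sg u t|) + D * (`|t| * `|sg u t|) + C * D * (`|t| * `|x|) + D * (`|t| * `|x|).
  by ring.
by rewrite !addr_ge0.
Qed.

(** As lambda_k increases along [ic] with slope at least [c] and is still negative at [u], both
    [|lam u|] and [c * |t|] are at most [|lam v|]. The contact error [|t| * (|lam u| + |t|)] thus
    becomes [|t| * |lam v|]. *)
Lemma rarefaction_interaction_neg : exists2 C : R, 0 <= C & forall u t x,
  `|u - x0| < wave_radius -> `|wave_curve u t - x0| < wave_radius -> `|t| < wave_radius ->
    `|x| < wave_radius ->
  t < 0 -> lam u < 0 -> lam (wave_curve u t) < 0 -> x <= su (wave_curve u t) ->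
  `|char_curve u (x + t) - char_curve (wave_curve u t) x| <= C * (`|t| * (`|lam (wave_curve u t)|
    + `|x|)).
Proof.
have [C C0 HC] := char_curve_bb_close; have [B B0 HB] := ic_bb_order.
pose D := B * (1 + 1 / c); have D0 : 0 <= D by rewrite mulr_ge0 // addr_ge0 // divr_ge0 // ltW.
exists (C * (D + 1)) => [|u t x ur]; first by rewrite mulr_ge0 // addr_ge0.
set v := wave_curve u t => vr tr xr t0 lu lv xsu.
have h3 := wave_radius_le; have h2 := state_radius_le; have h20 := state_radius_gt0;
  have h10 := curve_radius_gt0.
have ur2 : `|u - x0| < state_radius by lra. have vr2 : `|v - x0| < state_radius by lra.
have ur1 := in_curve_radius ur2; have vr1 := in_curve_radius vr2.
have tr1 : `|t| < curve_radius by lra.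
have vu : `|v - u| <= K * `|t| by exact: wave_curve_close.
have vE : v = ic u t by rewrite /v /wave_curve leNgt t0.
clearbody v.
have [_ _ sur _] := critical_small ur2.
have sur1 : `|su u| < curve_radius by lra.
have su0 := su_gt0 (in_state_ball ur1) (in_time_ball sur1) lu.
have tsu : t <= su u by lra.
have r00 : `|0 : R| < rho by rewrite normr0.
have gap : `|lam u| + `|t| <= (1 + 1 / c) * `|lam v|.
  have := lam_slope (in_state_ball ur1) (in_time_ball tr1) r00 (ltW t0).
  rewrite ic0 ?in_state_ball // -vE sub0r -(ltr0_norm t0) => h.
  have e1 := ltr0_norm lu; have e2 := ltr0_norm lv.
  have h4 : `|t| <= `|lam v| / c.
    by rewrite ler_pdivlMr // mulrC e2; have := normr_ge0 (lam u); lra.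
  have : 0 <= c * `|t| by rewrite mulr_ge0 // ltW.
  rewrite mulrDl mul1r [1 / c * _]mulrC mulrA mulr1; lra.
have close : `|(v, 0) - bb u t| <= D * (`|t| * `|lam v|).
  rewrite vE; apply: (le_trans (HB _ _ ur2 tr1)); rewrite -vE.
  have -> : D * (`|t| * `|lam v|) = B * `|t| * ((1 + 1 / c) * `|lam v|) by rewrite /D; ring.
  by rewrite ler_wpM2l // mulr_ge0.
rewrite (char_curve_left vr2 (ltW lv) xsu).
have := HC u v t x ur2 vr2 _ _ lu tsu xsu vu => h.
have {}h : `|char_curve u (x + t) - bb v x| <= C * (`|(v, 0) - bb u t| + `|t| * `|x|).
  by apply: h; lra_from tr xr h3 h2 h20 h10.
have h4 : C * (`|(v, 0) - bb u t| + `|t| * `|x|) <= C * (D * (`|t| * `|lam v|) + `|t| * `|x|).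
  by rewrite ler_wpM2l // lerD2r.
apply: (le_trans h); apply: (le_trans h4).
have p0 : 0 <= `|t| * `|lam v| by rewrite mulr_ge0.
have p1 : 0 <= `|t| * `|x| by rewrite mulr_ge0.
rewrite -subr_ge0.
have -> : C * (D + 1) * (`|t| * (`|lam v| + `|x|)) -
   C * (D * (`|t| * `|lam v|) + `|t| * `|x|) =
   C * (`|t| * `|lam v|) + C * D * (`|t| * `|x|) by ring.
by rewrite addr_ge0 // mulr_ge0 // mulr_ge0.
Qed.

(** The rarefaction crosses lambda_k = 0 at [w = ic u (sb u)], and [w] takes over the role of [u],
    with the remaining parameter [a = t - sb u]. The slope of lambda_k gives [|a| <= |lam v| / c];
    since lambda_k(w) = 0, the contact error at [w] is of order [|a| ^+ 2], hence of order
    [|t| * |lam v|]. *)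
Lemma rarefaction_interaction_pos : exists2 C : R, 0 <= C & forall u t x,
  `|u - x0| < wave_radius -> `|wave_curve u t - x0| < wave_radius -> `|t| < wave_radius ->
    `|x| < wave_radius ->
  t < 0 -> 0 <= lam u -> lam (wave_curve u t) < 0 -> x <= su (wave_curve u t) ->
  `|char_curve u (x + t) - char_curve (wave_curve u t) x| <= C * (`|t| * (`|lam (wave_curve u t)|
    + `|x|)).
Proof.
have [B B0 HB] := ic_bb_order; have [B' B'0 HB'] := hc_bb_order.
pose q := K * K / c; have q0 : 0 <= q by rewrite divr_ge0 ?mulr_ge0 // ltW.
pose C := 2 * B / c + B * q + (B + B') * (K * K + q).
have C1 : 0 <= 2 * B / c by rewrite divr_ge0 ?mulr_ge0 // ltW.
have C2 : 0 <= B * q by rewrite mulr_ge0.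
have C3 : 0 <= (B + B') * (K * K + q) by rewrite mulr_ge0 // addr_ge0 // mulr_ge0.
exists C => [|u t x ur]; first by rewrite !addr_ge0.
set v := wave_curve u t => vr tr xr t0 lu lv xsu.
have h3 := wave_radius_le; have h2 := state_radius_le; have h20 := state_radius_gt0;
  have h10 := curve_radius_gt0.
have vE : v = ic u t by rewrite /v /wave_curve leNgt t0.
clearbody v.
have ur2 : `|u - x0| < state_radius by lra_from ur h3 h20.
have vr2 : `|v - x0| < state_radius by lra_from vr h3 h20.
have ur1 := in_curve_radius ur2; have vr1 := in_curve_radius vr2.
have tr1 : `|t| < curve_radius by lra_from tr h3 h2 h20 h10.
have r00 : `|0 : R| < rho by rewrite normr0.
have [_ _ _ sbr] := critical_small ur2.
have sbr1 : `|sb u| < curve_radius by lra_from sbr h10.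
have [_ lw] := sbP (in_state_ball ur1).
set w := ic u (sb u) in lw.
have sb0 : sb u <= 0.
  rewrite leNgt; apply/negP => sb0.
  have := lam_slope (in_state_ball ur1) r00 (in_time_ball sbr1) (ltW sb0).
  rewrite ic0 ?in_state_ball // lw.
  have : 0 < c * (sb u - 0) by rewrite mulr_gt0 // subr0.
  by move=> g1 g2; lra_from g1 g2 lu.
have tsb : t < sb u.
  rewrite ltNge; apply/negP => sbt.
  have := lam_slope (in_state_ball ur1) (in_time_ball sbr1) (in_time_ball tr1) sbt; rewrite -vE lw.
  have : 0 <= c * (t - sb u) by rewrite mulr_ge0 ?(ltW c0) // subr_ge0.
  by move=> g1 g2; lra_from g1 g2 lv.
pose a := t - sb u; have a0 : a < 0 by rewrite /a subr_lt0.
have aE : `|a| = sb u - t by rewrite (ltr0_norm a0) /a; ring.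
have tE : `|t| = - t by exact: ltr0_norm.
have at_ : `|a| <= `|t| by lra_from aE tE sb0.
have alv : `|a| <= `|lam v| / c.
  have := lam_slope (in_state_ball ur1) (in_time_ball tr1) (in_time_ball sbr1) (ltW tsb);
    rewrite -vE lw sub0r.
  by rewrite ler_pdivlMr // (ltr0_norm lv) aE mulrC.
have [_ wu] := ic_close ur1 sbr1; rewrite -/w in wu.
have [_ Ksb] := sb_small ur.
have wr2 : `|w - x0| < state_radius.
  by rewrite -(subrKA u); apply: (le_lt_trans (ler_normD _ _)); lra_from wu Ksb ur h3 h20.
have wr1 := in_curve_radius wr2.
have ar1 : `|a| < curve_radius / 2 by lra_from at_ tr h3 h2 h20 h10.
have ar2 : `|a| < curve_radius by lra_from ar1 h10.
have sbr2 : `|sb u| < curve_radius / 2 by lra_from sbr h10.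
have vw : v = ic w a by rewrite ic_add // /a addrC subrK.
have close : `|(v, 0) - bb w a| <= B / c * (`|t| * `|lam v|).
  rewrite vw; apply: (le_trans (HB _ _ wr2 ar2)).
  rewrite lw normr0 add0r -vw.
  have -> : B / c * (`|t| * `|lam v|) = B * `|t| * (`|lam v| / c) by ring.
  by rewrite ler_pM ?mulr_ge0 // ler_wpM2l.
have shift : `|bb v x - bb w (a + x)| <= 2 * B / c * (`|t| * `|lam v|).
  have h : `|bb v x - bb w (a + x)| <= 2 * `|(v, 0) - bb w a| by apply: bb_shift_close => //;
    lra_from xr h3 h2 h20 h10.
  by apply: (le_trans h); rewrite -[2 * B / c]mulrA -mulrA ler_wpM2l.
have p0 : 0 <= `|t| * `|lam v| by rewrite mulr_ge0.
have p1 : 0 <= `|t| * `|x| by rewrite mulr_ge0.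
have tcw : wave_curve u (sb u) = w.
  rewrite /wave_curve; case: ifP => // sb0'.
  by rewrite /w; have -> : sb u = 0 by [apply/eqP; rewrite eq_le sb0];
    rewrite hc0 ?ic0 ?in_state_ball.
rewrite (char_curve_left vr2 (ltW lv) xsu) /char_curve ltNge lu /=.
have C3' : (2 * B / c) * (`|t| * `|lam v|) <= 2 * B / c * (`|t| * (`|lam v| + `|x|)).
  by rewrite ler_wpM2l // ler_wpM2l // lerDl.
have T0 : 0 <= `|t| * (`|lam v| + `|x|) by rewrite mulr_ge0 // addr_ge0.
(* As long as [x + t] is below [sb u], the curve from [u] is the orbit [bb w] and [shift] suffices.
   Otherwise [a + x] is an overshoot, bounded by both [|x|] and [q * |t|]. *)
case: ltP => [_|sbx].
  rewrite tcw distrC; have -> : x + t - sb u = a + x by rewrite /a; ring.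
  apply: (le_trans shift); apply: (le_trans C3').
  by rewrite ler_wpM2r // /C -addrA lerDl addr_ge0.
have sx0 : 0 <= a + x by rewrite /a; lra_from sbx.
have xpos : 0 <= x by lra_from sx0 a0.
have xE := ger0_norm xpos.
(* Since lambda_k(w) = 0, [su w] vanishes, and [su_lip] bounds [su v] by the distance from [v] to
   [w]. *)
have sux : x <= q * `|a|.
  have h := su_lip vr2 wr2; have [] := suP (in_state_ball wr1).
  rewrite lw normr0 mulr0 normr_le0 => /eqP suw _.
  have [_ vw'] := ic_close wr1 ar2.
  rewrite -vw in vw'; rewrite suw subr0 in h.
  have h4 : c * `|su v| <= K * (K * `|a|) by apply: (le_trans h); rewrite ler_wpM2l.
  have h5 : `|su v| <= q * `|a|.
    rewrite -(ler_pM2l c0) (le_trans h4) // le_eqVlt; apply/orP; left; apply/eqP.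
    by rewrite /q; field; rewrite gt_eqF.
  by have := ler_norm (su v); lra_from xsu h5.
have sx : `|a + x| <= `|x| by rewrite (ger0_norm sx0) xE; lra_from a0.
have sxa : `|a + x| <= q * `|t|.
  have : q * `|a| <= q * `|t| by rewrite ler_wpM2l.
  by rewrite (ger0_norm sx0); lra_from sux a0.
have sxr : `|a + x| < curve_radius by lra_from sx xr h3 h2 h20 h10.
have icE : ic w (a + x) = ic u (x + t).
  have -> : x + t = sb u + (a + x) by rewrite /a; ring.
  by apply: ic_add => //; lra_from sx xr h3 h2 h20 h10.
have pr : `|x + t| < curve_radius by apply: (le_lt_trans (ler_normD _ _));
  lra_from tr xr h3 h2 h20 h10.
have near_ic : `|(ic u (x + t), 0) - bb w (a + x)| <= B * q * (`|t| * `|x|).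
  rewrite -icE; apply: (le_trans (HB _ _ wr2 sxr)); rewrite lw normr0 add0r.
  have -> : B * q * (`|t| * `|x|) = B * (`|x| * (q * `|t|)) by ring.
  by rewrite -mulrA ler_wpM2l // ler_pM.
(* If [x + t >= 0] the wave curve is on its Hugoniot branch. It is compared with the integral curve
   through [bb u]; the contact errors are harmless because lambda_k vanishes at [w], so that
   [|lam u|] is at most [K * K * |t|]. *)
have tc_ic : `|(wave_curve u (x + t), 0 : R) - (ic u (x + t), 0 : R)| <= (B + B') * (K * K + q) *
  (`|t| * `|x|).
  rewrite /wave_curve; case: ifP => [p_ge0|_]; last first.
    by rewrite pair0B subrr norm_pair0 normr0 mulr_ge0.
  have b1 := HB _ _ ur2 pr; have b2 := HB' _ _ ur2 pr.
  have pE := ger0_norm p_ge0.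
  have px : `|x + t| <= `|x| by rewrite pE xE; lra_from t0.
  have pq : `|x + t| <= q * `|t| by rewrite pE; move: sxa; rewrite (ger0_norm sx0) /a => g;
    lra_from g sb0.
  have lul : `|lam u| <= K * K * `|t|.
    have := lam_lip (in_state_ball ur1) (in_state_ball wr1); rewrite lw subr0 distrC => h.
    apply: (le_trans h); rewrite -mulrA ler_wpM2l // (le_trans wu) // ler_wpM2l //.
    by rewrite (ler0_norm sb0) tE; lra_from tsb.
  have s1 : `|x + t| * (`|lam u| + `|x + t|) <= (K * K + q) * (`|t| * `|x|).
    have -> : (K * K + q) * (`|t| * `|x|) = `|x| * (K * K * `|t| + q * `|t|) by ring.
    by rewrite ler_pM ?addr_ge0 // lerD.
  have := ler_normB ((hc u (x + t), 0) - bb u (x + t)) ((ic u (x + t), 0) - bb u (x + t)).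
  rewrite opprB subrKA => h; apply: (le_trans h); apply: (le_trans (lerD b2 b1)).
  have s2 := ler_wpM2l (addr_ge0 B0 B'0) s1.
  clearbody q; lra_from s2.
have -> : (wave_curve u (x + t), 0) - bb v x = ((wave_curve u (x + t), 0) - (ic u (x + t), 0)) +
   (((ic u (x + t), 0) - bb w (a + x)) - (bb v x - bb w (a + x))).
  by rewrite opprB subrKA addrA subrK.
apply: (le_trans (ler_normD _ _)).
apply: (le_trans (lerD (lexx _) (ler_normB _ _))).
have t1 : B * q * (`|t| * `|x|) <= B * q * (`|t| * (`|lam v| + `|x|)).
  by rewrite ler_wpM2l // ler_wpM2l // lerDr.
have t2 : (B + B') * (K * K + q) * (`|t| * `|x|) <=
    (B + B') * (K * K + q) * (`|t| * (`|lam v| + `|x|)).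
  by rewrite ler_wpM2l // ler_wpM2l // lerDr.
have tt := le_trans tc_ic t2; have t3 := le_trans near_ic t1; have t4 := le_trans shift C3'.
by rewrite /C; clearbody q; lra_from tt t3 t4.
Qed.

Lemma char_curve_interaction : exists2 C : R, 0 <= C & exists2 r : R, 0 < r & forall u t x,
  `|u - x0| < r -> `|wave_curve u t - x0| < r -> `|t| < r -> `|x| < r ->
  wave_speed u t < 0 ->
  (lam (wave_curve u t) <= 0 -> x <= su (wave_curve u t)) -> (0 < lam (wave_curve u t) -> x = 0) ->
  `|char_curve u (x + t) - char_curve (wave_curve u t) x| <= C * (`|t| * (`|wave_speed u t| +
    `|x|)).
Proof.
have [C1 C10 H1] := shock_interaction.
have [C2 C20 H2] := rarefaction_interaction_neg.
have [C3 C30 H3] := rarefaction_interaction_pos.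
exists (C1 + C2 + C3); first by rewrite !addr_ge0.
exists wave_radius => // u t x ur vr tr xr; rewrite /wave_speed; set e := `|t| * _.
have weak C : 0 <= C -> C <= C1 + C2 + C3 -> C * e <= (C1 + C2 + C3) * e.
  by move=> _ h; rewrite ler_wpM2r // mulr_ge0 // addr_ge0.
move=> vs xsu xE; have [t0|t0] := leP 0 t.
  rewrite /e t0 in vs weak *; apply: (le_trans (H1 u t x ur vr tr xr t0 vs xsu xE)).
  by apply: weak => //; lra.
rewrite /e leNgt t0 /= in vs weak *.
have xsu' := xsu (ltW vs).
have [lu|lu] := ltP (lam u) 0.
  apply: (le_trans (H2 u t x ur vr tr xr t0 lu vs xsu')); apply: weak => //; lra.
apply: (le_trans (H3 u t x ur vr tr xr t0 lu vs xsu')); apply: weak => //; lra.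
Qed.

(** This coarse bound keeps the curve where the center manifold chart and the parametrization of the
    stable manifold are Lipschitz. *)
Lemma char_curve_near : exists2 C : R, 0 <= C & exists2 r : R, 0 < r & forall u s,
  `|u - x0| < r -> `|s| < r -> `|char_curve u s - (x0, 0)| <= C * (`|u - x0| + `|s|).
Proof.
exists (1 + 2 * K ^+ 3 + K); first by rewrite !addr_ge0 // mulr_ge0 // exprn_ge0.
exists wave_radius => // u s ur sr.
have h3 := wave_radius_le; have h2 := state_radius_le; have h20 := state_radius_gt0;
  have h10 := curve_radius_gt0.
have ur2 : `|u - x0| < state_radius by lra.
have ur1 := in_curve_radius ur2; have sr1 : `|s| < curve_radius by lra.
have n0 := normr_ge0 (u - x0); have s0 := normr_ge0 s.
have K30 : 0 <= K ^+ 3 by rewrite exprn_ge0.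
have k1 : 0 <= K ^+ 3 * `|u - x0| by rewrite mulr_ge0.
have k2 : 0 <= K ^+ 3 * `|s| by rewrite mulr_ge0.
have k3 : 0 <= K * `|u - x0| by rewrite mulr_ge0.
have k4 : 0 <= K * `|s| by rewrite mulr_ge0.
have tcb : `|(wave_curve u s, 0 : R) - (x0, 0 : R)| <= `|u - x0| + K * `|s|.
  rewrite pair0B norm_pair0 -(subrKA u); apply: (le_trans (ler_normD _ _)).
  by rewrite addrC lerD2l wave_curve_close.
rewrite /char_curve; case: ifP => _; case: ifP => _; try lra.
  rewrite -(subrKA (u, 0)); apply: (le_trans (ler_normD _ _)).
  by have [_ h] := bb_close ur1 sr1; rewrite pair0B norm_pair0; lra.
have [sb1 sb2] := sb_small ur.
have [_ _ _ sbr] := critical_small ur2.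
have sbr1 : `|sb u| < curve_radius by lra.
have tb := wave_curve_close ur1 sbr1; set w := wave_curve u (sb u) in tb *.
have wx : `|w - x0| <= `|w - u| + `|u - x0| by rewrite -(subrKA u); exact: ler_normD.
have wr1 : `|w - x0| < curve_radius by lra.
have ssb := ler_normB s (sb u).
have ssr : `|s - sb u| < curve_radius by lra.
have [_ h] := bb_close wr1 ssr.
rewrite -(subrKA (w, 0)); apply: (le_trans (ler_normD _ _)); rewrite pair0B norm_pair0.
have e1 : K * `|s - sb u| <= K * (`|s| + `|sb u|) by rewrite ler_wpM2l.
have e2 : K * `|sb u| <= K * (K * K * `|u - x0|) by rewrite ler_wpM2l.
have e3 : K * (K * K * `|u - x0|) = K ^+ 3 * `|u - x0| by ring.
lra.
Qed.

Lemma char_curve_estimates :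
  (exists2 C : R, 0 <= C & exists2 r : R, 0 < r & forall u t x,
    `|u - x0| < r -> `|wave_curve u t - x0| < r -> `|t| < r -> `|x| < r ->
    wave_speed u t < 0 ->
    (lam (wave_curve u t) <= 0 -> x <= su (wave_curve u t)) -> (0 < lam (wave_curve u t) ->
      x = 0) ->
    `|char_curve u (x + t) - char_curve (wave_curve u t) x| <= C * (`|t| * (`|wave_speed u t| +
      `|x|))) /\
  (exists2 C : R, 0 <= C & exists2 r : R, 0 < r & forall u s,
    `|u - x0| < r -> `|s| < r -> `|char_curve u s - (x0, 0)| <= C * (`|u - x0| + `|s|)).
Proof. by split; [exact: char_curve_interaction|exact: char_curve_near]. Qed.

End CharacteristicCurves.

(** * From local hypotheses to uniform estimates *)

Section Preparation.
Context {R : realType}.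

Lemma is_derive_pair (V W : normedModType R) (f : R -> V) (g : R -> W) (t : R) (a : V) (b : W) :
  is_derive t (1 : R) f a -> is_derive t (1 : R) g b ->
  is_derive t (1 : R) (fun s => (f s, g s)) (a, b).
Proof.
move=> /is_deriveP_eps Hf /is_deriveP_eps Hg; apply/is_deriveP_eps => e e0.
have [r r0 Hr] := Hf e e0; have [r' r'0 Hr'] := Hg e e0.
exists (Num.min r r'); first by rewrite lt_min r0.
move=> s; rewrite lt_min => /andP[sr sr'].
by rewrite prod_normE ge_max /= Hr ?Hr'.
Qed.

Lemma pair_dist_le (V : normedModType R) (u v : V) (s t : R) :
  `|(u, s) - (v, t)| <= `|u - v| + `|s - t|.
Proof. by rewrite prod_normE ge_max /= lerDl lerDr !normr_ge0. Qed.

Lemma pair_ball (V : normedModType R) (u v : V) (s t r : R) :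
  `|u - v| < r -> `|s - t| < r -> `|(u, s) - (v, t)| < r.
Proof. by move=> uv st; rewrite prod_normE gt_max /= uv. Qed.

(** The equation is given pointwise near [(x0, 0)], with no continuity in the initial state;
    trapping the solutions makes the smallness uniform in [u] and [s]. *)
Lemma flow_near (V Y : normedModType R) (x0 : V) (y0 : Y) (f : Y -> Y)
    (init : V -> Y) (flow : V -> R -> Y) :
  locally_lipschitz f y0 ->
  (\forall u \near x0, `|init u - y0| <= `|u - x0| /\ flow u 0 = init u) ->
  (\forall q \near (x0, 0 : R), is_derive q.2 (1 : R) (flow q.1) (f (flow q.1 q.2))) ->
  forall e : R, 0 < e -> exists2 r : R, 0 < r &
    forall u s, `|u - x0| < r -> `|s| < r -> `|flow u s - y0| < e.
Proof.
move=> fL /nearW_radius[r1 r10 H1] /near_pair_radius[r2 r20 H2] e e0.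
have [K K0 [r3 r30 H3]] := locally_lipschitz_bounded fL.
pose e' := Num.min e r3; have e'0 : 0 < e' by rewrite lt_min e0.
have K1 : 0 < K + 1 by rewrite ltr_wpDl.
pose r := Num.min (Num.min r1 r2) (e' / (2 * (K + 1))).
have r0 : 0 < r by rewrite !lt_min r10 r20 divr_gt0 // mulr_gt0.
exists r => // u s; rewrite lt_min => /andP[]; rewrite lt_min => /andP[ur1 ur2].
rewrite ltr_pdivlMr ?mulr_gt0 // => ur3 sr.
have rE : r * (2 * (K + 1)) <= e' by rewrite -ler_pdivlMr ?mulr_gt0 // ge_min lexx orbT.
have [iu fu] := H1 _ ur1.
have [] := @solution_trapped _ _ f y0 e' K _ K0 (flow u) r s => //.
- by move=> y ye; apply: H3; apply: lt_le_trans ye _; rewrite ge_min lexx orbT.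
- move=> t tr; apply: (H2 u t) => //; rewrite subr0 (lt_le_trans tr) //.
  by rewrite !ge_min lexx orbT.
- rewrite fu; have := normr_ge0 (u - x0); nra.
- by move=> h _; apply: lt_le_trans h _; rewrite ge_min lexx.
Qed.

(** [unique_small_zero] locates the zero without a rate. The slope [c] forces a sign change on the
    interval of half-length [|e u 0| / c]; the zero found there by the intermediate value theorem
    lies in the range of uniqueness and is therefore [z u]. *)
Lemma small_zero_bound (h m : nat) (S : system R h m) (e : 'cV[R]_(h + m) -> R -> R)
    (z : 'cV[R]_(h + m) -> R) (c K r : R) :
  unique_small_zero S e z -> 0 < c -> 0 < r -> 0 <= K ->
  (forall u, `|u - ustar S| < r -> `|e u 0| <= K * `|u - ustar S|) ->
  (forall u s t, `|u - ustar S| < r -> `|s| < r -> `|t| < r -> s <= t ->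
     c * (t - s) <= e u t - e u s) ->
  (forall u s, `|u - ustar S| < r -> `|s| < r -> {for s, continuous (e u)}) ->
  exists2 r' : R, 0 < r' & forall u, `|u - ustar S| < r' ->
    `|z u| <= `|e u 0| / c /\ e u (z u) = 0.
Proof.
move=> [r1 r10 /nearW_radius[r2 r20 Hz]] c0 r0 K0 e0 slope econt.
have K1 : 0 < K + 1 by rewrite ltr_wpDl.
pose d := Num.min r r1.
exists (Num.min (Num.min r r2) (c * d / (K + 1))).
  by rewrite !lt_min r0 r20 divr_gt0 // mulr_gt0 // lt_min r0.
move=> u; rewrite !lt_min => /andP[/andP[ur ur2]]; rewrite ltr_pdivlMr // => uK.
have [_ ez0 zuniq] := Hz u ur2; split => //.
pose t := `|e u 0| / c.
have t0 : 0 <= t by rewrite divr_ge0 // ltW.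
have td : t < d.
  rewrite /t ltr_pdivrMr // mulrC; apply: (le_lt_trans (e0 u ur)).
  by have := normr_ge0 (u - ustar S); nra.
have [tr tr1] : t < r /\ t < r1 by move: td; rewrite lt_min => /andP.
have wave_curve : c * t = `|e u 0| by rewrite /t mulrC divfK // gt_eqF.
rewrite -/t; clearbody t.
have r00 : `|0 : R| < r by rewrite normr0.
have tn : `|t| < r by rewrite ger0_norm.
have mtn : `|- t| < r by rewrite normrN.
have up_ := slope u 0 t ur r00 tn t0.
have dn := slope u (- t) 0 ur mtn r00; rewrite oppr_le0 in dn; have {}dn := dn t0.
rewrite subr0 in up_; rewrite sub0r opprK in dn.
have mt : - t <= t by lra.
have ec : {within `[- t, t], continuous (e u)}.
  apply: continuous_in_subspaceT => s; rewrite inE /= in_itv /= => /andP[s1 s2].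
  by apply: econt => //; rewrite ltr_norml; apply/andP; split; lra.
have := ler_norm (e u 0); have := ler_norm (- e u 0); rewrite normrN => n1 n2.
have [|s] := IVT (v := 0) mt ec.
  by rewrite ge_min le_max; apply/andP; split; apply/orP; [left|right]; lra.
rewrite in_itv /= => /andP[s1 s2] es.
have <- : s = z u by apply: zuniq => //; rewrite ltr_norml; apply/andP; split; lra.
by rewrite ler_norml; apply/andP; split; lra.
Qed.

Lemma slope_of_derivative (g g' : R -> R) (c s t r : R) :
  (forall x, `|x| < r -> is_derive x (1 : R) g (g' x) /\ c <= g' x) ->
  `|s| < r -> `|t| < r -> s <= t -> c * (t - s) <= g t - g s.
Proof.
move=> H sr tr st.
have sub x : s <= x <= t -> `|x| < r.
  move=> /andP[sx xt]; move: sr tr; rewrite !ltr_norml => /andP[? ?] /andP[? ?].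
  by apply/andP; split; lra.
have gc : {within `[s, t], continuous g}.
  apply: continuous_in_subspaceT => x; rewrite inE /= in_itv /= => /sub xr.
  by apply: is_derive1_continuous (H x xr).1.
have [|x] := MVT_segment (df := g') st _ gc.
  move=> x; rewrite in_itv /= => /andP[sx xt].
  by apply: (H x _).1; apply: sub; rewrite !ltW.
rewrite in_itv /= => /sub xr ->; rewrite ler_wpM2r ?subr_ge0 //.
exact: (H x xr).2.
Qed.

End Preparation.

(** * Regularity, slopes and critical parameters of the k-th field *)

Section Instantiation.
Context {R : realType} {h m : nat}.
Variables (S : system R h m) (F : fields R h m) (L : layers R h m) (W : waves R h m).
Variables (k : 'I_(h + m)) (l : nat).
Hypothesis S_smooth : smooth_coefficients S.
Hypothesis S_conservative : conservative_form S.
Hypothesis S_structure : structure_conditions S.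
Hypothesis A11_noncharacteristic : noncharacteristic_block S l.
Hypothesis F_fields : characteristic_fields S F k.
Hypothesis L_center : center_manifold S L.
Hypothesis F_rk : rk_normalized S F L k.
Hypothesis L_curves : layer_curves S L.
Hypothesis W_integral : integral_curves S F W.
Hypothesis W_hugoniot : hugoniot_curves S F W.
Hypothesis W_critical : critical_parameters S F W k.
Hypothesis W_tk : tk_parametrized S F L W k.

Notation state := 'cV[R]_(h + m).
Notation U := (ustar S).

Definition layer_field (q : state * R) : state * R := (rc S L q, thc L q).
Definition layer_curve (u : state) (s : R) : state * R := (bu L u s, bz L u s).
Definition hug (q : state * R) : state := hcurve W k q.1 q.2.
Definition speed (q : state * R) : R := sigma W k q.1 q.2.

Let cV := cV_coordinates (R := R) (h + m).
Let cVR := pairR_coordinates cV.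

Lemma k_genuinely_nonlinear : genuinely_nonlinear S F k.
Proof.
case: F_fields => [_ _ _ _ [_ [d d0 Hd]]].
by apply: filterS Hd => u; exact: lt_le_trans.
Qed.

Lemma tcurve_wave_curve (u : state) (s : R) :
  tcurve S F W k u s = wave_curve (icurve W k) (hcurve W k) u s.
Proof. by rewrite /tcurve /wave_curve asboolT //; exact: k_genuinely_nonlinear. Qed.

Lemma lam_locally_lipschitz : locally_lipschitz (lam F k) U.
Proof.
case: F_fields => [/(_ k)[lamC _] _ _ _ _].
exact: (classC_near1_locally_lipschitz cV (classC_near1W lamC)).
Qed.

Lemma rv_locally_lipschitz : locally_lipschitz (rv F k) U.
Proof.
case: F_fields => [/(_ k)[_ rC] _ _ _ _].
exact: (classC_near1_locally_lipschitz cV (classC_near1W rC)).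
Qed.

Lemma layer_field_locally_lipschitz : locally_lipschitz layer_field (U, 0).
Proof.
case: L_center => [[pcC thC] _ _ _ _].
have pL : locally_lipschitz (pc L) (U, 0).
  exact: (classC_near1_locally_lipschitz cVR (classC_near1W pcC)).
apply: locally_lipschitz_pair; last first.
  exact: (classC_near1_locally_lipschitz cVR (classC_near1W thC)).
case: S_smooth => [_ [A11s A21s _] _ _ _].
apply: locally_lipschitz_col_mxN => //; apply: locally_lipschitz_mulmx => //.
apply: (locally_lipschitz_fst (f := fun u => invmx (A11 S u) *m (A21 S u)^T)).
apply: locally_lipschitz_mulmx.
  apply: locally_lipschitz_invmx.
    exact: (classC_near1_locally_lipschitz cV (smooth_classC_near 1 A11s)).
  by apply: filterS A11_noncharacteristic => u [d _]; rewrite unitmxE unitfE.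
apply: locally_lipschitz_trmx.
exact: (classC_near1_locally_lipschitz cV (smooth_classC_near 1 A21s)).
Qed.

Lemma hug_classC2 : classC_near 2 (U, 0) hug.
Proof. by have [] := W_hugoniot k. Qed.

Lemma speed_classC2 : classC_near 2 (U, 0) speed.
Proof. by have [] := W_hugoniot k. Qed.

Lemma hug_deriv_locally_lipschitz : locally_lipschitz ('D_(0, 1) hug) (U, 0).
Proof.
apply: (classC_near1_locally_lipschitz cVR).
exact: classC_near_derive hug_classC2.
Qed.

Lemma speed_locally_lipschitz : locally_lipschitz speed (U, 0).
Proof. exact: (classC_near1_locally_lipschitz cVR (classC_near1W speed_classC2)). Qed.

Lemma hug_is_derive : \forall q \near (U, 0 : R),
  is_derive q.2 (1 : R) (hcurve W k q.1) ('D_(0, 1) hug q).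
Proof.
apply: filterS (classC_near_near (classC_near1W hug_classC2)) => -[u s] C.
apply: (is_derive_snd (f := hug)); exact: classC_near1_derivable.
Qed.

Lemma speed_is_derive : \forall q \near (U, 0 : R),
  is_derive q.2 (1 : R) (sigma W k q.1) ('D_(0, 1) speed q).
Proof.
apply: filterS (classC_near_near (classC_near1W speed_classC2)) => -[u s] C.
apply: (is_derive_snd (f := speed)); exact: classC_near1_derivable.
Qed.

Lemma sigma_slope : exists2 c : R, 0 < c & exists2 r : R, 0 < r &
  forall u s t, `|u - U| < r -> `|s| < r -> `|t| < r -> s <= t ->
    c * (t - s) <= sigma W k u t - sigma W k u s.
Proof.
have D0 := shock_speed_slope_pos S_smooth S_conservative S_structure F_fields W_hugoniot.
rewrite -/speed in D0; set D := 'D_(0, 1) speed (U, 0) in D0.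
exists (D / 2); first by rewrite divr_gt0.
have Dc : {for (U, 0), continuous ('D_(0, 1) speed)}.
  exact: classC_near_continuous (classC_near_derive _ speed_classC2).
have : \forall q \near (U, 0 : R), D / 2 < 'D_(0, 1) speed q.
  by apply: (cvgr_gt _ Dc); rewrite ltr_pdivrMr // mulr_natr mulr2n ltrDl.
move=> H; have /near_pair_radius[r r0 Hr] : \forall q \near (U, 0 : R),
    D / 2 < 'D_(0, 1) speed q /\
    is_derive q.2 (1 : R) (sigma W k q.1) ('D_(0, 1) speed q).
  by apply: filterI H _; exact: speed_is_derive.
exists r => // u s t ur sr tr st.
apply: (@slope_of_derivative _ _ (fun x => 'D_(0, 1) speed (u, x)) (D / 2) s t r _ sr tr st).
move=> x xr; have [] := Hr u x ur; first by rewrite subr0.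
by move=> /= /ltW.
Qed.

Lemma icurve_near (e : R) : 0 < e -> exists2 r : R, 0 < r &
  forall u s, `|u - U| < r -> `|s| < r -> `|icurve W k u s - U| < e.
Proof.
have [ic0 icd] := W_integral k.
apply: (flow_near (init := id) rv_locally_lipschitz) => //.
by apply: filterS ic0.
Qed.

Lemma layer_curve_is_derive : \forall q \near (U, 0 : R),
  is_derive q.2 (1 : R) (layer_curve q.1) (layer_field (layer_curve q.1 q.2)).
Proof.
case: L_curves => [_ Hd]; apply: filterS Hd => q [d1 d2].
exact: is_derive_pair.
Qed.

Lemma layer_curve0 : \forall u \near U, layer_curve u 0 = (u, 0).
Proof. by case: L_curves => [H0 _]; apply: filterS H0 => u [b1 b2]; rewrite /layer_curve b1 b2. Qed.

Lemma layer_curve_near (e : R) : 0 < e -> exists2 r : R, 0 < r &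
  forall u s, `|u - U| < r -> `|s| < r -> `|layer_curve u s - (U, 0)| < e.
Proof.
apply: (flow_near (init := fun u => (u, 0)) layer_field_locally_lipschitz).
  apply: filterS layer_curve0 => u b0; split => //.
  by apply: (le_trans (pair_dist_le _ _ _ _)); rewrite subrr normr0 addr0.
exact: layer_curve_is_derive.
Qed.

Lemma lam_icurve_slope : exists2 c : R, 0 < c & exists2 r : R, 0 < r &
  forall u s t, `|u - U| < r -> `|s| < r -> `|t| < r -> s <= t ->
    c * (t - s) <= lam F k (icurve W k u t) - lam F k (icurve W k u s).
Proof.
case: F_fields => [/(_ k)[lamC _] _ _ _ [_ [d d0 Hd]]].
exists d => //.
have lamd : \forall u \near U, differentiable (lam F k) u.
  apply: filterS (classC_near_near (classC_near1W lamC)) => u.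
  exact: (classC_near1_differentiable cV).
have /nearW_radius[r1 r10 H1] : \forall u \near U,
    d <= 'D_(rv F k u) (lam F k) u /\ differentiable (lam F k) u.
  by apply: filterI Hd _.
have [r2 r20 H2] := icurve_near r10.
have [_ /near_pair_radius[r3 r30 H3]] := W_integral k.
exists (Num.min r2 r3) => [|u s t]; first by rewrite lt_min r20.
rewrite !lt_min => /andP[ur2 ur3] sr tr st.
have := @slope_of_derivative _ (lam F k \o icurve W k u)
  (fun x => 'D_(rv F k (icurve W k u x)) (lam F k) (icurve W k u x)) d s t (Num.min r2 r3).
rewrite !lt_min; apply; [|exact: sr|exact: tr|exact: st].
move=> x; rewrite lt_min => /andP[xr2 xr3].
have [dle ldiff] := H1 _ (H2 u x ur2 xr2); split => //.
apply: is_derive_curve => //; apply: (H3 u x ur3); by rewrite subr0.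
Qed.

Lemma lam_U0 : lam F k U = 0.
Proof. by case: F_fields => [_ _ _ [_ ->]]. Qed.

Lemma sunder_bound : exists2 K : R, 0 < K & exists2 r : R, 0 < r & forall u, `|u - U| < r ->
  `|sunder W u| <= K * `|lam F k u| /\ sigma W k u (sunder W u) = 0.
Proof.
have [c c0 [r1 r10 H1]] := sigma_slope.
have [K K0 [r2 r20 H2]] := lam_locally_lipschitz.
have [_ _ hinit _] := W_hugoniot k.
have /nearW_radius[r3 r30 H3] := hinit.
have /near_pair_radius[r4 r40 H4] := speed_is_derive.
pose r := Num.min (Num.min r1 r2) (Num.min r3 r4).
have r0 : 0 < r by rewrite !lt_min r10 r20 r30.
have rs (x : R) : x < r -> [/\ x < r1, x < r2, x < r3 & x < r4].
  by rewrite !lt_min => /andP[/andP[? ?] /andP[? ?]].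
have [su_ _] := W_critical.
have := @small_zero_bound _ _ _ _ (sigma W k) (sunder W) c K r su_ c0 r0 K0 _ _ _.
case.
- move=> u /rs[_ u2 u3 _]; have [_ -> _] := H3 u u3.
  by have := H2 u U u2; rewrite subrr normr0 lam_U0 subr0; apply.
- by move=> u s t /rs[u1 _ _ _] /rs[s1 _ _ _] /rs[t1 _ _ _]; exact: H1.
- move=> u s /rs[_ _ _ u4] /rs[_ _ _ s4]; apply: is_derive1_continuous.
  by apply: (H4 u s u4); rewrite subr0.
move=> r' r'0 Hr'; exists c^-1; first by rewrite invr_gt0.
exists (Num.min r' r3) => [|u]; first by rewrite lt_min r'0.
rewrite lt_min => /andP[ur' u3]; have [h1 h2] := Hr' u ur'; split=> //.
by rewrite mulrC; have [_ <- _] := H3 u u3.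
Qed.

Lemma sbar_bound : exists2 K : R, 0 < K & exists2 r : R, 0 < r & forall u, `|u - U| < r ->
  `|sbar W u| <= K * `|lam F k u| /\ lam F k (icurve W k u (sbar W u)) = 0.
Proof.
have [c c0 [r1 r10 H1]] := lam_icurve_slope.
have [K K0 [r2 r20 H2]] := lam_locally_lipschitz.
have [ic0 icd] := W_integral k.
have /nearW_radius[r3 r30 H3] := ic0.
have /near_pair_radius[r4 r40 H4] := icd.
case: F_fields => [/(_ k)[lamC _] _ _ _ _].
have /nearW_radius[r5 r50 H5] : \forall u \near U, {for u, continuous (lam F k)}.
  by apply: filterS (classC_near_near lamC) => u; exact: classC_near_continuous.
have [r6 r60 H6] := icurve_near r50.
pose r := Num.min (Num.min (Num.min r1 r2) (Num.min r3 r4)) r6.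
have r0 : 0 < r by rewrite !lt_min r10 r20 r30 r40.
have rs (x : R) : x < r -> [/\ x < r1, x < r2, x < r3 & x < r4] /\ x < r6.
  by rewrite !lt_min => /andP[/andP[/andP[? ?] /andP[? ?]] ?].
have [_ sb_] := W_critical.
have := @small_zero_bound _ _ _ _ (fun u s =>
  lam F k (icurve W k u s)) (sbar W) c K r sb_ c0 r0 K0 _ _ _.
case.
- move=> u /rs[[_ u2 u3 _] _]; rewrite H3 //.
  by have := H2 u U u2; rewrite subrr normr0 lam_U0 subr0; apply.
- by move=> u s t /rs[[u1 _ _ _] _] /rs[[s1 _ _ _] _] /rs[[t1 _ _ _] _]; exact: H1.
- move=> u s /rs[[_ _ _ u4] u6] /rs[[_ _ _ s4] s6].
  apply: (@continuous_comp _ _ _ (icurve W k u) (lam F k)); last exact: H5 (H6 u s u6 s6).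
  apply: is_derive1_continuous.
  by apply: (H4 u s u4); rewrite subr0.
move=> r' r'0 Hr'; exists c^-1; first by rewrite invr_gt0.
exists (Num.min r' r3) => [|u]; first by rewrite lt_min r'0.
rewrite lt_min => /andP[ur' u3]; have [h1 h2] := Hr' u ur'; split=> //.
by rewrite H3 // mulrC in h1.
Qed.

Lemma sunder_near (e : R) : 0 < e -> exists2 r : R, 0 < r &
  forall u, `|u - U| < r -> `|sunder W u| < e.
Proof.
move=> e0; have [K K0 [r1 r10 H1]] := sunder_bound.
have [K' K'0 [r2 r20 H2]] := lam_locally_lipschitz.
have KK : 0 < K * K' + 1 by rewrite ltr_wpDl // mulr_ge0 // ltW.
exists (Num.min (Num.min r1 r2) (e / (K * K' + 1))); first by rewrite !lt_min r10 r20 divr_gt0.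
move=> u; rewrite !lt_min ltr_pdivlMr // => /andP[/andP[ur1 ur2] ue].
have [su1 _] := H1 u ur1; have := H2 u U ur2; rewrite subrr normr0 lam_U0 subr0 => /(_ r20) h2.
have h3 : K * `|lam F k u| <= K * (K' * `|u - U|) by rewrite ler_wpM2l // ltW.
by have := normr_ge0 (u - U); lra.
Qed.

(** The normalization of t_k is stated in phase space, where it gives z_c p_c = 0. Testing with
    p_c^T B_22 and using p_c^T B_22 p_c = 1 recovers z_c = 0. *)
Lemma sunder_contact : exists2 r : R, 0 < r & forall u, `|u - U| < r ->
  lam F k u <= 0 -> 0 <= sunder W u -> layer_curve u (sunder W u) = (hcurve W k u (sunder W u), 0).
Proof.
case: L_center => [_ /near_pair_radius[r1 r10 H1] _ _ _].
have [r2 r20 H2] := layer_curve_near r10.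
have [r3 r30 H3] := sunder_near r20.
have /nearW_radius[r4 r40 H4] := W_tk.
exists (Num.min (Num.min r2 r3) r4) => [|u]; first by rewrite !lt_min r20 r30.
rewrite !lt_min => /andP[/andP[u2 u3] u4] lu su0.
have := H4 u u4 lu; rewrite tcurve_wave_curve /wave_curve su0 /b_ /center_chart /=.
have [bu_ bz_] : `|bu L u (sunder W u) - U| < r1 /\ `|bz L u (sunder W u) - 0| < r1.
  have := H2 u _ u2 (H3 u u3); rewrite prod_normE gt_max /= => /andP[]; by [].
have := H1 _ _ bu_ bz_; rewrite /layer_curve.
set b := bu L u _; set z := bz L u _ => pcn [hE zE].
congr (_, _); first by rewrite hE.
have : ((pc L (b, z))^T *m B22 S b *m (z *: pc L (b, z))) 0 0 = 0.
  by rewrite -zE mulmx0 mxE.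
by rewrite -scalemxAr pcn !mxE eqxx mulr1.
Qed.

End Instantiation.

(** * The interaction estimate in phase space *)

Section Assembly.
Context {R : realType}.

Lemma common_radius (rs : seq R) : (forall r, r \in rs -> 0 < r) ->
  exists rho : R, [/\ 0 < rho, rho <= 1 & forall r, r \in rs -> rho <= r].
Proof.
elim: rs => [|r rs IHrs] Hpos; first by exists 1; split.
have [|rho [rho0 rho1 Hrho]] := IHrs.
  by move=> s srs; apply: Hpos; rewrite inE srs orbT.
exists (Num.min r rho); split; first by rewrite lt_min rho0 Hpos // mem_head.
  by rewrite ge_min rho1 orbT.
move=> s; rewrite inE => /orP[/eqP ->|/Hrho sr]; first by rewrite ge_min lexx.
by rewrite ge_min sr orbT.
Qed.

Lemma common_bound (Ks : seq R) : exists K : R, 1 <= K /\ forall C, C \in Ks -> C <= K.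
Proof.
elim: Ks => [|C Ks [K [K1 HK]]]; first by exists 1.
exists (Num.max C K); split; first by rewrite le_max K1 orbT.
move=> D; rewrite inE => /orP[/eqP ->|/HK DK]; first by rewrite le_max lexx.
by rewrite le_max DK orbT.
Qed.

Lemma locally_lipschitz_scale (V : normedModType R) (p q : nat) (f : V -> R)
    (g : V -> 'M[R]_(p, q)) (x : V) :
  locally_lipschitz f x -> locally_lipschitz g x ->
  locally_lipschitz (fun y => f y *: g y) x.
Proof.
move=> fL gL; have [C C0 [d d0 Cf]] := locally_lipschitz_bounded fL.
have [C' C'0 [d' d'0 Cg]] := locally_lipschitz_bounded gL.
case: fL gL => [K K0 [e e0 Hf]] [K' K'0 [e' e'0 Hg]].
exists (K * C' + C * K'); first by rewrite addr_ge0 // mulr_ge0.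
exists (Num.min (Num.min d d') (Num.min e e')); first by rewrite !lt_min d0 d'0 e0.
move=> y z; rewrite !lt_min => /andP[/andP[yd yd'] /andP[ye ye']].
move=> /andP[/andP[zd zd'] /andP[ze ze']].
have -> : f y *: g y - f z *: g z = (f y - f z) *: g y + f z *: (g y - g z).
  by rewrite scalerBl scalerBr addrA subrK.
apply: (le_trans (ler_normD _ _)); rewrite !normrZ mulrDl lerD //.
  by rewrite mulrAC ler_pM // ?Hf ?Cg.
by rewrite -mulrA ler_pM // ?Hg ?Cf.
Qed.

Lemma locally_lipschitz_id_fst (V : normedModType R) (x : V * R) :
  locally_lipschitz (fun q : V * R => q.1) x.
Proof.
exists 1 => //; exists 1 => // y z _ _.
by rewrite mul1r; have -> : `|y - z| = Num.max `|y.1 - z.1| `|y.2 - z.2| by [];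
   rewrite le_max lexx.
Qed.

Lemma locally_lipschitz_id_snd (V : normedModType R) (x : V * R) :
  locally_lipschitz (fun q : V * R => q.2) x.
Proof.
exists 1 => //; exists 1 => // y z _ _.
by rewrite mul1r; have -> : `|y - z| = Num.max `|y.1 - z.1| `|y.2 - z.2| by [];
   rewrite le_max lexx orbT.
Qed.

Context {h m : nat}.
Variables (S : system R h m) (F : fields R h m) (L : layers R h m) (W : waves R h m).
Variables (k : 'I_(h + m)) (l : nat).
Hypothesis S_smooth : smooth_coefficients S.
Hypothesis S_conservative : conservative_form S.
Hypothesis S_structure : structure_conditions S.
Hypothesis A11_noncharacteristic : noncharacteristic_block S l.
Hypothesis F_fields : characteristic_fields S F k.
Hypothesis L_center : center_manifold S L.
Hypothesis F_rk : rk_normalized S F L k.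
Hypothesis L_curves : layer_curves S L.
Hypothesis W_integral : integral_curves S F W.
Hypothesis W_hugoniot : hugoniot_curves S F W.
Hypothesis W_critical : critical_parameters S F W k.
Hypothesis W_tk : tk_parametrized S F L W k.

Notation state := 'cV[R]_(h + m).
Notation U := (ustar S).

Let lamk := lam F k.
Let ick := icurve W k.
Let hck := hcurve W k.
Let lc := layer_curve L.
Let GX := char_curve lamk ick hck lc (sunder W) (sbar W).

Local Ltac mem := by rewrite !inE eqxx ?orbT.

(** The twenty radii and ten bounds of the local estimates are merged into one radius [rho] and one
    constant [K], and the two slopes into their minimum [c]. *)
Lemma char_curve_estimates_near :
  (exists2 C : R, 0 <= C & exists2 r : R, 0 < r & forall u t x,
    `|u - U| < r -> `|wave_curve ick hck u t - U| < r -> `|t| < r -> `|x| < r ->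
    wave_speed lamk ick hck (sigma W k) u t < 0 ->
    (lamk (wave_curve ick hck u t) <= 0 -> x <= sunder W (wave_curve ick hck u t)) ->
    (0 < lamk (wave_curve ick hck u t) -> x = 0) ->
    `|GX u (x + t) - GX (wave_curve ick hck u t) x|
      <= C * (`|t| * (`|wave_speed lamk ick hck (sigma W k) u t| + `|x|))) /\
  (exists2 C : R, 0 <= C & exists2 r : R, 0 < r & forall u s,
    `|u - U| < r -> `|s| < r -> `|GX u s - (U, 0)| <= C * (`|u - U| + `|s|)).
Proof.
have [K1 _ [d1 q1 H1]] := lam_locally_lipschitz F_fields.
have [K2 _ [d2 q2 H2]] := rv_locally_lipschitz F_fields.
have [K3 _ [d3 q3 H3]] := locally_lipschitz_bounded (rv_locally_lipschitz F_fields).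
have LF := layer_field_locally_lipschitz S_smooth A11_noncharacteristic L_center.
have [K4 _ [d4 q4 H4]] := LF.
have [K5 _ [d5 q5 H5]] := locally_lipschitz_bounded LF.
have [ic0 /near_pair_radius[d6 q6 H6]] := W_integral k.
have /nearW_radius[d7 q7 H7] := ic0.
have /nearW_radius[d8 q8 H8] := layer_curve0 L_curves.
have /near_pair_radius[d9 q9 H9] := layer_curve_is_derive L_curves.
have [_ _ /nearW_radius[d10 q10 H10] _] := W_hugoniot k.
have /near_pair_radius[d11 q11 H11] := hug_is_derive k W_hugoniot.
have HL := hug_deriv_locally_lipschitz k W_hugoniot.
have [K6 K60 [d12 q12 H12]] := HL.
have [K7 _ [d13 q13 H13]] := locally_lipschitz_bounded HL.
have [K8 K80 [d14 q14 H14]] := speed_locally_lipschitz k W_hugoniot.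
have [c1 c10 [d15 q15 H15]] :=
  sigma_slope S_smooth S_conservative S_structure F_fields W_hugoniot.
have [c2 c20 [d16 q16 H16]] := lam_icurve_slope F_fields W_integral.
have [K9 K90 [d17 q17 H17]] := sunder_bound S_smooth S_conservative S_structure
  F_fields W_hugoniot W_critical.
have [K10 K100 [d18 q18 H18]] := sbar_bound F_fields W_integral W_critical.
have [d19 q19 H19] := sunder_contact S_smooth S_conservative S_structure
  A11_noncharacteristic F_fields L_center L_curves W_hugoniot W_critical W_tk.
have /nearW_radius[d20 q20 H20] := F_rk.
have [rho [rho0 rho1 Hr]] : exists rho : R, [/\ 0 < rho, rho <= 1 &
    forall r, r \in [:: d1; d2; d3; d4; d5; d6; d7; d8; d9; d10; d11; d12; d13; d14;
       d15; d16; d17; d18; d19; d20] -> rho <= r].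
  apply: common_radius => r; rewrite !inE.
  by do 19! (case/orP => [/eqP -> //|]) ; move/eqP ->.
have [K [K1' HK]] := common_bound [:: K1; K2; K3; K4; K5; K6; K7; K8; K9; K10].
pose c := Num.min c1 c2; have c0 : 0 < c by rewrite lt_min c10.
have lt_r r x : x < rho -> r \in [:: d1; d2; d3; d4; d5; d6; d7; d8; d9; d10; d11; d12; d13; d14;
       d15; d16; d17; d18; d19; d20] -> x < r.
  by move=> xr /Hr; exact: lt_le_trans.
have K0 : 0 <= K by apply: le_trans K1'.
have le_K (C x y : R) : 0 <= y -> x <= C * y ->
    C \in [:: K1; K2; K3; K4; K5; K6; K7; K8; K9; K10] -> x <= K * y.
  by move=> y0 xC /HK CK; apply: (le_trans xC); rewrite ler_wpM2r.
have c_le (e x y : R) : 0 <= y -> e * y <= x -> c <= e -> c * y <= x.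
  by move=> y0 ex ce; apply: le_trans ex; rewrite ler_wpM2r.
apply: (@char_curve_estimates _ _ U rho K c lamk (rv F k) (layer_field S L) ick hck
  ('D_(0, 1) (hug W k)) lc (sigma W k) (sunder W) (sbar W)
  rho0 rho1 K1' c0 (lam_U0 F_fields)).
- move=> u v ur vr; apply: le_K (H1 u v _ _) _ => //; [apply: lt_r ur _|apply: lt_r vr _|]; mem.
- move=> u v ur vr; apply: le_K (H2 u v _ _) _ => //; [apply: lt_r ur _|apply: lt_r vr _|]; mem.
- move=> u ur; apply: le_trans (H3 u _) (HK _ _); [apply: lt_r ur _|]; mem.
- move=> u v ur vr; apply: le_K (H4 u v _ _) _ => //; [apply: lt_r ur _|apply: lt_r vr _|]; mem.
- move=> u ur; apply: le_trans (H5 u _) (HK _ _); [apply: lt_r ur _|]; mem.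
- move=> u ur; apply: H7; apply: lt_r ur _; mem.
- move=> u s ur sr; apply: (H6 u s); rewrite ?subr0; [apply: lt_r ur _|apply: lt_r sr _]; mem.
- move=> u ur; apply: H8; apply: lt_r ur _; mem.
- move=> u s ur sr; apply: (H9 u s); rewrite ?subr0; [apply: lt_r ur _|apply: lt_r sr _]; mem.
- move=> u ur; have [] := H10 u; [apply: lt_r ur _; mem|by []].
- move=> u s ur sr; apply: (H11 u s); rewrite ?subr0; [apply: lt_r ur _|apply: lt_r sr _]; mem.
- move=> u v s t ur vr sr tr.
  apply: (@le_trans _ _ (K6 * `|(u, s) - (v, t)|)).
    by apply: H12; apply: pair_ball; rewrite ?subr0;
      [apply: lt_r ur _|apply: lt_r sr _|apply: lt_r vr _|apply: lt_r tr _]; mem.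
  apply: (@le_trans _ _ (K6 * (`|u - v| + `|s - t|))).
    by rewrite ler_wpM2l // pair_dist_le.
  by rewrite ler_wpM2r ?addr_ge0 // HK //; mem.
- move=> u s ur sr; apply: le_trans (H13 (u, s) _) (HK _ _); last by mem.
  by apply: pair_ball; rewrite ?subr0; [apply: lt_r ur _|apply: lt_r sr _]; mem.
- move=> u ur; have [] := H10 u; [apply: lt_r ur _; mem|by []].
- move=> u v s ur vr sr.
  apply: (@le_trans _ _ (K8 * `|(u, s) - (v, s)|)).
    by apply: (H14 (u, s) (v, s)); apply: pair_ball; rewrite ?subr0;
      [apply: lt_r ur _|apply: lt_r sr _|apply: lt_r vr _|apply: lt_r sr _]; mem.
  apply: (@le_trans _ _ (K8 * (`|u - v| + `|s - s|))).
    by rewrite ler_wpM2l // pair_dist_le.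
  by rewrite subrr normr0 addr0 ler_wpM2r // HK //; mem.
- move=> u s t ur sr tr st; apply: c_le (H15 u s t _ _ _ st) _; rewrite ?subr_ge0 //;
    [apply: lt_r ur _; mem|apply: lt_r sr _; mem|apply: lt_r tr _; mem|].
  by rewrite ge_min lexx.
- move=> u s t ur sr tr st; apply: c_le (H16 u s t _ _ _ st) _; rewrite ?subr_ge0 //;
    [apply: lt_r ur _; mem|apply: lt_r sr _; mem|apply: lt_r tr _; mem|].
  by rewrite ge_min lexx orbT.
- move=> u ur; have [|b1 b2] := H17 u; first by [apply: lt_r ur _; mem].
  split=> //; apply: le_K b1 _ => //; mem.
- move=> u ur; have [|b1 b2] := H18 u; first by [apply: lt_r ur _; mem].
  split=> //; apply: le_K b1 _ => //; mem.
- move=> u ur lu su0; apply: H19 => //; apply: lt_r ur _; mem.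
- move=> u ur lu; apply: H20 => //; apply: lt_r ur _; mem.
Qed.

Lemma gamma_char_curve (u : state) (s : R) : gamma S F L W k u s = center_chart L (GX u s).
Proof.
have chart0 (v : state) : center_chart L (v, 0) = (v, 0) by rewrite /center_chart /= scale0r.
rewrite /gamma /GX /char_curve !(tcurve_wave_curve W F_fields).
by case: ifP => _; case: ifP => _ //; rewrite chart0.
Qed.

Lemma center_chart_locally_lipschitz : locally_lipschitz (center_chart L) (U, 0).
Proof.
case: L_center => [[pcC _] _ _ _ _].
apply: locally_lipschitz_pair; first exact: locally_lipschitz_id_fst.
apply: locally_lipschitz_scale; first exact: locally_lipschitz_id_snd.
exact: (classC_near1_locally_lipschitz (pairR_coordinates (cV_coordinates (h + m)))
  (classC_near1W pcC)).
Qed.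

Lemma varsigma_wave_speed (u : state) (s : R) :
  varsigma S F W k u s = wave_speed lamk ick hck (sigma W k) u s.
Proof. by rewrite /varsigma (tcurve_wave_curve W F_fields). Qed.

Lemma gamma_near : exists2 C : R, 0 <= C & exists2 r : R, 0 < r & forall u s,
  `|u - U| < r -> `|s| < r ->
  `|gamma S F L W k u s - (U, 0)| <= C * (`|u - U| + `|s|).
Proof.
have [_ [C C0 [r r0 H]]] := char_curve_estimates_near.
have [K K0 [r' r'0 HK]] := center_chart_locally_lipschitz.
have C1 : 0 < C + 1 by rewrite ltr_wpDl.
exists (K * C); first exact: mulr_ge0.
exists (Num.min r (r' / (2 * (C + 1)))) => [|u s].
  by rewrite lt_min r0 divr_gt0 // mulr_gt0.
have p2 : 0 < 2 * (C + 1) by rewrite mulr_gt0.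
rewrite !lt_min !ltr_pdivlMr // => /andP[ur ur'] /andP[sr sr'].
have g := H u s ur sr; have U0 : (U, 0) = center_chart L (U, 0) :> _ * _.
  by rewrite /center_chart /= scale0r.
rewrite gamma_char_curve {1}U0.
have n0 := normr_ge0 (u - U); have n1 := normr_ge0 s.
have gr : `|GX u s - (U, 0)| < r' by apply: (le_lt_trans g); nra.
apply: (le_trans (HK _ _ gr _)); first by rewrite subrr normr0.
by rewrite -mulrA ler_wpM2l.
Qed.

Lemma gamma_interaction : exists2 C : R, 0 <= C & exists2 r : R, 0 < r & forall u t x,
  let v := tcurve S F W k u t in
  `|u - U| < r -> `|v - U| < r -> `|t| < r -> `|x| < r ->
  varsigma S F W k u t < 0 ->
  (lam F k v <= 0 -> x <= sunder W v) -> (0 < lam F k v -> x = 0) ->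
  `|gamma S F L W k u (x + t) - gamma S F L W k v x|
    <= C * (`|t| * (`|varsigma S F W k u t| + `|x|)).
Proof.
have [[A A0 [a a0 HA]] [C C0 [r r0 H]]] := char_curve_estimates_near.
have [K K0 [r' r'0 HK]] := center_chart_locally_lipschitz.
have C1 : 0 < C + 1 by rewrite ltr_wpDl.
exists (K * A); first exact: mulr_ge0.
exists (Num.min (Num.min a (r / 2)) (r' / (4 * (C + 1)))) => [|u t x].
  by rewrite !lt_min a0 !divr_gt0 // mulr_gt0.
have p2 : 0 < 4 * (C + 1) by rewrite mulr_gt0.
rewrite varsigma_wave_speed (tcurve_wave_curve W F_fields) /= !gamma_char_curve.
rewrite !lt_min ![_ < r' / _]ltr_pdivlMr //.
move=> /andP[/andP[ua ur] ur'] /andP[/andP[va vr] vr'] /andP[/andP[ta tr] tr'].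
move=> /andP[/andP[xa xr] xr'] vs l1 l2.
have B := HA u t x ua va ta xa vs l1 l2.
have n0 := normr_ge0 (u - U); have n1 := normr_ge0 t; have n2 := normr_ge0 x.
have n3 := ler_normD x t.
have g1 : `|GX u (x + t) - (U, 0)| < r'.
  apply: (le_lt_trans (H u (x + t) _ _)); [lra|by apply: (le_lt_trans n3); lra|].
  have : C * (`|u - U| + `|x + t|) <= C * (`|u - U| + (`|x| + `|t|)) by rewrite ler_wpM2l // lerD2l.
  nra.
have g2 : `|GX (wave_curve ick hck u t) x - (U, 0)| < r'.
  apply: (le_lt_trans (H (wave_curve ick hck u t) x _ _)); [lra|lra|].
  by have := normr_ge0 (wave_curve ick hck u t - U); nra.
by apply: (le_trans (HK _ _ g1 g2)); rewrite -mulrA ler_wpM2l.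
Qed.

End Assembly.

(** * The boundary map *)

Section Boundary.
Context {R : realType} {h m : nat}.
Variables (S : system R h m) (F : fields R h m) (L : layers R h m) (W : waves R h m).
Variables (k : 'I_(h + m)) (n : nat) (M : slaving R h m n).

Notation state := 'cV[R]_(h + m).
Notation U := (ustar S).

(** For the approximate solution, whose strengths beyond [k] vanish, the state entering [phi] is
    thus the given right state itself. *)
Lemma fast_waves0 : integral_curves S F W -> hugoniot_curves S F W ->
  \forall u \near U, forall s : 'I_(h + m) -> R,
    (forall i : 'I_(h + m), (k < i)%N -> s i = 0) -> fast_waves S F W k s u = u.
Proof.
move=> Wi Wh.
have Ht (i : 'I_(h + m)) : \forall u \near U, tcurve S F W i u 0 = u.
  have [ic0 _] := Wi i; have [_ _ hc0 _] := Wh i.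
  move: ic0 hc0; apply: filterS2 => u iu [hu _ _].
  by rewrite /tcurve; case: ifP.
have : \forall u \near U, forall i, tcurve S F W i u 0 = u.
  exact: (@filter_forall _ _ (fun i u => tcurve S F W i u 0 = u) (nbhs U) _ Ht).
apply: filterS => u Hu s s0; rewrite /fast_waves.
have : all (fun i : 'I_(h + m) => k < i)%N [seq i : 'I_(h + m) <- enum 'I_(h + m) | (k < i)%N].
  exact: seq.filter_all.
elim: [seq _ <- _ | _] => //= i t IHt /andP[ki /IHt ->].
by rewrite s0 // Hu.
Qed.

(** The constant does not depend on [ub], because the values of [pos_proj] are uniformly bounded. *)
Lemma parabolic_reduction_bound : exists2 C : R, 0 <= C & forall ub x y : state,
  `|parabolic_reduction S ub x - parabolic_reduction S ub y| <= C * `|x - y|.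
Proof.
have [C C0 HC] := @pos_proj_bounded R h.
exists (h%:R * C + 1) => [|ub x y]; first by rewrite addr_ge0 // mulr_ge0.
have e0 : 0 <= h%:R * C * `|x - y| by rewrite !mulr_ge0.
have n0 := normr_ge0 (x - y).
rewrite /parabolic_reduction opp_col_mx add_col_mx -mulmxBr -!linearB /= mulrDl mul1r.
apply: col_mx_norm_le; first exact: addr_ge0.
  apply: (@le_trans _ _ (h%:R * C * `|x - y|)); last by rewrite lerDl.
  apply: (le_trans (mulmx_norm_le _ _)); rewrite -!mulrA ler_wpM2l //.
  by rewrite ler_pM // ?HC // usubmx_norm_le.
by apply: (le_trans (dsubmx_norm_le _)); rewrite lerDr.
Qed.

Lemma beta_eq0 (u ub : state) : beta S u ub = 0 ->
  parabolic_reduction S ub u = parabolic_reduction S ub ub.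
Proof.
rewrite /beta /parabolic_reduction mulmxBr => /eqP; rewrite col_mx_eq0 !subr_eq0.
by move=> /andP[/eqP -> /eqP ->].
Qed.

(** [omega_check] is (zeta_k, 0), so its variation is at most that of [gamma]. The four terms of the
    constant come from [m_minus], from [omega_check], from [m_p], two of whose arguments move, and
    from [gamma] itself; the given Lipschitz constants have no prescribed sign, hence the absolute
    values. *)
Lemma phi_lipschitz : stable_parametrization S M -> slaving_map S F L W k M ->
  (exists2 C : R, 0 <= C & exists2 r : R, 0 < r & forall u s,
    `|u - U| < r -> `|s| < r ->
    `|gamma S F L W k u s - (U, 0)| <= C * (`|u - U| + `|s|)) ->
  exists2 C : R, 0 <= C & exists2 r : R, 0 < r & forall (u v : state) (s t : R) (xi : 'rV[R]_n),
    `|u - U| < r -> `|v - U| < r -> `|s| < r -> `|t| < r -> `|xi| < r ->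
    `|phi S F L W k M u xi s - phi S F L W k M v xi t|
      <= C * `|gamma S F L W k u s - gamma S F L W k v t|.
Proof.
move=> [[Lm /nearW_radius[r1 p1 H1]] _ _ _] [[Lp /nearW_radius[r2 p2 H2]] _ _].
move=> [G G0 [r3 p3 H3]].
have G1 : 0 < G + 1 by rewrite ltr_wpDl.
exists (`|Lm| + 1 + 2 * `|Lp| + 1); first by rewrite !addr_ge0 // mulr_ge0.
exists (Num.min (Num.min r1 r2) (Num.min r3 (r1 / (2 * (G + 1))))).
  by rewrite !lt_min p1 p2 p3 divr_gt0 // mulr_gt0.
move=> u v s t xi; have G2 : 0 < 2 * (G + 1) by rewrite mulr_gt0.
rewrite !lt_min ![_ < r1 / _]ltr_pdivlMr //.
move=> /andP[/andP[u1 u2] /andP[u3 u4]] /andP[/andP[v1 v2] /andP[v3 v4]].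
move=> /andP[/andP[s1 s2] /andP[s3 s4]] /andP[/andP[t1 t2] /andP[t3 t4]].
move=> /andP[/andP[x1 x2] _].
set g := gamma S F L W k u s; set g' := gamma S F L W k v t.
have fst_le (V V' : normedModType R) (q : V * V') : `|q.1| <= `|q|.
  by rewrite prod_normE le_max lexx.
have gU : `|g - (U, 0)| < r1.
  by apply: (le_lt_trans (H3 u s u3 s3)); have := normr_ge0 (u - U); have := normr_ge0 s; nra.
have gU' : `|g' - (U, 0)| < r1.
  by apply: (le_lt_trans (H3 v t v3 t3)); have := normr_ge0 (v - U); have := normr_ge0 t; nra.
have z1 : `|g.1 - U| < r1 by apply: le_lt_trans gU; exact: fst_le (g - (U, 0)).
have z1' : `|g'.1 - U| < r1 by apply: le_lt_trans gU'; exact: fst_le (g' - (U, 0)).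
have zz : `|g.1 - g'.1| <= `|g - g'| by exact: fst_le (g - g').
pose oc := omega_check S F L W k u s; pose oc' := omega_check S F L W k v t.
have occ : `|oc - oc'| <= `|g - g'|.
  by rewrite prod_normE ge_max /= subrr normr0 normr_ge0 andbT.
have dm : `|m_minus M oc xi - m_minus M oc' xi| <= `|Lm| * `|g - g'|.
  have := H1 ((g.1, xi), (g'.1, xi)); rewrite /= => B.
  apply: (le_trans (B _)).
    by rewrite !prod_normE /= !gt_max /= !subr0 z1 z1' x1.
  apply: (le_trans (ler_wpM2r _ (ler_norm Lm))) => //.
  rewrite ler_wpM2l // prod_normE ge_max /= subrr normr0 zz /=.
  by rewrite le_max normr_ge0.
have dp : `|m_p M oc g xi - m_p M oc' g' xi| <= 2 * `|Lp| * `|g - g'|.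
  have := H2 ((u, s, xi), (v, t, xi)); rewrite /= => B.
  apply: (le_trans (B _)).
    by rewrite !prod_normE /= !gt_max /= !subr0 u2 s2 x2 v2 t2.
  rewrite subrr normr0 addr0 -/oc -/oc' -/g -/g'.
  apply: (le_trans (ler_wpM2r _ (ler_norm Lp))) => //.
  have -> : 2 * `|Lp| * `|g - g'| = `|Lp| * (`|g - g'| + `|g - g'|) by ring.
  by rewrite ler_wpM2l // lerD2r.
apply: (@le_trans _ _ `|(m_minus M oc xi - oc + m_p M oc g xi + g) -
                        (m_minus M oc' xi - oc' + m_p M oc' g' xi + g')|).
  exact: fst_le (_ - _).
have -> : (m_minus M oc xi - oc + m_p M oc g xi + g) -
     (m_minus M oc' xi - oc' + m_p M oc' g' xi + g') =
     (m_minus M oc xi - m_minus M oc' xi) - (oc - oc') +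
     (m_p M oc g xi - m_p M oc' g' xi) + (g - g').
  rewrite !opprD !opprK addrACA; congr (_ + _); rewrite addrACA; congr (_ + _).
  by rewrite addrACA.
apply: (le_trans (ler_normD _ _)).
have e1 := ler_normD (m_minus M oc xi - m_minus M oc' xi - (oc - oc'))
  (m_p M oc g xi - m_p M oc' g' xi).
have e2 := ler_normB (m_minus M oc xi - m_minus M oc' xi) (oc - oc').
lra.
Qed.

End Boundary.

(** * Comparison of the exact and approximate boundary solutions *)

Lemma sum_small_params (R : realType) (p : nat) (k : 'I_p) (f : 'I_p -> R) :
  \sum_(i < p | (k <= i)%N) f i = f k + \sum_(i < p | (k < i)%N) f i.
Proof.
rewrite (bigD1 k) //=; congr (_ + _); apply: eq_bigl => i.
by rewrite ltn_neqAle andbC eq_sym.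
Qed.

Theorem lemma6p2 (R : realType) (h m : nat) (S : system R h m)
    (F : fields R h m) (L : layers R h m) (W : waves R h m)
    (k : 'I_(h + m)) (l : nat) (M : slaving R h m (k - l)%N)
    (S_smooth : smooth_coefficients S)
    (S_conservative : conservative_form S)
    (S_structure : structure_conditions S)
    (A11_noncharacteristic : noncharacteristic_block S l)
    (F_fields : characteristic_fields S F k)
    (L_center : center_manifold S L)
    (F_rk : rk_normalized S F L k)
    (L_curves : layer_curves S L)
    (W_integral : integral_curves S F W)
    (W_hugoniot : hugoniot_curves S F W)
    (W_critical : critical_parameters S F W k)
    (W_tk : tk_parametrized S F L W k)
    (M_stable : stable_parametrization S M)
    (M_slaving : slaving_map S F L W k M)
    (M_invertible : boundary_solver_invertible S F L W k M) :
  exists2 C2 : R, 0 < C2 & exists2 delta : R, 0 < delta &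
    forall (up ubar ub : 'cV[R]_(h + m)) (sk xik : R) (xi xi' : 'rV[R]_(k - l))
        (s' : 'I_(h + m) -> R),
      `|up - ustar S| < delta -> `|ubar - ustar S| < delta ->
      `|ub - ustar S| < delta ->
      `|sk| < delta -> `|xik| < delta -> `|xi| < delta ->
      small_params k delta xi' s' ->
      ubar = tcurve S F W k up sk ->
      varsigma S F W k up sk < 0 ->
      beta S (phi S F L W k M ubar xi xik) ub = 0 ->
      beta S (phi S F L W k M (fast_waves S F W k s' up) xi' (s' k)) ub = 0 ->
      (lam F k (tcurve S F W k up sk) <= 0 ->
         xik <= sunder W (tcurve S F W k up sk)) ->
      (0 < lam F k (tcurve S F W k up sk) -> xik = 0) ->
      \sum_j `|xi 0 j - xi' 0 j| + `|s' k - (xik + sk)|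
        + \sum_(i < h + m | (k < i)%N) `|s' i|
      <= C2 * `|sk| * (negative_part (varsigma S F W k up sk) + `|xik|).
Proof.
have half (r x : R) : 0 < r -> x < r / 2 -> x < r by lra.
have [A A0 [r1 p1 HA]] := gamma_interaction S_smooth S_conservative S_structure
  A11_noncharacteristic F_fields L_center F_rk L_curves W_integral W_hugoniot
  W_critical W_tk.
have near_gamma := gamma_near S_smooth S_conservative S_structure
  A11_noncharacteristic F_fields L_center F_rk L_curves W_integral W_hugoniot
  W_critical W_tk.
have [B B0 [r2 p2 HB]] := phi_lipschitz M_stable M_slaving near_gamma.
have [C C0 HC] := parabolic_reduction_bound S.
have [d [K [rho [d0 K0 rho0 HM]]]] := M_invertible.
(* [A], [B], [C] and [K] are the constants of [gamma], of [phi], of the parabolic reduction and of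
   the inverse of the boundary solver; the added 1 makes the constant positive. *)
exists (K * (C * (B * A)) + 1); first by rewrite ltr_wpDl // !mulr_ge0 // ltW.
have /nearW_radius[r3 p3 H3] := fast_waves0 k W_integral W_hugoniot.
(* The halves make room for the sum [xik + sk], which is a parameter of both [phi] and the boundary
   solver. *)
exists (Num.min (Num.min r1 (r2 / 2)) (Num.min r3 (d / 2))).
  by rewrite !lt_min p1 p3 !divr_gt0.
move=> up ubar ub sk xik xi xi' s'; rewrite !lt_min.
move=> /andP[/andP[up1 up2] /andP[up3 up4]] /andP[/andP[ba1 ba2] _].
move=> /andP[_ /andP[_ ub4]] /andP[/andP[sk1 sk2] /andP[sk3 sk4]].
move=> /andP[/andP[xk1 xk2] /andP[xk3 xk4]] /andP[/andP[xi1 xi2] /andP[xi3 xi4]].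
move=> [xi'd s'd] ubarE vs b1 b2 l1 l2.
have sum_lt (r : R) : `|xik| < r / 2 -> `|sk| < r / 2 -> `|xik + sk| < r.
  by move=> h1 h2; rewrite (splitr r) (le_lt_trans (ler_normD _ _)) // ltrD.
pose s'' (i : 'I_(h + m)) : R := if i == k then xik + sk else 0.
have [Hinv _] := HM up ub (half _ _ d0 up4) (half _ _ d0 ub4).
have small'' : small_params k d xi s''.
  split; first exact: half xi4.
  by move=> i _; rewrite /s''; case: ifP => _; [exact: sum_lt|rewrite normr0].
have small' : small_params k d xi' s'.
  split; first by move: xi'd; rewrite !lt_min => /andP[_ /andP[_ /half]]; apply.
  by move=> i /s'd; rewrite !lt_min => /andP[_ /andP[_ /half]]; apply.
have {}Hinv := Hinv xi xi' s'' s' small'' small'.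
have fast'' : fast_waves S F W k s'' up = up.
  by apply: H3 => // i ki; rewrite /s'' -val_eqE /= gtn_eqF.
(* Both boundary conditions prescribe the reduction of [ub]; this is what allows the state reached
   from [ubar] to replace the exact solution. *)
have E2 : parabolic_reduction S ub (boundary_solver S F L W k M up xi' s') =
    parabolic_reduction S ub (phi S F L W k M ubar xi xik).
  by rewrite (beta_eq0 b1) -(beta_eq0 b2).
rewrite E2 {1}/boundary_solver fast'' {2}/s'' eqxx in Hinv.
have gam := HA up sk xik up1 _ sk1 xk1 vs l1 l2.
rewrite -ubarE in gam l1 l2; have {}gam := gam ba1.
have ph := HB up ubar (xik + sk) xik xi (half _ _ p2 up2) (half _ _ p2 ba2)
  (sum_lt _ xk2 sk2) (half _ _ p2 xk2) (half _ _ p2 xi2).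
have pr := HC ub (phi S F L W k M up xi (xik + sk)) (phi S F L W k M ubar xi xik).
rewrite sum_small_params /s'' eqxx in Hinv.
have -> : negative_part (varsigma S F W k up sk) = `|varsigma S F W k up sk|.
  by rewrite /negative_part (ltr0_norm vs); apply/max_idPl; rewrite oppr_ge0 ltW.
set T := `|sk| * _ in gam.
have T0 : 0 <= T by rewrite mulr_ge0 // addr_ge0.
rewrite -mulrA -/T.
have e1 : B * `|gamma S F L W k up (xik + sk) - gamma S F L W k ubar xik| <= B * (A * T).
  by rewrite ler_wpM2l.
have e2 := ler_wpM2l C0 (le_trans ph e1).
have e3 := ler_wpM2l (ltW K0) (le_trans pr e2).
have e4 : K * (C * (B * (A * T))) <= (K * (C * (B * A)) + 1) * T.
  by rewrite mulrDl mul1r -!mulrA lerDl.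
apply: le_trans e4; apply: le_trans e3; apply: le_trans Hinv.
rewrite -addrA lerD2l distrC lerD2l le_eqVlt; apply/orP; left; apply/eqP.
apply: eq_bigr => i ki; rewrite -val_eqE /= gtn_eqF // sub0r normrN //.
Qed.
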